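(* Let $\gamma>1$ and let $T:\mathbb{T}\to\mathbb{T}$ be the circle map with parameter $\gamma$ defined in the context. Then $T$ has exponential return and hitting time distributions with respect to $\lambda$: for $\lambda$-almost every $x\in\mathbb{T}$ and every $t\ge0$, $$\lim_{r\to0}F^e_r(t)=e^{-t}\qquad\text{and}\qquad \lim_{r\to0}F^h_r(t)=e^{-t}.$$
   Context: Let $\mathbb{T}=[-1,1]/\!\sim$ be the circle obtained by identifying $-1$ and $1$. For a parameter $\gamma>1$, the continuous map $T:\mathbb{T}\to\mathbb{T}$ is defined implicitly by $$x=\frac{1}{2\gamma}(1+T(x))^{\gamma}\ \text{ if } 0\le x\le \frac1{2\gamma},\qquad x=T(x)+\frac{1}{2\gamma}(1-T(x))^{\gamma}\ \text{ if } \frac1{2\gamma}\le x\le 1,$$ and, for negative values of $x$, by $T(-x)=-T(x)$. The normalized (probability) Lebesgue measure $\lambda$ on $\mathbb{T}$ is $T$-invariant. For $x\in\mathbb{T}$ and $r>0$ let $B_r(x)$ be the ball of radius $r$ around $x$, let $\tau_{B_r(x)}(y)=\min\{n\ge1: T^n y\in B_r(x)\}$, and let $\lambda_r$ be the conditional measure of $\lambda$ on $B_r(x)$. The return and hitting time distributions (depending on $x$) are $$F^e_r(t)=\lambda_r\big(y\in B_r(x):\ \tau_{B_r(x)}(y)\,\lambda(B_r(x))>t\big),\qquad F^h_r(t)=\lambda\big(y\in\mathbb{T}:\ \tau_{B_r(x)}(y)\,\lambda(B_r(x))>t\big).$$ *)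

(* Defs.v *)
From HB Require Import structures.
From mathcomp Require Import all_boot all_order all_algebra.
From mathcomp Require Import all_classical all_reals all_analysis.
From mathcomp Require Import measurable_realfun lra.
Set Implicit Arguments.
Unset Strict Implicit.
Unset Printing Implicit Defensive.
Import Order.TTheory GRing.Theory Num.Theory.
Import numFieldNormedType.Exports.
Local Open Scope classical_set_scope.
Local Open Scope ring_scope.

(** The circle [-1, 1]/~ obtained from [-1, 1] by gluing -1 to 1.  A point is
    stored as its unique representative in [-1, 1[. *)
Record circle (R : realType) := Circle {
  circle_rep : R;
  _ : (-1 <= circle_rep) && (circle_rep < 1)
}.

HB.instance Definition _ (R : realType) := [isSub for @circle_rep R].
HB.instance Definition _ (R : realType) := [Choice of circle R by <:].

Section circle.
Context {R : realType}.
Implicit Types x y z : circle R.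

Lemma circle_repP x : (-1 <= circle_rep x) && (circle_rep x < 1).
Proof. by case: x. Qed.

Fact circle_base_subproof : (-1 <= (-1 : R)) && ((-1 : R) < 1).
Proof. by lra. Qed.

Definition circle_base : circle R := Circle circle_base_subproof.

HB.instance Definition _ := isPointed.Build (circle R) circle_base.

(** The quotient map, meant for arguments in [-1, 1]: it is the identity on
    [-1, 1[ and sends 1 (as well as every real outside [-1, 1]) to -1. *)
Definition circle_proj (a : R) : circle R := insubd circle_base a.

Definition circle_opp x : circle R := circle_proj (- circle_rep x).

(** The arc length distance; the circumference of the circle is 2. *)
Definition circle_dist x y : R :=
  Num.min `|circle_rep x - circle_rep y| (2 - `|circle_rep x - circle_rep y|).

Lemma circle_distxx x : circle_dist x x = 0.
Proof. by rewrite /circle_dist subrr normr0 subr0; apply/min_idPl; lra. Qed.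

Lemma circle_dist_positivity x y : circle_dist x y = 0 -> x = y.
Proof.
move=> d0; apply/val_inj => /=; move: (circle_repP x) (circle_repP y) d0.
rewrite /circle_dist; case: (leP _ (2 - _)) => _ xI yI d0.
  by apply/eqP; rewrite -subr_eq0 -normr_eq0 d0.
by move: d0; case: (ler0P (circle_rep x - circle_rep y)); lra.
Qed.

Lemma circle_dist_sym x y : circle_dist x y = circle_dist y x.
Proof. by rewrite /circle_dist distrC. Qed.

Lemma circle_dist_triangle y x z :
  circle_dist x z <= circle_dist x y + circle_dist y z.
Proof.
move: (circle_repP x) (circle_repP y) (circle_repP z); rewrite /circle_dist.
set a := circle_rep x; set b := circle_rep y; set c := circle_rep z.
move=> aI bI cI; rewrite ge_min.
case: (ler0P (a - b)) => ab; case: (ler0P (b - c)) => bc;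
case: (ler0P (a - c)) => ac;
case: (leP _ (2 - _)) => ?; case: (leP _ (2 - _)) => ?; lra.
Qed.

HB.instance Definition _ := @isMetric.Build R (circle R) circle_dist
  circle_distxx circle_dist_positivity circle_dist_sym circle_dist_triangle.


Lemma circle_opens_setC (A : set (circle R)) :
  <<s @open (circle R) >> A -> <<s @open (circle R) >> (~` A).
Proof. by move=> mA; rewrite -setTD; exact: sigma_algebraCD. Qed.

HB.instance Definition _ := @isMeasurable.Build
  (sigma_display (@open (circle R))) (circle R) <<s @open (circle R) >>
  (@sigma_algebra0 _ setT _) circle_opens_setC
  (@sigma_algebra_bigcup _ setT _).

(** The normalized Lebesgue measure. *)
Definition lambda (A : set (circle R)) : \bar R :=
  ((2^-1)%:E * lebesgue_measure (@circle_rep R @` A))%E.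

Lemma image_circle_repT : @circle_rep R @` setT = `[-1, 1[%classic.
Proof.
apply/seteqP; split=> [_ [x _ <-]|a]/=; rewrite in_itv/=.
  exact: circle_repP.
by move=> aI; exists (Circle aI).
Qed.

Lemma measurable_image_circle_rep (A : set (circle R)) :
  measurable A -> measurable (@circle_rep R @` A).
Proof.
have inj : injective (@circle_rep R) by exact: val_inj.
pose G := [set A | measurable (@circle_rep R @` A)].
suff: <<s @open (circle R) >> `<=` G by exact.
apply: smallest_sub.
  split; rewrite /G/=.
  - by rewrite image_set0.
  - move=> B mB; rewrite setTD.
    rewrite (_ : _ @` _ = `[-1, 1[%classic `\` (@circle_rep R @` B)).
      exact: measurableD.
    rewrite -image_circle_repT; apply/seteqP; split=> [_ [x Bx <-]|a []]/=.
      by split; [exists x|move=> [y By] /inj yx; apply: Bx; rewrite -yx].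
    by move=> [x _ <-] Bx; exists x => // Bx'; apply: Bx; exists x.
  - move=> F mF; rewrite image_bigcup; exact: bigcupT_measurable.
move=> U oU; rewrite /G/=.
pose V := (@circle_rep R @` U) `&` `]-1, 1[%classic.
have oV : open V.
  rewrite openE => _ [[x Ux <-]]/=; rewrite in_itv/= => /andP[x1 x2].
  move: oU; rewrite openE => /(_ _ Ux) /nbhs_ballP[e/= e0 xeU].
  pose d := Num.min e (Num.min (1 + circle_rep x) (1 - circle_rep x)).
  apply/nbhs_ballP; exists d => /=.
    by rewrite /d !lt_min e0/=; lra.
  move=> a; rewrite /ball/= /d !lt_min => /and3P[ae a1 a2].
  have aI : (-1 <= a) && (a < 1).
    move: a1 a2; case: (ler0P (circle_rep x - a)) => ?; lra.
  split; last first.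
    by rewrite /= in_itv/=; move: a1 a2; case: (ler0P (circle_rep x - a)) => ?; lra.
  exists (Circle aI) => //; apply: xeU; rewrite ballEmdist/=.
  rewrite (le_lt_trans _ ae)// /mdist/= /circle_dist/=.
  by rewrite ge_min lexx.
have -> : @circle_rep R @` U =
    V `|` ((@circle_rep R @` U) `&` [set -1]).
  rewrite -setIUr; apply/esym/setIidPl => _ [x Ux <-]/=; rewrite in_itv/=.
  by have /andP[+ ->] := circle_repP x; rewrite le_eqVlt eq_sym andbT =>
    /orP[/eqP ->|->]; [right|left].
apply: measurableU; first exact: open_measurable.
have [U1|U1] := pselect ((@circle_rep R @` U) (-1)).
  by rewrite (_ : _ `&` _ = [set -1])//; apply/setIidPr => _ ->.
by rewrite (_ : _ `&` _ = set0)//; apply/disjoints_subset => a aU /= a1;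
  apply: U1; rewrite -a1.
Qed.

Let lambda0 : lambda set0 = 0%E.
Proof. by rewrite /lambda image_set0 measure0 mule0. Qed.

Let lambda_ge0 A : (0 <= lambda A)%E.
Proof. by rewrite /lambda mule_ge0// lee_fin invr_ge0. Qed.

Let lambda_semi_sigma_additive : semi_sigma_additive lambda.
Proof.
move=> F mF tF mUF; rewrite /lambda image_bigcup.
under eq_fun do rewrite -ge0_sume_distrr//.
apply: cvgeZl => //; apply: measure_semi_sigma_additive.
- by move=> n; exact: measurable_image_circle_rep.
- move=> i j _ _ [_ [[x Fx <-] [y Fy /val_inj yx]]].
  by apply: tF => //; exists x; split=> //; rewrite -yx.
- by apply: bigcupT_measurable => n; exact: measurable_image_circle_rep.
Qed.

HB.instance Definition _ := isMeasure.Build _ _ _ lambda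
  lambda0 lambda_ge0 lambda_semi_sigma_additive.

Let lambda_setT : lambda setT = 1%E.
Proof.
rewrite /lambda image_circle_repT lebesgue_measure_itv/= lte_fin ifT; last lra.
by rewrite -EFinB -EFinM; congr EFin; lra.
Qed.

HB.instance Definition _ := Measure_isProbability.Build _ _ _ lambda lambda_setT.

(** The defining relations of the map with parameter [gamma], every point being
    written as [circle_proj a] with [a] in [-1, 1].  The second relation alone
    may have several solutions [b] (the right-hand side is not monotone on
    [-1, 1] when [gamma > 2]): continuity of [T] singles out the one
    in [0, 1]. *)
Definition is_circle_map (gamma : R) (T : circle R -> circle R) : Prop :=
  [/\ continuous T,
      forall a, 0 <= a <= (2 * gamma)^-1 ->
        exists b, [/\ -1 <= b <= 1, T (circle_proj a) = circle_proj b &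
          a = (2 * gamma)^-1 * (1 + b) `^ gamma],
      forall a, (2 * gamma)^-1 <= a <= 1 ->
        exists b, [/\ -1 <= b <= 1, T (circle_proj a) = circle_proj b &
          a = b + (2 * gamma)^-1 * (1 - b) `^ gamma] &
      forall x, T (circle_opp x) = circle_opp (T x)].

(** The least [n >= 1] such that [T^n y] is in [B], and [+oo] if there is
    none. *)
Definition hitting_time (T : circle R -> circle R) (B : set (circle R))
    (y : circle R) : \bar R :=
  ereal_inf [set n%:R%:E | n in [set n | (1 <= n)%N /\ B (iter n T y)]].

Definition cond_lambda (B A : set (circle R)) : R :=
  fine (lambda (A `&` B)) / fine (lambda B).

Definition return_time_dist (T : circle R -> circle R) (x : circle R) (t r : R)
    : R :=
  cond_lambda (ball x r) [set y | ball x r y /\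
    (t%:E < hitting_time T (ball x r) y * lambda (ball x r))%E].

Definition hitting_time_dist (T : circle R -> circle R) (x : circle R) (t r : R)
    : R :=
  fine (lambda [set y |
    (t%:E < hitting_time T (ball x r) y * lambda (ball x r))%E]).

End circle.

(* Main.v *)
Require Import Defs.
From mathcomp Require Import all_boot all_order all_algebra.
From mathcomp Require Import all_classical all_reals all_analysis.
From mathcomp Require Import measurable_realfun ring lra zify.
Import Order.TTheory GRing.Theory Num.Theory.
Import numFieldNormedType.Exports.
Local Open Scope classical_set_scope.
Local Open Scope ring_scope.
Set Implicit Arguments.
Unset Strict Implicit.
Unset Printing Implicit Defensive.

(** On the representatives in [-1, 1[ the map [T] has two full increasing
    inverse branches whose sum is the identity, so their derivatives add up to
    1 (whence invariance of [lambda]) and compositions of branches are strict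
    contractions.

    Mixing.  The transfer operator preserves nondecreasing functions, and on
    those it decreases the variance by a definite amount as long as the variance
    is not small; hence the variance of the iterates tends to 0 uniformly.

    Distortion.  The fixed point is neutral, but the variation of
    [ln (W_w)], [W_w] being the derivative of the inverse branch coded by the
    word [w], is controlled by the variation of the logarithm of the distance to
    that point, a quantity which the branches contract accordingly.  So [W_w]
    has bounded distortion on the points about to cross from one half of the
    circle to the other, and every crossing halves the length of a cylinder.
    Decomposing a ball [B] into the cylinders that end at the p-th crossing
    gives mixing for [B], up to the boundary of [B] and to the points whose p-th
    crossing is late; the latter are rare as the tail of the excursion times is
    integrable.

    Short returns.  If the centre is not periodic, a return to a small ball
    happens after many crossings, and the quasi-independence of the cylinders
    ending at a crossing makes the short returns negligible.

    Together this yields lambda(B n A_n) = r lambda(A_n) + o(r) uniformly in n,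
    where r = lambda(B) and A_n is the set of points avoiding B at the times
    1, ..., n.  By invariance lambda(B n A_n) = lambda(A_n) - lambda(A_{n+1}), so
    that lambda(A_n) = (1 - r)^n + o(1) uniformly in n. *)

(** * Inverse branches and their distortion *)

(** Near the neutral fixed point cylinders of length n shrink only polynomially in n, and their
    distortion is not uniformly bounded. Counting crossings instead of iterates cures both, at the
    price of a clock problem. A ball of measure r needs p of order log (1 / r) crossings before its
    cylinders are small compared with r. The time allotted to them must be much shorter than 1 / r,
    the scale of the hitting times, whereas an excursion exceeding its share must have measure much
    smaller than r. Both can hold because the measure of the excursions longer than n is O(n^(-1 - 1
    / gamma)), an exponent below -1: with an integer K >= gamma, the choice n = 2^(2 K j) for r
    about 2^(-(2 K + 1) j) leaves room on both sides. Until the circle map itself is treated, the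
    dynamics enters only as a measurable map [S] of the reals satisfying [S_branch], that is,
    inverting both branches. Deriving this for [T] needs an argument, since the implicit equation
    may have a second root; continuity of [T] excludes it. *)

Section branches.
Context {R : realType} (gamma : R) (gamma_gt1 : 1 < gamma).

(** [slope] is the derivative of [bend]; the argument is the distance to the neutral fixed point. *)
Definition slope (u : R) : R := u `^ (gamma - 1) / 2.
Definition bend (u : R) : R := (2 * gamma)^-1 * u `^ gamma.

(* Inverse branches of the circle map on representatives: [branch true] takes
   values in [0, 1] and [branch false] in [-1, 0]. *)
Definition phi (z : R) : R := if z <= 0 then bend (1 + z) else z + bend (1 - z).
Definition branch (d : bool) (z : R) : R := if d then phi z else z - phi z.

(** The derivative of [phi]. The link is made by convexity in [phi_mean_value] and, in integrated
    form, by [mean_dphi_itv]. *)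
Definition dphi (z : R) : R := if z <= 0 then slope (1 + z) else 1 - slope (1 - z).
Definition weight (d : bool) (z : R) : R := if d then dphi z else 1 - dphi z.

Let gamma_gt0 : 0 < gamma. Proof. exact: lt_trans gamma_gt1. Qed.

Ltac glra := move: (gamma_gt1) => ?; lra.

Lemma bendE u : 0 <= u -> bend u = slope u * u / gamma.
Proof.
move=> u0; rewrite /bend /slope -(mulr_powRB1 u0 gamma_gt0).
by field; glra.
Qed.

Lemma slope_ge0 u : 0 <= slope u.
Proof. by rewrite divr_ge0 ?powR_ge0. Qed.

Lemma slope_gt0 u : 0 < u -> 0 < slope u.
Proof. by move=> u0; rewrite divr_gt0 ?powR_gt0. Qed.

Lemma le_slope u v : 0 <= u -> u <= v -> slope u <= slope v.
Proof.
move=> u0 uv; rewrite ler_pM2r ?invr_gt0//.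
by apply: ge0_ler_powR => //; rewrite ?nnegrE; glra.
Qed.

Lemma slope0 : slope 0 = 0.
Proof. by rewrite /slope powR0 ?mul0r//; glra. Qed.

Lemma slope1 : slope 1 = 2^-1.
Proof. by rewrite /slope powR1 mul1r. Qed.

Lemma bend0 : bend 0 = 0.
Proof. by rewrite bendE// slope0 !mul0r. Qed.

Lemma bend1 : bend 1 = (2 * gamma)^-1.
Proof. by rewrite /bend powR1 mulr1. Qed.

Lemma bend_ge0 u : 0 <= bend u.
Proof. by rewrite mulr_ge0 ?powR_ge0// invr_ge0; glra. Qed.

(* Young's inequality with exponents [gamma] and [gamma / (gamma - 1)] *)
Lemma bend_tangent u v : 0 <= u -> 0 <= v -> slope u * (v - u) <= bend v - bend u.
Proof.
move=> u0 v0.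
have := @conjugate_powR R (u `^ (gamma - 1)) v (gamma / (gamma - 1)) gamma
  (powR_ge0 _ _) v0.
rewrite -powRrM mulrCA divff ?mulr1 ?subr_eq0 ?gt_eqF//.
have h1 : 0 < gamma / (gamma - 1) by rewrite divr_gt0; glra.
have h2 : 0 < gamma by glra.
have h3 : (gamma / (gamma - 1))^-1 + gamma^-1 = 1 by field; glra.
move=> /(_ h1 h2 h3) {h1 h2 h3}.
rewrite /bend /slope -(mulr_powRB1 u0 gamma_gt0).
set w := u `^ (gamma - 1); set x := v `^ gamma => Y.
have -> : w / 2 * (v - u) = (w * v - w * u) / 2 by field.
have -> : (2 * gamma)^-1 * x - (2 * gamma)^-1 * (u * w) =
  (u * w / (gamma / (gamma - 1)) + x / gamma - w * u) / 2 by field; glra.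
by rewrite ler_pM2r ?invr_gt0//; glra.
Qed.

Lemma dphiN z : dphi (- z) = 1 - dphi z.
Proof.
rewrite /dphi oppr_le0; have [z0|z0|->] := ltgtP z 0.
- by rewrite opprK.
- by glra.
- by rewrite addr0 subr0 slope1; glra.
Qed.

Lemma phiN z : phi (- z) = phi z - z.
Proof.
rewrite /phi oppr_le0; have [z0|z0|->] := ltgtP z 0.
- by rewrite opprK; glra.
- by rewrite ?opprK; glra.
- by rewrite !subr0 addr0.
Qed.

(** Oddness of the map, read on its inverse branches; it reduces the distortion and contraction
    estimates to the half [-1, 0]. *)
Lemma branchN d z : branch d (- z) = - branch (~~ d) z.
Proof. by case: d; rewrite /= phiN; ring. Qed.

Lemma weightN d z : weight d (- z) = weight (~~ d) z.
Proof. by case: d; rewrite /= dphiN; ring. Qed.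

Lemma le_dphi y z : -1 <= y -> y <= z -> z <= 1 -> dphi y <= dphi z.
Proof.
have h (u v : R) : -1 <= u -> u <= v -> v <= 0 -> dphi u <= dphi v.
  by move=> u1 uv v0; rewrite /dphi v0 (le_trans uv v0) le_slope; glra.
have h' (u v : R) : 0 <= u -> u <= v -> v <= 1 -> dphi u <= dphi v.
  move=> u1 uv v0; rewrite -(opprK u) -(opprK v) (dphiN (- u)) (dphiN (- v)).
  by have := h (- v) (- u); glra.
move=> y1 yz z1; have [z0|z0] := leP z 0; first exact: h.
have [y0|y0] := leP y 0; last by apply: h' => //; glra.
by apply: (@le_trans _ _ (dphi 0)); [apply: h|apply: h'] => //; glra.
Qed.

(** Convexity of [phi]: the tangent inequality of [bend] at both ends on [-1, 0], its mirror image
    on [0, 1], and otherwise a cut at 0, where the monotonicity of [dphi] joins the two. *)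
Lemma phi_mean_value y z : -1 <= y -> y <= z -> z <= 1 ->
  dphi y * (z - y) <= phi z - phi y <= dphi z * (z - y).
Proof.
have h (u v : R) : -1 <= u -> u <= v -> v <= 0 ->
    dphi u * (v - u) <= phi v - phi u <= dphi v * (v - u).
  move=> u1 uv v0; rewrite /dphi /phi v0 (le_trans uv v0).
  have := @bend_tangent (1 + u) (1 + v); have := @bend_tangent (1 + v) (1 + u).
  by glra.
have h' (u v : R) : 0 <= u -> u <= v -> v <= 1 ->
    dphi u * (v - u) <= phi v - phi u <= dphi v * (v - u).
  move=> u1 uv v0; have h0 : -1 <= - v by glra.
  have h1 : - v <= - u by glra.
  have h2 : - u <= 0 by glra.
  by have := h _ _ h0 h1 h2; rewrite !phiN !dphiN; glra.
move=> y1 yz z1; have [z0|z0] := leP z 0; first exact: h.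
have [y0|y0] := leP y 0; last by apply: h' => //; glra.
have /andP[h1 h2] := @h y 0 y1 y0 (lexx 0).
have /andP[h3 h4] := @h' 0 z (lexx 0) (ltW z0) z1.
have d0 : 0 <= 0 - y by glra.
have d1 : 0 <= z - 0 by glra.
have k1 : dphi 0 <= dphi z by apply: le_dphi; glra.
have k2 : dphi y <= dphi 0 by apply: le_dphi; glra.
have := ler_wpM2r d1 k2; have := ler_wpM2r d0 k1; glra.
Qed.

Lemma slope_le_half u : u <= 1 -> slope u <= 2^-1.
Proof.
move=> u1; have [u0|u0] := leP 0 u; first by rewrite -slope1 le_slope.
by rewrite /slope lt0_powR1// mul1r.
Qed.

Lemma dphi_ge0 z : 0 <= dphi z.
Proof.
rewrite /dphi; case: ifPn => z0; first exact: slope_ge0.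
have : slope (1 - z) <= 2^-1 by apply: slope_le_half; glra.
by glra.
Qed.

Lemma dphi_le1 z : dphi z <= 1.
Proof.
rewrite /dphi; case: ifPn => z0; last by have := slope_ge0 (1 - z); glra.
have : slope (1 + z) <= 2^-1 by apply: slope_le_half; glra.
by glra.
Qed.

Lemma weight_ge0 d z : 0 <= weight d z.
Proof. by have := dphi_le1 z; have := dphi_ge0 z; case: d => /=; glra. Qed.

Lemma weight_le1 d z : weight d z <= 1.
Proof. by have := dphi_le1 z; have := dphi_ge0 z; case: d => /=; glra. Qed.

Lemma dphi_gt0 z : -1 < z -> 0 < dphi z.
Proof.
move=> z1; rewrite /dphi; case: ifPn => z0; first by apply: slope_gt0; glra.
have : slope (1 - z) <= 2^-1 by apply: slope_le_half; glra.
by glra.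
Qed.

Lemma dphi_lt1 z : z < 1 -> dphi z < 1.
Proof. by move=> z1; have := @dphi_gt0 (- z); rewrite dphiN; glra. Qed.

Lemma phi_lt y z : -1 <= y -> y < z -> z <= 1 -> phi y < phi z.
Proof.
move=> y1 yz z1; pose m := (y + z) / 2.
have [ym mz] : y < m /\ m < z by split; rewrite /m; glra.
have /andP[h1 _] := phi_mean_value y1 (ltW ym) (ltW (lt_le_trans mz z1)).
have /andP[h2 _] := phi_mean_value (le_trans y1 (ltW ym)) (ltW mz) z1.
have h3 : 0 < dphi m * (z - m).
  by rewrite mulr_gt0 ?dphi_gt0 ?subr_gt0//; glra.
have h4 : 0 <= dphi y * (m - y) by rewrite mulr_ge0 ?dphi_ge0//; glra.
by glra.
Qed.

Lemma branch_lt d y z : -1 <= y -> y < z -> z <= 1 -> branch d y < branch d z.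
Proof.
move=> y1 yz z1; case: d => /=; first exact: phi_lt.
have h1 : phi (- z) < phi (- y) by apply: phi_lt; glra.
by rewrite !phiN in h1; glra.
Qed.

Lemma branch_le d y z : -1 <= y -> y <= z -> z <= 1 -> branch d y <= branch d z.
Proof.
move=> y1; rewrite le_eqVlt => /predU1P[->//|yz] z1.
by apply: ltW; exact: branch_lt.
Qed.

Lemma branchC d z : branch d z + branch (~~ d) z = z.
Proof. by case: d => /=; ring. Qed.

Lemma branch_contr_lt d y z : -1 <= y -> y < z -> z <= 1 ->
  branch d z - branch d y < z - y.
Proof.
move=> y1 yz z1; have := @branch_lt (~~ d) y z y1 yz z1.
by have := branchC d z; have := branchC d y; glra.
Qed.

Lemma phiN1 : phi (-1) = 0.
Proof. by rewrite /phi lerN10 subrr bend0. Qed.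

Lemma phi1 : phi 1 = 1.
Proof. by rewrite /phi ler10 subrr bend0 addr0. Qed.

Lemma phi0 : phi 0 = (2 * gamma)^-1.
Proof. by rewrite /phi lexx addr0 bend1. Qed.

Definition cgamma : R := (2 * gamma)^-1.

Lemma cgamma_gt0 : 0 < cgamma.
Proof. by rewrite invr_gt0; glra. Qed.

Lemma cgamma_lt : cgamma < 2^-1.
Proof. by rewrite ltf_pV2 ?posrE; glra. Qed.

Lemma branch_true_itv z : -1 <= z < 1 -> 0 <= branch true z < 1.
Proof.
move=> /andP[z1 z2]; apply/andP; split.
  by rewrite -phiN1; apply: (branch_le true) => //; glra.
by rewrite -[ltRHS]phi1; apply: phi_lt => //; glra.
Qed.

Lemma branch_false_itv z : -1 <= z < 1 -> -1 <= branch false z < 0.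
Proof.
move=> /andP[z1 z2].
have h1 : branch false (-1) <= branch false z by apply: branch_le; glra.
have h2 : branch false z < branch false 1 by apply: branch_lt; glra.
by move: h1 h2; rewrite /= phiN1 phi1; glra.
Qed.

Lemma branch_itv d z : -1 <= z < 1 -> -1 <= branch d z < 1.
Proof.
move=> zI; case: d; first by have := branch_true_itv zI; glra.
by have := branch_false_itv zI; glra.
Qed.

Lemma branch_sign d z : -1 <= z < 1 -> (0 <= branch d z) = d.
Proof.
move=> zI; case: d; first by have /andP[] := branch_true_itv zI.
by apply/negbTE; rewrite -ltNge; have /andP[] := branch_false_itv zI.
Qed.

(* [hdist e z] is the distance from [z] to the neutral fixed point, as measured
   inside the closed half [0, 1] (for [e = true]) or [-1, 0] of the circle. *)
Definition hdist (e : bool) (z : R) : R := if e then 1 - z else 1 + z.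
Definition in_half (e : bool) (z : R) : bool := 0 < hdist e z <= 1.

Lemma hdistN e z : hdist e (- z) = hdist (~~ e) z.
Proof. by case: e => /=; rewrite ?opprK. Qed.

Lemma in_halfN e z : in_half e (- z) = in_half (~~ e) z.
Proof. by rewrite /in_half hdistN. Qed.

Lemma in_half_itv e z : in_half e z -> -1 < z < 1.
Proof. by case: e; rewrite /in_half /=; lra. Qed.

Lemma in_half_branch d e z : in_half e z -> in_half d (branch d z).
Proof.
move=> /in_half_itv zI; have zI' : -1 <= z < 1 by glra.
have h : branch false (-1) < branch false z by apply: branch_lt; glra.
move: h; rewrite /= phiN1 => h.
case: d; rewrite /in_half /=.
  by have := branch_true_itv zI'; rewrite /=; glra.
by have := branch_false_itv zI'; rewrite /=; glra.
Qed.

Lemma lnB_le (x y : R) : 0 < x -> 0 < y -> ln x - ln y <= (x - y) / y.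
Proof.
move=> x0 y0; rewrite -ln_div ?posrE//.
have -> : x / y = 1 + (x - y) / y by field; rewrite gt_eqF.
apply: le_ln1Dx; rewrite mulrBl divff ?gt_eqF//.
by have := divr_gt0 x0 y0; lra.
Qed.

(** Here [u] and [v] are distances to the fixed point and the branch stays in its half. As
    [u - bend u = u * (1 - slope u / gamma)], the variation of the logarithm of the distance drops
    by that of [ln (1 - slope u / gamma)], which is at least [(slope v - slope u) / gamma]. The log
    weight varies by at most [2 * (slope v - slope u)], since [slope] is at most 1/2. Hence the
    constant [2 * gamma]. *)
Lemma distortion_same u v : 0 < u -> u <= v -> v <= 1 ->
  `|ln (1 - slope u) - ln (1 - slope v)| +
    2 * gamma * `|ln (u - bend u) - ln (v - bend v)|
  <= 2 * gamma * `|ln u - ln v|.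
Proof.
move=> u0 uv v1; have v0 : 0 < v by glra.
have suv : slope u <= slope v by apply: le_slope => //; glra.
have sv : slope v <= 2^-1 by exact: slope_le_half.
have su := slope_ge0 u.
have sg x : 0 <= x -> x <= 2^-1 -> 0 < 1 - x / gamma.
  move=> x0 x2; rewrite subr_gt0 ltr_pdivrMr//; glra.
have bE x : 0 < x -> x - bend x = x * (1 - slope x / gamma).
  by move=> x0; rewrite bendE ?ltW//; field; glra.
have gu : 0 < 1 - slope u / gamma by apply: sg; glra.
have gv : 0 < 1 - slope v / gamma by apply: sg; glra.
rewrite !bE// !lnM ?posrE//.
have h1 : ln (1 - slope u) - ln (1 - slope v) <= 2 * (slope v - slope u).
  have := @lnB_le (1 - slope u) (1 - slope v).
  have -> : 1 - slope u - (1 - slope v) = slope v - slope u by ring.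
  move=> /(_ _ _)/le_trans; apply; [glra|glra|].
  rewrite ler_pdivrMr; last by glra.
  rewrite mulrAC ler_peMl//; glra.
have h2 : 2 * (slope v - slope u) <=
    2 * gamma * (ln (1 - slope u / gamma) - ln (1 - slope v / gamma)).
  have := lnB_le gv gu.
  have -> : 1 - slope v / gamma - (1 - slope u / gamma) =
    - ((slope v - slope u) / gamma) by field; glra.
  rewrite mulNr => h.
  have h' : (slope v - slope u) / gamma <=
      (slope v - slope u) / gamma / (1 - slope u / gamma).
    rewrite ler_pdivlMr// ler_piMr//.
      by rewrite divr_ge0//; glra.
    by rewrite gerBl divr_ge0//; glra.
  have -> : 2 * (slope v - slope u) = 2 * gamma * ((slope v - slope u) / gamma).
    by field; glra.
  by apply: ler_wpM2l; glra.
have h3 : ln (1 - slope v) <= ln (1 - slope u) by rewrite ler_ln ?posrE; glra.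
have h4 : ln u <= ln v by rewrite ler_ln ?posrE.
have h5 : ln (u * (1 - slope u / gamma)) <= ln (v * (1 - slope v / gamma)).
  rewrite ler_ln ?posrE ?mulr_gt0// -!bE//.
  have := @bend_tangent v u (ltW v0) (ltW u0) => h.
  have : slope v * (v - u) <= 2^-1 * (v - u) by apply: ler_wpM2r; glra.
  by glra.
move: h5; rewrite !lnM ?posrE// => h5.
rewrite ger0_norm ?subr_ge0//.
rewrite ler0_norm ?subr_le0//.
rewrite ler0_norm ?subr_le0//.
by glra.
Qed.

(** The log weight varies by [gamma - 1] times the variation of [ln u]. The new distance
    [1 - bend u] stays away from 0, so its logarithm varies by at most
    [(v - u) / (2 * (1 - cgamma))]; [2 * gamma] times this fits into the remaining [gamma + 1]
    because [gamma <= (gamma + 1) * (1 - cgamma)] and [v - u <= ln v - ln u]. *)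
Lemma distortion_switch u v : 0 < u -> u <= v -> v <= 1 ->
  `|ln (slope u) - ln (slope v)| +
    2 * gamma * `|ln (1 - bend u) - ln (1 - bend v)|
  <= 2 * gamma * `|ln u - ln v|.
Proof.
move=> u0 uv v1; have v0 : 0 < v by glra.
have luv : ln u <= ln v by rewrite ler_ln ?posrE.
have lns x : 0 < x -> ln (slope x) = (gamma - 1) * ln x - ln 2.
  by move=> x0; rewrite /slope ln_div ?posrE ?powR_gt0// ln_powR.
have bv : bend v <= cgamma.
  rewrite /bend ler_piMr ?invr_ge0//; first by glra.
  have -> : 1 = 1 `^ gamma :> R by rewrite powR1.
  by apply: ge0_ler_powR => //; rewrite ?nnegrE; glra.
have buv0 : 0 <= bend v - bend u.
  apply: le_trans (bend_tangent (ltW u0) (ltW v0)).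
  by rewrite mulr_ge0 ?slope_ge0//; glra.
have buv : bend v - bend u <= 2^-1 * (v - u).
  have h := @bend_tangent v u (ltW v0) (ltW u0).
  have : slope v * (v - u) <= 2^-1 * (v - u).
    by apply: ler_wpM2r; rewrite ?slope_le_half//; glra.
  by glra.
have c2 := cgamma_lt; have bu := bend_ge0 u; have c0 := cgamma_gt0.
have h1 : ln (1 - bend u) - ln (1 - bend v) <= 2^-1 * (v - u) / (1 - cgamma).
  apply: le_trans (lnB_le _ _) _; [glra|glra|].
  apply: ler_pM; [glra|by rewrite invr_ge0; glra|glra|].
  by rewrite lef_pV2 ?posrE; glra.
have h2 : v - u <= ln v - ln u.
  have := lnB_le u0 v0.
  have : v - u <= (v - u) / v by rewrite ler_peMr ?invf_ge1//; glra.
  have -> : (u - v) / v = - ((v - u) / v) by rewrite -mulNr opprB.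
  by glra.
have h3 : ln (1 - bend v) <= ln (1 - bend u) by rewrite ler_ln ?posrE; glra.
rewrite !lns// (ler0_norm (_ : _ - ln v <= 0)); last by glra.
rewrite (ger0_norm (_ : 0 <= ln (1 - bend u) - _)); last by glra.
rewrite ler0_norm; last first.
  by have := ler_wpM2l (_ : 0 <= gamma - 1) luv; move=> /(_ ltac:(glra)); glra.
have h4 : 2 * gamma * (2^-1 * (v - u) / (1 - cgamma)) <=
    (gamma + 1) * (v - u).
  have -> : 2 * gamma * (2^-1 * (v - u) / (1 - cgamma)) =
    (gamma / (1 - cgamma)) * (v - u) by field; glra.
  apply: ler_wpM2r; first by glra.
  rewrite ler_pdivrMr; last by glra.
  have -> : (gamma + 1) * (1 - cgamma) = gamma + 2^-1 - cgamma.
    by rewrite /cgamma; field; glra.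
  by glra.
have h5 := ler_wpM2l (_ : 0 <= 2 * gamma) h1.
have h6 := ler_wpM2l (_ : 0 <= gamma + 1) h2.
by have := h5 ltac:(glra); have := h6 ltac:(glra); glra.
Qed.

(** [2 * gamma * ln (hdist e z)] acts as a potential: the variation of the log weight is paid by the
    decrease of the variation of the potential, so that the bound telescopes along words. *)
Lemma distortion_step d e s t : in_half e s -> in_half e t ->
  `|ln (weight d s) - ln (weight d t)| +
    2 * gamma * `|ln (hdist d (branch d s)) - ln (hdist d (branch d t))|
  <= 2 * gamma * `|ln (hdist e s) - ln (hdist e t)|.
Proof.
wlog: d e s t / e = false => [hw|->].
  case: e => hs ht; last exact: hw.
  have := hw (~~ d) false (- s) (- t) erefl.
  by rewrite !in_halfN !weightN !branchN !hdistN negbK; exact.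
wlog: s t / s <= t => [hw hs ht|st].
  have [st|/ltW st] := leP s t; first exact: hw.
  by rewrite distrC (distrC (ln (hdist d _))) (distrC (ln (hdist false _))) hw.
rewrite /in_half /= => hs ht.
have [s0 t0] : s <= 0 /\ t <= 0 by split; glra.
case: d; rewrite /= /dphi /phi s0 t0.
  by apply: distortion_switch; glra.
have -> : 1 + (s - bend (1 + s)) = (1 + s) - bend (1 + s) by ring.
have -> : 1 + (t - bend (1 + t)) = (1 + t) - bend (1 + t) by ring.
by apply: distortion_same; glra.
Qed.

End branches.

(** * Compositions of inverse branches along words *)

Section words.
Context {R : realType} (gamma : R) (gamma_gt1 : 1 < gamma).
Local Notation branch := (branch gamma).
Local Notation weight := (weight gamma).
Local Notation cgamma := (cgamma gamma).
Implicit Types (w : seq bool) (d e : bool).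

Ltac glra := move: (gamma_gt1) => ?; lra.

(** The first letter is the outermost branch: the orbit of [wbranch w z] reads [w] from left to
    right and then arrives at [z]. *)
Fixpoint wbranch w (z : R) : R :=
  if w is d :: w' then branch d (wbranch w' z) else z.

(* the derivative of [wbranch w] *)
Fixpoint wweight w (z : R) : R :=
  if w is d :: w' then weight d (wbranch w' z) * wweight w' z else 1.

Fixpoint changes w : nat :=
  if w is d :: w' then
    (if w' is d' :: _ then (d != d') + changes w' else 0)%N
  else 0%N.

Lemma wbranch_itv w z : -1 <= z < 1 -> -1 <= wbranch w z < 1.
Proof. by move=> zI; elim: w => //= d w; exact: branch_itv. Qed.

Lemma wbranch_cat w1 w2 z : wbranch (w1 ++ w2) z = wbranch w1 (wbranch w2 z).
Proof. by elim: w1 => //= d w1 ->. Qed.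

Lemma wweight_ge0 w z : 0 <= wweight w z.
Proof. by elim: w => //= d w ih; rewrite mulr_ge0// weight_ge0. Qed.

Lemma weight_gt0 d z : -1 < z < 1 -> 0 < weight d z.
Proof.
move=> /andP[z1 z2]; case: d => /=; first exact: dphi_gt0.
by rewrite subr_gt0 dphi_lt1.
Qed.

Lemma in_half_wbranch w e z : in_half e z -> in_half (head e w) (wbranch w z).
Proof.
by move=> ez; elim: w => //= d w ih; exact: in_half_branch ih.
Qed.

Lemma wweight_gt0 w e z : in_half e z -> 0 < wweight w z.
Proof.
move=> ez; elim: w => //= d w ih; rewrite mulr_gt0// weight_gt0//.
exact: in_half_itv (in_half_wbranch w ez).
Qed.

Lemma wdistortion w e s t : in_half e s -> in_half e t ->
  `|ln (wweight w s) - ln (wweight w t)| +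
    2 * gamma * `|ln (hdist (head e w) (wbranch w s)) -
                  ln (hdist (head e w) (wbranch w t))|
  <= 2 * gamma * `|ln (hdist e s) - ln (hdist e t)|.
Proof.
move=> es et; elim: w => [|d w ih] /=; first by rewrite subrr normr0 add0r.
have hs := in_half_wbranch w es; have ht := in_half_wbranch w et.
have := distortion_step gamma_gt1 d hs ht.
have gs : 0 < weight d (wbranch w s) by apply: weight_gt0; exact: in_half_itv hs.
have gt : 0 < weight d (wbranch w t) by apply: weight_gt0; exact: in_half_itv ht.
rewrite !lnM ?posrE ?(wweight_gt0 w es) ?(wweight_gt0 w et)//.
set a := ln (weight d _); set b := ln (weight d _).
set a' := ln (wweight _ _); set b' := ln (wweight _ _).
have := ler_normD (a - b) (a' - b').
have -> : a + a' - (b + b') = (a - b) + (a' - b') by ring.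
by move: ih; rewrite -/a' -/b'; lra.
Qed.

Lemma wbranch_itvcc w z : -1 <= z <= 1 -> -1 <= wbranch w z <= 1.
Proof.
move=> zI; elim: w => //= d w ih.
have hd : branch d (-1) <= branch d (wbranch w z) by apply: branch_le; glra.
have hd' : branch d (wbranch w z) <= branch d 1 by apply: branch_le; glra.
by move: hd hd'; case: d => /=; rewrite phiN1// phi1//; glra.
Qed.

Lemma wbranch_lt w y z : -1 <= y -> y < z -> z <= 1 -> wbranch w y < wbranch w z.
Proof.
move=> y1 yz z1; elim: w => //= d w ih.
have hy : -1 <= wbranch w y <= 1 by apply: wbranch_itvcc; glra.
have hz : -1 <= wbranch w z <= 1 by apply: wbranch_itvcc; glra.
by apply: branch_lt => //; glra.
Qed.

Lemma wbranch_le w y z : -1 <= y -> y <= z -> z <= 1 -> wbranch w y <= wbranch w z.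
Proof.
move=> y1; rewrite le_eqVlt => /predU1P[->//|yz] z1.
by apply: ltW; exact: wbranch_lt.
Qed.

Lemma wbranch_contr_le w y z : -1 <= y -> y <= z -> z <= 1 ->
  wbranch w z - wbranch w y <= z - y.
Proof.
move=> y1 yz z1; elim: w => //= d w; apply: le_trans.
have hy : -1 <= wbranch w y <= 1 by apply: wbranch_itvcc; glra.
have hz : -1 <= wbranch w z <= 1 by apply: wbranch_itvcc; glra.
have := wbranch_le w y1 yz z1; rewrite le_eqVlt => /predU1P[->|].
  by rewrite !subrr.
by move=> h; apply: ltW; apply: branch_contr_lt => //; glra.
Qed.

Lemma wbranch_contr_lt w y z : w != [::] -> -1 <= y -> y < z -> z <= 1 ->
  wbranch w z - wbranch w y < z - y.
Proof.
case: w => // d w _ y1 yz z1 /=.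
apply: lt_le_trans (wbranch_contr_le w y1 (ltW yz) z1).
have hy : -1 <= wbranch w y <= 1 by apply: wbranch_itvcc; glra.
have hz : -1 <= wbranch w z <= 1 by apply: wbranch_itvcc; glra.
by apply: branch_contr_lt => //; [glra|exact: wbranch_lt|glra].
Qed.

(** The derivative of a branch that changes half is [slope] of the distance from its argument to the
    fixed point, hence at most 1/2. *)
Lemma branch_switch d e s t : d != e -> in_half e s -> in_half e t -> s <= t ->
  branch d t - branch d s <= (t - s) / 2.
Proof.
wlog: d e s t / e = false => [hw|->].
  case: e; last exact: hw.
  move=> de hs ht st; have := hw (~~ d) false (- t) (- s) erefl.
  rewrite !in_halfN !branchN; case: d {hw} de => //= _ /(_ isT ht hs).
  by rewrite lerN2 => /(_ st); lra.
case: d => // _; rewrite /in_half /= => hs ht st.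
have /andP[_ ] := @phi_mean_value _ _ gamma_gt1 s t ltac:(lra) st ltac:(lra).
have -> : dphi gamma t = slope gamma (1 + t) by rewrite /dphi ifT//; lra.
move=> /le_trans; apply; rewrite mulrC.
by apply: ler_wpM2l; rewrite ?slope_le_half//; lra.
Qed.

(** Each change of letter contributes a factor 1/2 and any other letter a factor at most 1. The half
    [e] of the arguments counts as a last letter, since the innermost branch may switch too. *)
Lemma wbranch_contr w e s t : in_half e s -> in_half e t -> s <= t ->
  wbranch w t - wbranch w s <= 2 ^- changes (rcons w e) * (t - s).
Proof.
move=> es et st; elim: w => [|d w ih]; first by rewrite /= expr0 invr1 mul1r.
have hs := in_half_wbranch w es; have ht := in_half_wbranch w et.
have [s1 t1] := (in_half_itv hs, in_half_itv ht).
have hw : wbranch w s <= wbranch w t.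
  have [es' et'] := (in_half_itv es, in_half_itv et).
  by apply: wbranch_le => //; lra.
have -> : changes (rcons (d :: w) e) =
    ((d != head e w) + changes (rcons w e))%N by case: (w).
have [dw|dw] /= := eqVneq d (head e w).
  apply: le_trans ih.
  have := wbranch_contr_le [:: d] (ltW (andP s1).1) hw (ltW (andP t1).2).
  by [].
have := branch_switch dw hs ht hw => /le_trans; apply.
rewrite exprS invfM -mulrA mulrC; apply: ler_wpM2l => //.
Qed.

(* The cylinder of points whose first two digits are [e] and [~~ e], that is,
   the points of half [e] mapped into the opposite half. *)
Definition core (e : bool) (z : R) : bool :=
  if e then 0 <= z < cgamma else - cgamma <= z < 0.

Lemma core_in_half e z : core e z -> in_half e z.
Proof.
by have := cgamma_lt gamma_gt1; case: e; rewrite /core /in_half /=; lra.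
Qed.

(** A core stays at distance more than 1/2 from the fixed point, where [ln] is 2-Lipschitz. *)
Lemma core_ln_hdist e s t : core e s -> core e t ->
  `|ln (hdist e s) - ln (hdist e t)| <= 2 * `|s - t|.
Proof.
wlog: s t / hdist e t <= hdist e s => [hw es et|st].
  have [st|/ltW st] := leP (hdist e t) (hdist e s); first exact: hw.
  by rewrite distrC [`|s - t|]distrC hw.
move=> es et; have := cgamma_lt gamma_gt1 => c2.
have [s0 t0] : 2^-1 < hdist e s /\ 2^-1 < hdist e t.
  by move: es et; case: (e); rewrite /core /=; lra.
rewrite ger0_norm; last by rewrite subr_ge0 ler_ln ?posrE; lra.
apply: le_trans (lnB_le _ _) _; [lra|lra|].
rewrite ler_pdivrMr; last by lra.
have -> : hdist e s - hdist e t = `|s - t|.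
  move: st; case: (e) => /= st; first by rewrite ler0_norm; lra.
  by rewrite ger0_norm; lra.
by rewrite mulrAC ler_peMl//; lra.
Qed.

Lemma core_wdistortion w e s t : core e s -> core e t ->
  `|ln (wweight w s) - ln (wweight w t)| <= 4 * gamma * `|s - t|.
Proof.
move=> es et; have [hs ht] := (core_in_half es, core_in_half et).
have := wdistortion w hs ht; have := core_ln_hdist es et => h1 h2.
have h3 : 0 <= 2 * gamma * `|ln (hdist (head e w) (wbranch w s)) -
                  ln (hdist (head e w) (wbranch w t))|.
  by rewrite mulr_ge0//; glra.
have := ler_wpM2l (_ : 0 <= 2 * gamma) h1 => /(_ ltac:(glra)).
by lra.
Qed.

Lemma core_dist e s t : core e s -> core e t -> `|s - t| <= cgamma.
Proof.
move=> es et; rewrite ler_norml; move: es et.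
by case: e; rewrite /core /=; lra.
Qed.

(** A core has length [cgamma], and [4 * gamma * cgamma = 2]; this is the origin of the factor
    [expR 2] below. *)
Lemma core_wdistortion2 w e s t : core e s -> core e t ->
  `|ln (wweight w s) - ln (wweight w t)| <= 2.
Proof.
move=> es et; apply: le_trans (core_wdistortion w es et) _.
have := ler_wpM2l (_ : 0 <= 4 * gamma) (core_dist es et) => /(_ ltac:(glra)).
by move=> /le_trans; apply; rewrite /cgamma le_eqVlt; apply/orP; left;
  apply/eqP; field; glra.
Qed.

Lemma core_wweight_le w e s t : core e s -> core e t ->
  wweight w s <= expR 2 * wweight w t.
Proof.
move=> es et; have gs := wweight_gt0 w (core_in_half es).
have gt := wweight_gt0 w (core_in_half et).
rewrite -[leLHS]lnK ?posrE// -[X in _ * X]lnK ?posrE// -expRD ler_expR.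
by have := core_wdistortion2 w es et; rewrite ler_norml; lra.
Qed.

(** The Lipschitz constant is proportional to the weight itself, taken at any reference point [r];
    this makes the mixing error of a cylinder proportional to its measure. *)
Lemma core_wweight_lip w e r s t : core e r -> core e s -> core e t ->
  `|wweight w s - wweight w t| <= 4 * gamma * expR 2 * wweight w r * `|s - t|.
Proof.
wlog: s t / wweight w t <= wweight w s => [hw er es et|st].
  have [st|/ltW st] := leP (wweight w t) (wweight w s); first exact: hw.
  by rewrite distrC [`|s - t|]distrC hw.
move=> er es et; rewrite ger0_norm ?subr_ge0//.
have gs := wweight_gt0 w (core_in_half es).
have gt := wweight_gt0 w (core_in_half et).
have h1 := core_wdistortion w es et.
have h2 := core_wweight_le w es er.
have h3 : 1 - wweight w t / wweight w s <= 4 * gamma * `|s - t|.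
  have -> : wweight w t / wweight w s =
      expR (ln (wweight w t) - ln (wweight w s)).
    by rewrite expRB !lnK ?posrE.
  have := expR_ge1Dx (ln (wweight w t) - ln (wweight w s)).
  by move: h1; rewrite ler_norml; lra.
have -> : wweight w s - wweight w t =
    wweight w s * (1 - wweight w t / wweight w s) by field; rewrite gt_eqF.
apply: (@le_trans _ _ (expR 2 * wweight w r * (4 * gamma * `|s - t|))).
  apply: ler_pM => //; first exact: ltW.
  by rewrite subr_ge0 ler_pdivrMr// mul1r.
by rewrite le_eqVlt; apply/orP; left; apply/eqP; ring.
Qed.

End words.

(** * The transfer operator *)

Section mean.
Context {R : realType}.
Implicit Types (f g h : R -> R) (A B : set R).
Local Notation mu := (@lebesgue_measure R).
Local Notation I := (`[-1, 1[%classic : set R).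

Definition mean f : R := 2^-1 * Rintegral mu I f.

(** Bounded on the whole line and not only on [-1, 1[: the class is then stable under composition
    with any measurable function. *)
Definition bm f : Prop :=
  measurable_fun setT f /\ exists M : R, forall x, `|f x| <= M.

Lemma mu_I : mu I = 2%:E.
Proof.
rewrite lebesgue_measure_itv/= lte_fin ifT; last by lra.
by rewrite -EFinB; congr EFin; lra.
Qed.

Lemma bm_integrable f : bm f -> mu.-integrable I (EFin \o f).
Proof.
move=> [mf [M fM]]; apply: measurable_bounded_integrable => //.
- by rewrite [X in (X < _)%E]mu_I ltry.
- exact: measurable_funTS.
- exists M; split; first by rewrite num_real.
  by move=> N MN x _ /=; apply: le_trans (fM x) (ltW MN).
Qed.

Lemma bm_cst (k : R) : bm (fun=> k).
Proof. by split; [exact: measurable_cst|exists `|k|]. Qed.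

Lemma bmD f g : bm f -> bm g -> bm (fun x => f x + g x).
Proof.
move=> [mf [M fM]] [mg [N gN]]; split; first exact: measurable_funD.
exists (M + N) => x; apply: le_trans (ler_normD _ _) _.
by apply: lerD.
Qed.

Lemma bmM f g : bm f -> bm g -> bm (fun x => f x * g x).
Proof.
move=> [mf [M fM]] [mg [N gN]]; split; first exact: measurable_funM.
by exists (M * N) => x; rewrite normrM ler_pM.
Qed.

Lemma bmN f : bm f -> bm (fun x => - f x).
Proof.
move=> [mf [M fM]]; split; first exact: measurableT_comp.
by exists M => x; rewrite normrN.
Qed.

Lemma bmB f g : bm f -> bm g -> bm (fun x => f x - g x).
Proof. by move=> bf bg; apply: bmD => //; apply: bmN. Qed.

Lemma bm_comp f h : bm f -> measurable_fun setT h -> bm (fun x => f (h x)).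
Proof.
move=> [mf [M fM]] mh; split; first exact: (measurableT_comp mf mh).
by exists M.
Qed.

Lemma bm_indic A : measurable A -> bm (\1_A : R -> R).
Proof.
move=> mA; split; first exact: measurable_indic.
exists 1 => x; rewrite indicE; case: (x \in A) => /=; rewrite ?normr1 ?normr0//.
Qed.

Lemma eq_mean f g : (forall x, -1 <= x < 1 -> f x = g x) -> mean f = mean g.
Proof.
move=> fg; congr (_ * _); apply: eq_Rintegral => x; rewrite inE/= in_itv/=.
exact: fg.
Qed.

Lemma le_mean f g : bm f -> bm g -> (forall x, -1 <= x < 1 -> f x <= g x) ->
  mean f <= mean g.
Proof.
move=> bf bg fg; rewrite /mean ler_pM2l ?invr_gt0//.
by apply: le_Rintegral => //; exact: bm_integrable.
Qed.

Lemma meanD f g : bm f -> bm g -> mean (fun x => f x + g x) = mean f + mean g.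
Proof.
move=> bf bg; rewrite /mean -mulrDr; congr (_ * _).
by apply: RintegralD => //; exact: bm_integrable.
Qed.

Lemma meanZ (k : R) f : bm f -> mean (fun x => k * f x) = k * mean f.
Proof.
move=> bf; rewrite /mean RintegralZl//; first by rewrite mulrCA.
exact: bm_integrable.
Qed.

Lemma mean_cst (k : R) : mean (fun=> k) = k.
Proof. by rewrite /mean Rintegral_cst// [X in fine X]mu_I/=; lra. Qed.

Lemma meanN f : bm f -> mean (fun x => - f x) = - mean f.
Proof.
move=> bf; rewrite -mulN1r -meanZ//; apply: eq_mean => x _.
by rewrite mulN1r.
Qed.

Lemma meanB f g : bm f -> bm g -> mean (fun x => f x - g x) = mean f - mean g.
Proof.
by move=> bf bg; rewrite meanD ?meanN//; exact: bmN.
Qed.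

Lemma mean_ge0 f : bm f -> (forall x, -1 <= x < 1 -> 0 <= f x) -> 0 <= mean f.
Proof.
by move=> bf f0; rewrite -(mean_cst 0); apply: le_mean => //; exact: bm_cst.
Qed.

Definition pr A : R := mean \1_A.

Lemma prE A : measurable A -> pr A = 2^-1 * fine (mu (A `&` I)).
Proof. by move=> mA; rewrite /pr /mean /Rintegral integral_indic. Qed.

Lemma pr_itv (a b : R) : -1 <= a -> a <= b -> b <= 1 ->
  pr [set` `[a, b[] = (b - a) / 2.
Proof.
move=> a1 ab b1; rewrite prE// (_ : _ `&` _ = [set` `[a, b[])//.
  rewrite lebesgue_measure_itv/= lte_fin; move: ab.
  rewrite le_eqVlt => /predU1P[->|->].
    by rewrite ltxx/= subrr mul0r mulr0.
  by rewrite -EFinB/= mulrC.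
by apply/setIidPl => x; rewrite /= !in_itv/=; lra.
Qed.

Lemma pr_ge0 A : measurable A -> 0 <= pr A.
Proof.
by move=> mA; apply: mean_ge0; [exact: bm_indic|move=> x _; rewrite indicE].
Qed.

Lemma mean_cvg (f_ : nat -> R -> R) f (M : R) : (forall n, bm (f_ n)) -> bm f ->
  (forall n x, `|f_ n x| <= M) ->
  (forall x, f_ n x @[n --> \oo] --> f x) ->
  mean (f_ n) @[n --> \oo] --> mean f.
Proof.
move=> bf_ bf fM f_f; apply: cvgM; first exact: cvg_cst.
rewrite /Rintegral.
have [] := @dominated_convergence _ _ _ mu I (measurable_itv _)
  (fun n x => (f_ n x)%:E) (fun x => (f x)%:E) (fun=> M%:E).
- by move=> n; apply/measurable_EFinP/measurable_funTS; exact: (bf_ n).1.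
- by apply/measurable_EFinP/measurable_funTS; exact: bf.1.
- by apply/aeW => x _; apply: cvg_EFin; [exact: nearW|exact: f_f].
- by apply: bm_integrable (bm_cst _).
- by apply/aeW => x n _; rewrite lee_fin.
move=> _ _ h; apply: fine_cvg; rewrite fineK; first exact: h.
by apply: integrable_fin_num => //; exact: bm_integrable.
Qed.

Lemma le_pr A B : measurable A -> measurable B ->
  (forall x, -1 <= x < 1 -> A x -> B x) -> pr A <= pr B.
Proof.
move=> mA mB AB; apply: le_mean; [exact: bm_indic..|move=> x xI].
rewrite !indicE; have [xA|_] := boolP (x \in A); last by [].
by rewrite (mem_set (AB x xI _)) //; rewrite inE in xA.
Qed.

Lemma eq_pr A B : (forall x, -1 <= x < 1 -> A x <-> B x) -> pr A = pr B.
Proof.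
move=> AB; apply: eq_mean => x xI; rewrite !indicE; congr (_%:R).
by congr (nat_of_bool _); apply/idP/idP; rewrite !inE => /(AB x xI).
Qed.

Lemma pr_split A C : measurable A -> measurable C ->
  pr A = pr (A `&` C) + pr (A `&` ~` C).
Proof.
move=> mA mC; have mC' := measurableC mC.
rewrite /pr -meanD; [|by apply/bm_indic/measurableI..].
apply: eq_mean => x _; rewrite !indicE !in_setI in_setC.
by case: (x \in A); case: (x \in C) => /=; rewrite ?addr0 ?add0r.
Qed.

Lemma pr_setU_le A B : measurable A -> measurable B ->
  pr (A `|` B) <= pr A + pr B.
Proof.
move=> mA mB; rewrite /pr -meanD; [|exact: bm_indic..].
apply: le_mean.
- exact/bm_indic/measurableU.
- by apply: bmD; exact: bm_indic.
move=> x _; rewrite !indicE in_setU.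
by case: (x \in A); case: (x \in B) => /=; lra.
Qed.

Lemma pr0 : pr set0 = 0.
Proof.
by rewrite -(mean_cst 0); apply: eq_mean => x _; rewrite indicE in_set0.
Qed.

Lemma pr_full : pr setT = 1.
Proof.
by rewrite -(mean_cst 1); apply: eq_mean => x _; rewrite indicE in_setT.
Qed.

Lemma pr_le1 A : measurable A -> pr A <= 1.
Proof. by move=> mA; rewrite -pr_full; apply: le_pr. Qed.

Lemma pr_sum_le (n : nat) A (F : nat -> set R) : measurable A ->
  (forall k, measurable (F k)) ->
  (forall x, -1 <= x < 1 -> A x -> exists2 k, (k < n)%N & F k x) ->
  pr A <= \sum_(k < n) pr (F k).
Proof.
move=> mA mF; elim: n A mA => [|n ih] A mA AF.
  rewrite big_ord0 -pr0; apply: le_pr => // x xI Ax.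
  by have [] := AF x xI Ax.
rewrite big_ord_recr/=.
apply: (@le_trans _ _ (pr ((A `&` ~` F n) `|` F n))).
  apply: le_pr => //; first by apply: measurableU => //; apply: measurableI => //; exact: measurableC.
  by move=> x _ Ax; have [Fx|nFx] := pselect (F n x); [right|left].
have mA' : measurable (A `&` ~` F n) by apply: measurableI => //; exact: measurableC.
apply: le_trans (pr_setU_le _ _) _ => //; apply: lerD => //; apply: ih => //.
move=> x xI [Ax nFx]; have [k + Fk] := AF x xI Ax.
rewrite ltnS leq_eqVlt => /predU1P[kn|kn]; last by exists k.
by case: nFx; rewrite -kn.
Qed.

Lemma mean_indicM A B : mean (fun x => \1_A x * \1_B x) = pr (A `&` B).
Proof. by apply: eq_mean => x _; rewrite !indicE in_setI -natrM mulnb. Qed.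

End mean.

(** * Invariance of the mean under the transfer operator *)

Section transfer.
Context {R : realType} (gamma : R) (gamma_gt1 : 1 < gamma).
Local Notation phi := (phi gamma).
Local Notation dphi := (dphi gamma).
Local Notation branch := (branch gamma).
Local Notation weight := (weight gamma).
Implicit Types (f g h : R -> R) (A B : set R) (d : bool).

Ltac glra := move: (gamma_gt1) => ?; lra.

Lemma branch_onto a : -1 <= a < 1 ->
  exists2 z, -1 <= z < 1 & branch (0 <= a) z = a.
Proof.
(* Composed with the clipping to [-1, 1], the branch is 1-Lipschitz on the whole line, so that the
   intermediate value theorem applies. *)
move=> aI; pose clip (z : R) : R := if z <= -1 then -1 else if 1 <= z then 1 else z.
have clip_itv z : -1 <= clip z <= 1.
  by rewrite /clip; case: (leP z) => ?; [lra|case: (leP 1) => ?; lra].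
have clip_id z : -1 <= z <= 1 -> clip z = z.
  move=> zI; rewrite /clip; case: (leP z) => ?; [lra|case: (leP 1) => ?; lra].
have clip_lip y z : y <= z -> 0 <= clip z - clip y <= z - y.
  move=> yz; rewrite /clip; case: (leP y (-1)) => ?; case: (leP z (-1)) => ?;
    case: (leP 1 y) => ?; case: (leP 1 z) => ?; lra.
pose d := 0 <= a; pose f z := branch d (clip z).
have f_lip y z : y <= z -> 0 <= f z - f y <= z - y.
  move=> yz; have /andP[h1 h2] := clip_lip _ _ yz.
  have cy := clip_itv y; have cz := clip_itv z.
  have := @wbranch_contr_le _ _ gamma_gt1 [:: d] (clip y) (clip z).
  have := @branch_le _ _ gamma_gt1 d (clip y) (clip z).
  rewrite /= /f => /(_ _ _ _)/[swap] /(_ _ _ _) H K.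
  have := H ltac:(lra) ltac:(lra) ltac:(lra).
  have := K ltac:(lra) ltac:(lra) ltac:(lra).
  by lra.
have cf : continuous f.
  move=> x; apply/cvgrPdist_le => e e0; near=> y.
  apply: (@le_trans _ _ `|x - y|); last first.
    by near: y; apply: cvgr_dist_le => //; exact: cvg_id.
  have [xy|/ltW yx] := leP x y.
    by have fxy := f_lip _ _ xy; rewrite !ler0_norm; lra.
  by have fyx := f_lip _ _ yx; rewrite !ger0_norm; lra.
have cN1 : clip (-1) = -1 by apply: clip_id; lra.
have c1 : clip 1 = 1 by apply: clip_id; lra.
have [] := @IVT _ f (-1) 1 a.
- by lra.
- exact: continuous_subspaceT.
- rewrite /f cN1 c1 /d; rewrite ge_min le_max; case: (leP 0 a) => a0 /=; rewrite phiN1// phi1//; lra.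
move=> z; rewrite in_itv/= => zI faz; exists z; last first.
  by rewrite -[RHS]faz /f clip_id.
suff : z != 1 by move: zI => /andP[-> z1]; rewrite lt_neqAle z1 => ->.
apply/eqP => z1; move: faz; rewrite /f z1 c1 /d.
by case: (leP 0 a) => a0 /=; rewrite phi1//; lra.
Unshelve. all: by end_near. Qed.

Lemma measurable_slope : measurable_fun setT (slope gamma).
Proof.
by apply: measurable_funM => //; exact: measurable_powR.
Qed.

Lemma measurable_bend : measurable_fun setT (bend gamma).
Proof.
by apply: measurable_funM => //; exact: measurable_powR.
Qed.

Let mD1 : measurable_fun setT (fun z : R => 1 + z).
Proof. by apply: measurable_funD => //; exact: measurable_cst. Qed.

Let mB1 : measurable_fun setT (fun z : R => 1 - z).
Proof. by apply: measurable_funB => //; exact: measurable_cst. Qed.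

Let mle0 : measurable_fun setT (fun z : R => z <= 0).
Proof. by apply: measurable_fun_ler => //; exact: measurable_cst. Qed.

Lemma measurable_phi : measurable_fun setT phi.
Proof.
apply: measurable_fun_ifT => //.
  exact: measurableT_comp measurable_bend mD1.
by apply: measurable_funD => //; exact: measurableT_comp measurable_bend mB1.
Qed.

Lemma measurable_dphi : measurable_fun setT dphi.
Proof.
apply: measurable_fun_ifT => //.
  exact: measurableT_comp measurable_slope mD1.
apply: measurable_funB => //.
exact: measurableT_comp measurable_slope mB1.
Qed.

Lemma measurable_branch d : measurable_fun setT (branch d).
Proof.
case: d; first exact: measurable_phi.
by apply: measurable_funB => //; exact: measurable_phi.
Qed.

Lemma bm_weight d : bm (weight d).
Proof.
split.
  case: d; first exact: measurable_dphi.
  apply: measurable_funB => //.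
  exact: measurable_dphi.
by exists 1 => x; rewrite ger0_norm ?weight_ge0 ?weight_le1.
Qed.

Definition transfer f (z : R) : R :=
  weight true z * f (branch true z) + weight false z * f (branch false z).

Lemma bm_transfer f : bm f -> bm (transfer f).
Proof.
by move=> bf; apply: bmD; apply: bmM; (exact: bm_weight) ||
  (apply: bm_comp => //; exact: measurable_branch).
Qed.

Lemma bm_iter_transfer n f : bm f -> bm (iter n transfer f).
Proof. by move=> bf; elim: n => //= n; exact: bm_transfer. Qed.

Lemma indic_itv (a b z : R) : \1_[set` `[a, b[] z = ((a <= z) && (z < b))%:R :> R.
Proof. by rewrite indicE mem_setE in_itv. Qed.

(* Both sides are additive in the interval and lie between [dphi a * (b - a)]
   and [dphi b * (b - a)]; bisecting the interval halves the error bound. *)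
Lemma mean_dphi_itv (a b : R) : -1 <= a -> a <= b -> b <= 1 ->
  mean (fun z => dphi z * \1_[set` `[a, b[] z) = (phi b - phi a) / 2.
Proof.
pose G (a b : R) := mean (fun z => dphi z * \1_[set` `[a, b[] z).
have bG (u v : R) : bm (fun z => dphi z * \1_[set` `[u, v[] z).
  by apply: bmM; [exact: (bm_weight true)|exact: bm_indic].
have GD (u v w : R) : u <= v -> v <= w -> G u w = G u v + G v w.
  move=> uv vw; rewrite /G -meanD//; apply: eq_mean => z _.
  rewrite -mulrDr !indic_itv; congr (_ * _).
  by case: (leP u z); case: (ltP z v); case: (ltP z w); case: (leP v z) => //=;
    rewrite ?addr0 ?add0r//; lra.
have Gb (u v : R) : -1 <= u -> u <= v -> v <= 1 ->
    dphi u * (v - u) / 2 <= G u v <= dphi v * (v - u) / 2.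
  move=> u1 uv v1; rewrite -!mulrA -(pr_itv u1 uv v1) /pr.
  have bI : bm (\1_[set` `[u, v[] : R -> R) by exact: bm_indic.
  rewrite -!meanZ//; apply/andP; split; apply: le_mean => //.
  - by apply: bmM => //; exact: bm_cst.
  - move=> z zI; rewrite indic_itv; case: andP => [[uz zv]|_]; last by rewrite !mulr0.
    by rewrite !mulr1 le_dphi//; glra.
  - by apply: bmM => //; exact: bm_cst.
  - move=> z zI; rewrite indic_itv; case: andP => [[uz zv]|_]; last by rewrite !mulr0.
    by rewrite !mulr1 le_dphi//; glra.
have key n (u v : R) : -1 <= u -> u <= v -> v <= 1 ->
    `|G u v - (phi v - phi u) / 2| <= (dphi v - dphi u) * (v - u) / 2 ^+ n.
  elim: n u v => [|n ih] u v u1 uv v1.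
    rewrite expr0 divr1.
    have := Gb u v u1 uv v1; have := phi_mean_value gamma_gt1 u1 uv v1.
    have : dphi u * (v - u) <= dphi v * (v - u).
      by apply: ler_wpM2r; [|apply: le_dphi => //]; glra.
    by rewrite ler_norml; lra.
  pose m := (u + v) / 2; have [um mv] : u <= m /\ m <= v by split; rewrite /m; lra.
  rewrite (GD u m v)//.
  have h1 := ih u m u1 um ltac:(lra); have h2 := ih m v ltac:(lra) mv v1.
  have -> : G u m + G m v - (phi v - phi u) / 2 =
    (G u m - (phi m - phi u) / 2) + (G m v - (phi v - phi m) / 2) by ring.
  apply: le_trans (ler_normD _ _) _; apply: le_trans (lerD h1 h2) _.
  have -> : m - u = (v - u) / 2 by rewrite /m; field.
  have -> : v - m = (v - u) / 2 by rewrite /m; field.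
  rewrite exprS le_eqVlt; apply/orP; left; apply/eqP; field.
  by rewrite expf_neq0.
move=> a1 ab b1; apply/eqP; rewrite -subr_eq0 -normr_le0.
apply/ler_addgt0Pr => e e0; rewrite add0r.
have [n hn] : exists n, 2 < e * 2 ^+ n.
  have [n hn] : exists n : nat, 2 / e < n%:R.
    by exists (Num.truncn (2 / e)).+1; exact: truncnS_gt.
  exists n; rewrite mulrC -ltr_pdivrMr//; apply: lt_le_trans hn _.
  by rewrite -natrX ler_nat ltnW// ltn_expl.
apply: le_trans (key n a b a1 ab b1) _.
rewrite ler_pdivrMr ?exprn_gt0//; apply: le_trans (ltW hn).
have hb : dphi b - dphi a <= 1.
  by have := dphi_le1 gamma_gt1 b; have := dphi_ge0 gamma_gt1 a; glra.
have hb0 : 0 <= dphi b - dphi a by rewrite subr_ge0 le_dphi.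
rewrite -[leRHS]mul1r; apply: ler_pM => //; lra.
Qed.

Lemma indic_ray (a z : R) : (\1_(`]-oo, a[%classic) : R -> R) z = (z < a)%R%:R :> R.
Proof. by rewrite indicE mem_setE in_itv. Qed.

(** The branch into the half of [a] reaches [a] exactly at [z0]; the image of the other branch lies
    wholly below [a] if [0 <= a] and wholly above it otherwise. *)
Lemma transfer_ray (a z0 z : R) : -1 <= z0 < 1 -> branch (0 <= a) z0 = a ->
  -1 <= z < 1 ->
  transfer (\1_(`]-oo, a[%classic) : R -> R) z = if 0 <= a
    then dphi z * \1_[set` `[-1, z0[] z + (1 - dphi z)
    else (1 - dphi z) * \1_[set` `[-1, z0[] z.
Proof.
move=> z0I az zI; rewrite /transfer /= !indic_ray indic_itv.
have sgn d : (branch d z < branch d z0) = (z < z0).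
  apply/idP/idP => [|zz]; last by apply: branch_lt; glra.
  by apply: contraTT; rewrite -!leNgt => zz; apply: branch_le; glra.
have /andP[_ bf] := branch_false_itv gamma_gt1 zI.
have /andP[bt _] := branch_true_itv gamma_gt1 zI.
have := sgn (0 <= a); rewrite az; case: (leP 0 a) => a0 /= ->.
  have -> : z - phi z < a by move: bf => /=; lra.
  by rewrite (andP zI).1 mulr1.
have -> : phi z < a = false.
  by apply/negbTE; rewrite -leNgt; move: bt => /=; lra.
by rewrite (andP zI).1 mulr0 add0r.
Qed.

(** Invariance on a generating pi-system. For [a] in [-1, 1[ with preimage [z0] it reduces to the
    integral of [dphi] over [-1, z0[, since [a] is [phi z0] or [z0 - phi z0]. *)
Lemma mean_transfer_ray (a : R) :
  mean (transfer (\1_(`]-oo, a[%classic) : R -> R)) = mean (\1_(`]-oo, a[%classic) : R -> R).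
Proof.
have [a1|a1] := leP a (-1).
  apply: eq_mean => z zI; rewrite /transfer !indic_ray !ltNge.
  have := @branch_itv _ _ gamma_gt1 true z zI.
  have := @branch_itv _ _ gamma_gt1 false z zI => /= hf ht.
  by rewrite /= !(le_trans a1)/=; lra.
have [a2|a2] := leP 1 a.
  apply: eq_mean => z zI; rewrite /transfer !indic_ray.
  have := @branch_itv _ _ gamma_gt1 true z zI.
  have := @branch_itv _ _ gamma_gt1 false z zI => /= hf ht.
  by rewrite /= !(lt_le_trans _ a2)/=; lra.
have aI : -1 <= a < 1 by lra.
have [z0 z0I az] := branch_onto aI.
rewrite (eq_mean (fun z => @transfer_ray a z0 z z0I az)).
have -> : mean (\1_(`]-oo, a[%classic) : R -> R) = (a + 1) / 2.
  have <- : pr [set` `[-1, a[] = (a + 1) / 2 by rewrite pr_itv; lra.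
  by apply: eq_mean => z /andP[z1 _]; rewrite indic_ray indic_itv z1.
have bI : bm (\1_[set` `[-1, z0[] : R -> R) by exact: bm_indic.
have bd := bm_weight true; have bd' := bm_weight false.
have mz : mean (fun z => dphi z * \1_[set` `[-1, z0[] z) = phi z0 / 2.
  by rewrite mean_dphi_itv ?phiN1 ?subr0//; lra.
have m1 : mean dphi = 2^-1.
  rewrite -[RHS]mul1r -[X in X / _](phi1 gamma_gt1) -[X in X / _]subr0.
  rewrite -(phiN1 gamma_gt1) -mean_dphi_itv; [|lra..].
  by apply: eq_mean => z zI; rewrite indic_itv zI mulr1.
case: (leP 0 a) az => a0 /= az.
  rewrite meanD//; last exact: bmM.
  by rewrite meanB ?mean_cst//; [|exact: bm_cst]; rewrite mz m1 az; lra.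
under eq_fun do rewrite mulrBl mul1r.
rewrite meanB//; last exact: bmM.
by rewrite mz -/(pr _) pr_itv; lra.
Qed.

Lemma transfer_cst (k : R) z : transfer (fun=> k) z = k.
Proof. by rewrite /transfer /=; ring. Qed.

Lemma transferD f g z : transfer (fun x => f x + g x) z = transfer f z + transfer g z.
Proof. by rewrite /transfer; ring. Qed.

Lemma transferZ k f z : transfer (fun x => k * f x) z = k * transfer f z.
Proof. by rewrite /transfer; ring. Qed.

Lemma transferB f g z : transfer (fun x => f x - g x) z = transfer f z - transfer g z.
Proof. by rewrite /transfer; ring. Qed.

Lemma transfer_itv f (a b : R) z : (forall x, -1 <= x < 1 -> a <= f x <= b) ->
  -1 <= z < 1 -> a <= transfer f z <= b.
Proof.
move=> fab zI.
have := fab _ (branch_itv gamma_gt1 true zI).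
have := fab _ (branch_itv gamma_gt1 false zI).
rewrite /transfer => /andP[h1 h2] /andP[h3 h4].
have t0 := weight_ge0 gamma_gt1 true z; have f0 := weight_ge0 gamma_gt1 false z.
have := ler_wpM2l t0 h3; have := ler_wpM2l t0 h4.
have := ler_wpM2l f0 h1; have := ler_wpM2l f0 h2.
by rewrite /=; lra.
Qed.

Lemma mean_transferC A : measurable A -> mean (transfer \1_A) = mean \1_A ->
  mean (transfer \1_(~` A)) = mean \1_(~` A).
Proof.
move=> mA h; have bA := bm_indic mA.
have e z : \1_(~` A) z = 1 - \1_A z :> R.
  by rewrite !indicE in_setC; case: (z \in A) => /=; ring.
have -> : \1_(~` A) = (fun z => 1 - \1_A z) :> (R -> R) by apply/funext.
rewrite meanB//; last exact: bm_cst.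
rewrite -h -meanB//; [|exact: bm_cst|exact: bm_transfer].
by apply: eq_mean => z _; rewrite transferB transfer_cst.
Qed.

Lemma mean_sum (n : nat) (F : nat -> R -> R) : (forall k, bm (F k)) ->
  bm (fun x => \sum_(k < n) F k x) /\
  mean (fun x => \sum_(k < n) F k x) = \sum_(k < n) mean (F k).
Proof.
move=> bF; elim: n => [|n [ih1 ih2]].
  under eq_fun do rewrite big_ord0.
  by rewrite big_ord0 mean_cst; split=> //; exact: bm_cst.
under eq_fun do rewrite big_ord_recr.
by rewrite big_ord_recr/= meanD// ih2; split=> //; exact: bmD.
Qed.

Lemma mean_transfer_bigcup (F : nat -> set R) : (forall n, measurable (F n)) ->
  trivIset setT F -> (forall n, mean (transfer \1_(F n)) = mean \1_(F n)) ->
  mean (transfer \1_(\bigcup_k F k)) = mean \1_(\bigcup_k F k).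
Proof.
move=> mF tF hF; have bF k := bm_indic (mF k).
pose f_ n (x : R) : R := \sum_(k < n) \1_(F k) x.
have bf n : bm (f_ n) by exact: (mean_sum n bF).1.
have mU : measurable (\bigcup_k F k) by exact: bigcupT_measurable.
have f1 n x : x \notin \bigcup_k F k -> f_ n x = 0.
  move=> xF; rewrite /f_ big1// => k _; rewrite indicE; case: (boolP (_ \in _)) => //.
  by rewrite inE => Fx; move: xF; rewrite notin_setE => -[]; exists k.
have f2 m n x : F m x -> f_ n x = (m < n)%N%:R.
  move=> Fmx; rewrite /f_; have [mn|nm] := ltnP m n.
    rewrite (bigD1 (Ordinal mn))//= indicE mem_set// big1 ?addr0// => k kn.
    rewrite indicE; case: (boolP (_ \in _)) => //; rewrite inE => Fkx.
    move: kn; rewrite -val_eqE/= => /eqP[].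
    by apply: tF => //; exists x.
  rewrite big1// => k _; rewrite indicE; case: (boolP (_ \in _)) => //.
  rewrite inE => Fkx; have : (k : nat) = m by apply: tF => //; exists x.
  by move=> km; move: (ltn_ord k); rewrite km ltnNge nm.
have f_b n x : `|f_ n x| <= 1.
  have [xU|xU] := boolP (x \in \bigcup_k F k); last by rewrite f1 ?normr0.
  move: xU; rewrite inE => -[m _ Fx]; rewrite (f2 m)//.
  by case: (m < n)%N; rewrite /= ?normr1 ?normr0.
have f_cvg x : f_ n x @[n --> \oo] --> (\1_(\bigcup_k F k) x : R).
  have [xU|xU] := boolP (x \in \bigcup_k F k).
    rewrite indicE xU; move: xU; rewrite inE => -[m _ Fx].
    apply: cvg_near_cst; exists m.+1 => // n /= mn.
    by rewrite (f2 m)// mn.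
  by rewrite indicE (negbTE xU); apply: cvg_near_cst; exists 0%N => // n _ /=; rewrite f1.
have c1 : mean (f_ n) @[n --> \oo] --> mean \1_(\bigcup_k F k).
  by apply: (mean_cvg (M := 1)) => //; exact: bm_indic.
have c2 : mean (transfer (f_ n)) @[n --> \oo] --> mean (transfer \1_(\bigcup_k F k)).
  apply: (mean_cvg (M := 2)).
  - by move=> n; exact: bm_transfer.
  - by apply: bm_transfer; exact: bm_indic.
  - move=> n x; rewrite /transfer; apply: le_trans (ler_normD _ _) _.
    rewrite !normrM !(ger0_norm (weight_ge0 _ _ _))//.
    rewrite -[leRHS]/(1 + 1); apply: lerD;
      by rewrite mulr_ile1 ?weight_ge0 ?weight_le1.
  - move=> x; apply: cvgD; apply: cvgM; by [exact: cvg_cst|exact: f_cvg].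
apply/esym/(cvg_unique _ c1).
  exact: norm_hausdorff.
suff : (fun n => mean (f_ n)) = (fun n => mean (transfer (f_ n))) by move->.
apply/funext => n; rewrite /f_ (mean_sum n bF).2.
have bTF k : bm (transfer \1_(F k)) by exact: bm_transfer.
under eq_bigr do rewrite -hF.
rewrite -(mean_sum n bTF).2; apply: eq_mean => z _.
by rewrite /transfer !big_distrr -big_split.
Qed.

Lemma mean_transfer_indic A : measurable A -> mean (transfer \1_A) = mean \1_A.
Proof.
move=> mA.
apply: (@dynkin_induction _ (measurableTypeR R) (@RGenInftyO.G R)
  (fun A : set R => mean (transfer \1_A) = mean \1_A)).
- exact: RGenInftyO.measurableE.
- move=> _ _ [x ->] [y ->]; exists (Num.min x y).
  apply/seteqP; split => z; rewrite /= !in_itv/= lt_min; first by move=> [-> ->].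
  by move=> /andP[].
- by apply: eq_mean => z zI; rewrite /transfer !indicT/=; ring.
- by move=> _ [x ->]; exact: mean_transfer_ray.
- exact: mean_transferC.
- exact: mean_transfer_bigcup.
- suff : (RGenInftyO.G (R:=R)).-sigma.-measurable A by [].
  by rewrite -RGenInftyO.measurableE.
Qed.

(* Binary digits of [f]: replacing [f] by [2 f - 1_{f >= 1/2}] halves the error. *)
Lemma mean_transfer01 n f : bm f -> (forall x, 0 <= f x <= 1) ->
  `|mean (transfer f) - mean f| <= 2 ^- n.
Proof.
elim: n f => [|n ih] f bf f01.
  rewrite expr0 invr1.
  have h g : bm g -> (forall x, -1 <= x < 1 -> 0 <= g x <= 1) -> 0 <= mean g <= 1.
    move=> bg g01; rewrite mean_ge0//=; last by move=> x /g01 /andP[].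
    rewrite -(mean_cst 1); apply: le_mean => //; first exact: bm_cst.
    by move=> x /g01 /andP[].
  have := h f bf (fun x _ => f01 x).
  have := h (transfer f) (bm_transfer bf) (fun x => transfer_itv (fun x _ => f01 x)).
  by rewrite ler_norml; lra.
pose A := f @^-1` [set` `[2^-1, +oo[].
have mA : measurable A.
  by rewrite -[A]setTI; apply: bf.1 => //; exact: measurable_itv.
have AE x : \1_A x = (2^-1 <= f x)%R%:R :> R.
  have -> : 2^-1 <= f x = (x \in A); last by rewrite indicE.
  by apply/idP/idP; rewrite inE /A /= in_itv/= andbT.
pose g x := 2 * f x - \1_A x.
have bA := bm_indic mA.
have bf2 : bm (fun x => 2 * f x) by apply: bmM => //; exact: bm_cst.
have bg : bm g by exact: bmB.
have g01 x : 0 <= g x <= 1.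
  by rewrite /g AE; have := f01 x; case: (leP 2^-1 (f x)) => /= ? ?; lra.
have fE : f = (fun x => 2^-1 * (g x + \1_A x)).
  by apply/funext => x; rewrite /g subrK mulKf.
have bgA : bm (fun x => g x + \1_A x) by exact: bmD.
have -> : mean f = 2^-1 * (mean g + pr A) by rewrite {1}fE meanZ// meanD.
have -> : mean (transfer f) = 2^-1 * (mean (transfer g) + pr A).
  rewrite /pr -mean_transfer_indic// -meanD; [|exact: bm_transfer..].
  rewrite -meanZ; last by apply: bmD; exact: bm_transfer.
  by apply: eq_mean => z _; rewrite {1}fE transferZ transferD.
rewrite -mulrBr opprD addrACA subrr addr0 normrM ger0_norm ?invr_ge0// exprS invfM.
by apply: ler_wpM2l; [rewrite invr_ge0|exact: ih].
Qed.

Lemma mean_transfer f : bm f -> mean (transfer f) = mean f.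
Proof.
move=> bf; have [mf [M fM]] := bf.
have M0 : 0 <= M by apply: le_trans (fM 0).
(* With this scaling [k * f] is at most 1/2 in absolute value, so that [g] takes its values in
   [0, 1]. *)
pose k := (2 * (M + 1))^-1.
have k0 : 0 < k by rewrite invr_gt0; lra.
pose g x := k * f x + 2^-1.
have bkf : bm (fun x => k * f x) by apply: bmM => //; exact: bm_cst.
have bg : bm g by apply: bmD => //; exact: bm_cst.
have g01 x : 0 <= g x <= 1.
  have : `|k * f x| <= 2^-1.
    rewrite normrM gtr0_norm// mulrC ler_pdivrMr; last by lra.
    by apply: le_trans (fM x) _; lra.
  by rewrite ler_norml /g; lra.
have hg : mean (transfer g) = mean g.
  apply/eqP; rewrite -subr_eq0 -normr_le0; apply/ler_addgt0Pr => e e0.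
  rewrite add0r; have [n hn] : exists n : nat, e^-1 < n%:R.
    by exists (Num.truncn e^-1).+1; exact: truncnS_gt.
  apply: le_trans (mean_transfer01 n bg g01) _.
  rewrite -[leRHS]invrK lef_pV2 ?posrE ?invr_gt0 ?exprn_gt0//.
  apply: ltW; apply: lt_le_trans hn _.
  by rewrite -natrX ler_nat ltnW// ltn_expl.
have : mean (transfer g) = k * mean (transfer f) + 2^-1.
  rewrite -meanZ; last exact: bm_transfer.
  rewrite -[X in _ + X]mean_cst -meanD; last exact: bm_cst.
    by apply: eq_mean => z _; rewrite transferD transferZ transfer_cst.
  by apply: bmM; [exact: bm_cst|exact: bm_transfer].
rewrite hg /g meanD//; last exact: bm_cst.
rewrite mean_cst meanZ// => /addIr /mulfI h; apply/esym/h.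
by rewrite gt_eqF.
Qed.

End transfer.

(** * Mixing *)

Section mixing.
Context {R : realType} (gamma : R) (gamma_gt1 : 1 < gamma).
Local Notation phi := (phi gamma).
Local Notation dphi := (dphi gamma).
Local Notation transfer := (transfer gamma).
Implicit Types (f g h : R -> R) (A B : set R) (d : bool).

Ltac glra := move: (gamma_gt1) => ?; lra.

Definition ndecr f := forall y z : R, -1 <= y -> y <= z -> z < 1 -> f y <= f z.

Definition var f : R := mean (fun z => f z ^+ 2) - mean f ^+ 2.

Lemma bmX2 f : bm f -> bm (fun z => f z ^+ 2).
Proof.
by move=> bf; under eq_fun do rewrite expr2; exact: bmM.
Qed.

Lemma var_center f (a : R) : bm f ->
  var f = mean (fun z => (f z - a) ^+ 2) - (mean f - a) ^+ 2.
Proof.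
move=> bf; have b2 := bmX2 bf.
have -> : mean (fun z => (f z - a) ^+ 2) =
    mean (fun z => f z ^+ 2 + ((- 2 * a) * f z + a ^+ 2)).
  by apply: eq_mean => z _; ring.
have bc (k : R) : bm (fun=> k) by exact: bm_cst.
have bk : bm (fun z => -2 * a * f z) by exact: bmM.
rewrite meanD//; last exact: bmD.
by rewrite meanD// meanZ// mean_cst /var; ring.
Qed.

(** Increasing [z] moves both preimages up and shifts weight to the upper one, where [f] is
    larger. *)
Lemma ndecr_transfer f : ndecr f -> ndecr (transfer f).
Proof.
move=> nf y z y1 yz z1; rewrite /transfer /=.
have yI : -1 <= y < 1 by lra.
have zI : -1 <= z < 1 by lra.
have /andP[t1 t2] := branch_true_itv gamma_gt1 zI.
have /andP[u1 u2] := branch_false_itv gamma_gt1 zI.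
have /andP[t3 t4] := branch_true_itv gamma_gt1 yI.
have /andP[u3 u4] := branch_false_itv gamma_gt1 yI.
have ht := branch_le gamma_gt1 true y1 yz (ltW z1).
have hf := branch_le gamma_gt1 false y1 yz (ltW z1).
move: t1 t2 u1 u2 t3 t4 u3 u4 ht hf => /= t1 t2 u1 u2 t3 t4 u3 u4 ht hf.
have h1 : f (phi y) <= f (phi z) by apply: nf; lra.
have h2 : f (y - phi y) <= f (z - phi z) by apply: nf; lra.
have h3 : f (y - phi y) <= f (phi y) by apply: nf; lra.
have h4 : dphi y <= dphi z by apply: le_dphi; glra.
have p1 := ler_wpM2l (dphi_ge0 gamma_gt1 z) h1.
have p2 := ler_wpM2l (_ : 0 <= 1 - dphi z) h2.
have p3 : 0 <= (dphi z - dphi y) * (f (phi y) - f (y - phi y)).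
  by apply: mulr_ge0; lra.
have := p2 ltac:(by have := dphi_le1 gamma_gt1 z; lra).
by lra.
Qed.

(** [transfer f z] averages [f] over the two preimages of [z] with weights [dphi z] and
    [1 - dphi z]; the loss of variance is the mean of the variances of these two-point laws. *)
Lemma var_transfer f : bm f -> var f - var (transfer f) =
  mean (fun z => dphi z * (1 - dphi z) * (f (phi z) - f (z - phi z)) ^+ 2).
Proof.
move=> bf; have bP := bm_transfer gamma_gt1 bf.
have -> : var f - var (transfer f) =
    mean (fun z => f z ^+ 2) - mean (fun z => transfer f z ^+ 2).
  by rewrite /var (mean_transfer gamma_gt1 bf); ring.
rewrite -(mean_transfer gamma_gt1 (bmX2 bf)) -meanB.
- by apply: eq_mean => z _; rewrite /transfer /=; ring.
- exact/bm_transfer/bmX2.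
- exact: bmX2.
Qed.

Lemma var_transfer_le f : bm f -> var (transfer f) <= var f.
Proof.
move=> bf; rewrite -subr_ge0 var_transfer//.
have bd := bm_weight gamma_gt1 true.
have bd' := bm_weight gamma_gt1 false.
apply: mean_ge0.
  apply: bmM; first exact: bmM.
  by apply: bmX2; apply: bmB; apply: bm_comp => //;
    [exact: (measurable_branch _ true)|exact: (measurable_branch _ false)].
move=> z zI; rewrite mulr_ge0 ?sqr_ge0// mulr_ge0//.
  exact: dphi_ge0.
by rewrite subr_ge0; exact: dphi_le1.
Qed.

(** After centring at [f (- d)], the middle part contributes at most the squared oscillation between
    [- d] and [d], and the two end pieces at most their measure [1 - d]. *)
Lemma var_le f (d : R) : bm f -> ndecr f -> 0 < d < 1 ->
  (forall z, -1 <= z < 1 -> 0 <= f z <= 1) ->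
  var f <= (f d - f (- d)) ^+ 2 + (1 - d).
Proof.
move=> bf nf dI f01; rewrite (var_center (f (- d)) bf).
apply: (@le_trans _ _ (mean (fun z => (f z - f (- d)) ^+ 2))).
  by rewrite gerBl sqr_ge0.
have bI (a b : R) : bm (\1_[set` `[a, b[] : R -> R) by exact: bm_indic.
pose D := (f d - f (- d)) ^+ 2.
have <- : mean (fun z => D + (\1_[set` `[-1, - d[] z + \1_[set` `[d, 1[] z)) =
    D + (1 - d).
  rewrite meanD//; [|exact: bm_cst|exact: bmD].
  rewrite mean_cst meanD// -/(pr _) -/(pr _) !pr_itv; lra.
apply: le_mean.
- by apply: bmX2; apply: bmB => //; exact: bm_cst.
- by apply: bmD; [exact: bm_cst|exact: bmD].
move=> z zI; rewrite !indic_itv /D.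
have fz := f01 z zI.
have fd := f01 d ltac:(lra).
have fd' : 0 <= f (- d) <= 1 by apply: f01; lra.
have D0 := sqr_ge0 (f d - f (- d)).
have small : (f z - f (- d)) ^+ 2 <= 1.
  have : 0 <= (1 - (f z - f (- d))) * (1 + (f z - f (- d))).
    by apply: mulr_ge0; lra.
  by rewrite expr2; lra.
have [zd|dz] := ltP z (- d).
  have -> : d <= z = false by apply/negbTE; rewrite -ltNge; lra.
  by rewrite (andP zI).1 /=; lra.
have [zd|dz'] := leP d z; first by rewrite (andP zI).2 andbF /=; lra.
rewrite andbF /= !addr0 -subr_ge0 subr_sqr.
have h1 : f (- d) <= f z by apply: nf; lra.
have h2 : f z <= f d by apply: nf; lra.
by apply: mulr_ge0; lra.
Qed.

(** For [z] in [d, e[ one preimage is above [d] and the other below 0; for [z] in [-e, -d[ one is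
    above 0 and the other below [- d]. The two-point variances thus control the sum of the squares
    of [A] and [B], which is at least half the square of [A + B]. Stopping at [e], midway between
    [d] and 1, keeps the product of the weights at least [eta / 2]. *)
Lemma var_drop f (d : R) : bm f -> ndecr f -> 0 < d < 1 ->
  (1 - dphi ((1 + d) / 2)) * (1 - d) / 16 * (f d - f (- d)) ^+ 2 <=
  var f - var (transfer f).
Proof.
move=> bf nf dI; rewrite var_transfer//.
pose e := (1 + d) / 2; rewrite -/e; pose eta := 1 - dphi e.
have eI : d < e < 1 by rewrite /e; lra.
have eta0 : 0 <= eta by rewrite subr_ge0; exact: dphi_le1.
have bI (a b : R) : bm (\1_[set` `[a, b[] : R -> R) by exact: bm_indic.
have bkI (k a b : R) : bm (fun z => k * \1_[set` `[a, b[] z).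
  by apply: bmM => //; exact: bm_cst.
pose A := f d - f 0; pose B := f 0 - f (- d).
apply: (@le_trans _ _ (mean (fun z => eta / 2 * A ^+ 2 * \1_[set` `[d, e[] z +
  eta / 2 * B ^+ 2 * \1_[set` `[- e, - d[] z))).
  rewrite meanD// !meanZ// -/(pr _) -/(pr _) !pr_itv; [|lra..].
  have -> : - d - - e = (1 - d) / 2 by rewrite /e; field.
  have -> : e - d = (1 - d) / 2 by rewrite /e; field.
  have -> : f d - f (- d) = A + B by rewrite /A /B; ring.
  rewrite -subr_ge0 -/eta.
  have -> : eta / 2 * A ^+ 2 * ((1 - d) / 2 / 2) +
      eta / 2 * B ^+ 2 * ((1 - d) / 2 / 2) -
      eta * (1 - d) / 16 * (A + B) ^+ 2 =
    eta * (1 - d) / 16 * (A - B) ^+ 2 by field.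
  by rewrite mulr_ge0 ?sqr_ge0// divr_ge0// mulr_ge0//; lra.
apply: le_mean; first exact: bmD.
  apply: bmM; first by apply: bmM; [exact: (bm_weight gamma_gt1 true)|
    exact: (bm_weight gamma_gt1 false)].
  by apply: bmX2; apply: bmB; apply: bm_comp => //;
    [exact: (measurable_branch _ true)|exact: (measurable_branch _ false)].
move=> z zI; rewrite !indic_itv.
have /andP[/= t1 t2] := branch_true_itv gamma_gt1 zI.
have /andP[/= u1 u2] := branch_false_itv gamma_gt1 zI.
have g0 := dphi_ge0 gamma_gt1 z; have g1 := dphi_le1 gamma_gt1 z.
have d0 : dphi 0 = 2^-1.
  by have := dphiN gamma_gt1 0; rewrite oppr0; lra.
have bound x y : 0 <= x -> x <= y -> eta / 2 <= dphi z * (1 - dphi z) ->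
    eta / 2 * x ^+ 2 <= dphi z * (1 - dphi z) * y ^+ 2.
  move=> x0 xy h; apply: ler_pM => //; first by rewrite divr_ge0.
    by rewrite sqr_ge0.
  by rewrite ler_sqr ?nnegrE//; lra.
have [/andP[dz ze]|_] := boolP (d <= z < e).
  have -> : z < - d = false by apply/negbTE; rewrite -leNgt; lra.
  rewrite andbF mulr1 mulr0 addr0; apply: bound.
  - by rewrite subr_ge0; apply: nf; lra.
  - have h1 : f d <= f (phi z) by apply: nf; lra.
    have h2 : f (z - phi z) <= f 0 by apply: nf; lra.
    by rewrite /A; lra.
  - have h1 : dphi 0 <= dphi z by apply: le_dphi; glra.
    have h2 : dphi z <= dphi e by apply: le_dphi; glra.
    by rewrite mulrC; apply: ler_pM => //; rewrite ?invr_ge0// /eta; lra.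
have [/andP[ez zd]|_] := boolP (- e <= z < - d).
  rewrite mulr1 mulr0 add0r; apply: bound.
  - by rewrite subr_ge0; apply: nf; lra.
  - have h1 : f 0 <= f (phi z) by apply: nf; lra.
    have h2 : f (z - phi z) <= f (- d) by apply: nf; lra.
    by rewrite /B; lra.
  - have h1 : dphi z <= dphi 0 by apply: le_dphi; glra.
    have h2 : dphi (- e) <= dphi z by apply: le_dphi; glra.
    have h3 : dphi (- e) = eta by rewrite dphiN.
    by apply: ler_pM => //; rewrite ?invr_ge0//; lra.
by rewrite !mulr0 addr0 mulr_ge0 ?sqr_ge0// mulr_ge0// subr_ge0.
Qed.

Lemma iter_transfer_itv n f (a b : R) z :
  (forall x, -1 <= x < 1 -> a <= f x <= b) ->
  -1 <= z < 1 -> a <= iter n transfer f z <= b.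
Proof.
move=> fab; elim: n z => [|n ih] z zI; first exact: fab.
by rewrite iterS; exact: transfer_itv.
Qed.

Lemma var_decay (e : R) : 0 < e -> exists M, forall n f, (M <= n)%N ->
  bm f -> ndecr f -> (forall z, -1 <= z < 1 -> 0 <= f z <= 1) ->
  var (iter n transfer f) <= e.
Proof.
move=> e0; pose e' := Num.min e 1.
have [e'0 e'1 e'e] : [/\ 0 < e', e' <= 1 & e' <= e].
  by rewrite /e' lt_min e0 ltr01 !ge_min !lexx orbT.
(* The end pieces then contribute at most [e' / 2] in [var_le], so a variance above [e'] forces a
   squared oscillation of at least [e' / 2], hence a drop of at least [k]. *)
pose d := 1 - e' / 2; have dI : 0 < d < 1 by rewrite /d; lra.
pose k := (1 - dphi ((1 + d) / 2)) * (1 - d) / 16 * (e' / 2).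
have k0 : 0 < k.
  have := dphi_lt1 gamma_gt1 (_ : (1 + d) / 2 < 1) => /(_ ltac:(lra)) h.
  by rewrite mulr_gt0 ?divr_gt0 ?mulr_gt0//; lra.
have [M hM] : exists M : nat, k^-1 < M%:R.
  by exists (Num.truncn k^-1).+1; exact: truncnS_gt.
exists M => n f Mn bf nf f01.
have b m : bm (iter m transfer f) by exact: bm_iter_transfer.
have nd m : ndecr (iter m transfer f).
  by elim: m => //= m; exact: ndecr_transfer.
have i01 m z : -1 <= z < 1 -> 0 <= iter m transfer f z <= 1.
  exact: iter_transfer_itv.
have var1 m : var (iter m transfer f) <= 1.
  apply: (@le_trans _ _ (mean (fun z => iter m transfer f z ^+ 2))).
    by rewrite gerBl sqr_ge0.
  rewrite -[leRHS]mean_cst; apply: le_mean; [exact: bmX2|exact: bm_cst|].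
  by move=> z /(i01 m) /andP[h1 h2]; rewrite expr_le1.
have key m : var (iter m transfer f) <= e' \/ var (iter m transfer f) <= 1 - m%:R * k.
  elim: m => [|m ih]; first by right; rewrite mul0r subr0; exact: (var1 0%N).
  have [h|h] := leP (var (iter m transfer f)) e'.
    by left; rewrite iterS; apply: le_trans h; exact: var_transfer_le.
  right; case: ih => [h'|ih]; first by move: h; rewrite ltNge h'.
  have h1 := var_le (b m) (nd m) dI (i01 m).
  have h2 := var_drop (b m) (nd m) dI.
  set D := (_ - _) ^+ 2 in h1 h2.
  have h3 : e' / 2 <= D by rewrite /d in h1; lra.
  have h4 : k <= (1 - dphi ((1 + d) / 2)) * (1 - d) / 16 * D.
    apply: ler_wpM2l => //; rewrite divr_ge0// mulr_ge0//; last by lra.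
    by rewrite subr_ge0; exact: dphi_le1.
  by rewrite -natr1 mulrDl mul1r iterS; lra.
apply: le_trans e'e; case: (key n) => // /le_trans; apply.
have : 1 <= n%:R * k.
  rewrite -ler_pdivrMr// div1r; apply: ltW; apply: lt_le_trans hM _.
  by rewrite ler_nat.
by lra.
Qed.

(** Pointwise, |f| is at most f^2 / (2 k) + k / 2; choosing [k] as the root mean square of [f]
    recovers the Cauchy-Schwarz bound. *)
Lemma cov_le f A (k : R) : bm f -> measurable A -> 0 < k ->
  `|mean (fun z => f z * \1_A z)| <= (mean (fun z => f z ^+ 2) / k + k) / 2.
Proof.
move=> bf mA k0; have bA := bm_indic mA; have b2 := bmX2 bf.
have bfA : bm (fun z => f z * \1_A z) by exact: bmM.
pose g z := (2 * k)^-1 * f z ^+ 2 + k / 2.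
have bkf : bm (fun z => (2 * k)^-1 * f z ^+ 2).
  by apply: bmM => //; exact: bm_cst.
have bg : bm g by apply: bmD => //; exact: bm_cst.
have -> : (mean (fun z => f z ^+ 2) / k + k) / 2 = mean g.
  rewrite meanD//; last exact: bm_cst.
  by rewrite mean_cst meanZ//; field; rewrite gt_eqF.
have h z : `|f z * \1_A z| <= g z.
  apply: (@le_trans _ _ `|f z|).
    rewrite normrM indicE; case: (_ \in _) => /=; first by rewrite normr1 mulr1.
    by rewrite normr0 mulr0.
  rewrite /g -(@real_normK _ (f z)) ?num_real//.
  rewrite -subr_ge0.
  have -> : (2 * k)^-1 * `|f z| ^+ 2 + k / 2 - `|f z| =
    (2 * k)^-1 * (`|f z| - k) ^+ 2 by field; rewrite gt_eqF.
  by rewrite mulr_ge0 ?sqr_ge0// invr_ge0; lra.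
rewrite ler_norml -meanN//; apply/andP; split; apply: le_mean => //.
- exact: bmN.
- by move=> z _; have := h z; rewrite ler_norml => /andP[].
- by move=> z _; have := h z; rewrite ler_norml => /andP[].
Qed.

Lemma iter_transferZ n k f :
  iter n transfer (fun z => k * f z) = (fun z => k * iter n transfer f z).
Proof.
elim: n => //= n ->; apply/funext => z; exact: transferZ.
Qed.

Lemma iter_transferB n f g :
  iter n transfer (fun z => f z - g z) =
  (fun z => iter n transfer f z - iter n transfer g z).
Proof.
elim: n => //= n ->; apply/funext => z; exact: transferB.
Qed.

Lemma mean_iter_transfer n f : bm f -> mean (iter n transfer f) = mean f.
Proof.
move=> bf; elim: n => //= n ih; rewrite mean_transfer//.
exact: bm_iter_transfer.
Qed.

Lemma mixing_ndecr (e : R) : 0 < e -> exists M, forall n f A (V : R), (M <= n)%N ->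
  bm f -> ndecr f -> measurable A -> 0 < V ->
  (forall z, -1 <= z < 1 -> 0 <= f z <= V) ->
  `|mean (fun z => iter n transfer f z * \1_A z) - mean f * pr A| <= V * e.
Proof.
(* A variance of at most [e ^+ 2] makes [cov_le] with parameter [e] yield the error [e]. *)
move=> e0; have [M hM] := var_decay (exprn_gt0 2 e0).
exists M => n f A V Mn bf nf mA V0 fV.
have bA := bm_indic mA.
pose g z := V^-1 * f z.
have bg : bm g by apply: bmM => //; exact: bm_cst.
have ng : ndecr g.
  by move=> y z *; apply: ler_wpM2l; [rewrite invr_ge0 ltW|exact: nf].
have g01 z : -1 <= z < 1 -> 0 <= g z <= 1.
  move=> /fV /andP[h1 h2]; rewrite /g; apply/andP; split.
    by rewrite mulr_ge0// invr_ge0 ltW.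
  by rewrite ler_pdivrMl// mulr1.
have fE : f = (fun z => V * g z) by apply/funext => z; rewrite /g mulVKf ?gt_eqF.
have bng : bm (iter n transfer g) by exact: bm_iter_transfer.
have bX : bm (fun z => iter n transfer g z - mean g).
  by apply: bmB => //; exact: bm_cst.
have v := hM n g Mn bg ng g01.
have := cov_le bX mA e0.
have -> : mean (fun z => (iter n transfer g z - mean g) ^+ 2) =
    var (iter n transfer g).
  by rewrite (var_center (mean g))// mean_iter_transfer// subrr expr0n/= subr0.
have -> : mean (fun z => (iter n transfer g z - mean g) * \1_A z) =
    mean (fun z => iter n transfer g z * \1_A z) - mean g * pr A.
  rewrite /pr -meanZ// -meanB//; [|exact: bmM|by apply: bmM => //; exact: bm_cst].
  by apply: eq_mean => z _; ring.
move=> h; rewrite fE iter_transferZ meanZ//.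
have -> : mean (fun z => V * iter n transfer g z * \1_A z) =
    V * mean (fun z => iter n transfer g z * \1_A z).
  by rewrite -meanZ; [apply: eq_mean => z _; ring|exact: bmM].
rewrite -mulrA -mulrBr normrM gtr0_norm//; apply: ler_wpM2l; first exact: ltW.
apply: le_trans h _; rewrite ler_pdivrMr//.
have : var (iter n transfer g) / e <= e by rewrite ler_pdivrMr// -expr2.
by lra.
Qed.

(* A Lipschitz function cut off to an interval is the difference of two
   nondecreasing functions. *)
Lemma mixing_lip (e : R) : 0 < e -> exists M, forall n f g A (a b V L : R),
  (M <= n)%N -> bm f -> measurable A -> -1 <= a -> a <= b -> b <= 1 ->
  0 < V -> 0 <= L -> (forall z, a <= z < b -> 0 <= f z <= V) ->
  (forall y z, a <= y < b -> a <= z < b -> `|f y - f z| <= L * `|y - z|) ->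
  g = (fun z => f z * \1_[set` `[a, b[] z) ->
  `|mean (fun z => iter n transfer g z * \1_A z) - mean g * pr A| <= (V + 2 * L) * e.
Proof.
move=> e0; have e20 : 0 < e / 2 by lra.
have [M hM] := mixing_ndecr e20.
exists M => n f g A a b V L Mn bf mA a1 ab b1 V0 L0 fV fL gdef.
have bA := bm_indic mA.
have bg : bm g by rewrite gdef; apply: bmM => //; exact: bm_indic.
pose W := V + L * (b - a).
have Lba : 0 <= L * (b - a) by apply: mulr_ge0; lra.
have W0 : 0 < W by rewrite /W; lra.
have WL : W <= V + 2 * L.
  have : L * (b - a) <= L * 2 by apply: ler_wpM2l => //; lra.
  by rewrite /W; lra.
(* [v] grows at rate [L] on [a, b[, which compensates any decrease of [f], and jumps at [b] to the
   bound [W] of the sum, so that cutting [f] off there keeps [g + v] nondecreasing. *)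
pose v z := if z < a then 0 else if z < b then L * (z - a) else W.
have lip0 z : a <= z < b -> 0 <= L * (z - a) <= L * (b - a).
  move=> zab; apply/andP; split; first by rewrite mulr_ge0//; lra.
  by apply: ler_wpM2l => //; lra.
have v0W z : 0 <= v z <= W.
  rewrite /v; case: ltP => za; first by lra.
  case: ltP => zb; last by lra.
  by have := lip0 z; rewrite za zb => /(_ isT); rewrite /W; lra.
have bv : bm v.
  split; last by exists W => z; have := v0W z; rewrite ler_norml; lra.
  apply: nondecreasing_measurable => // y z yz; rewrite /v.
  case: (ltP y a) => ya.
    by have := v0W z; rewrite /v => /andP[].
  have -> : z < a = false by apply/negbTE; rewrite -leNgt; lra.
  case: (ltP y b) => yb.
    case: (ltP z b) => zb; first by apply: ler_wpM2l => //; lra.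
    by have := lip0 y; rewrite ya yb /W => /(_ isT); lra.
  by have -> : z < b = false by apply/negbTE; rewrite -leNgt; lra.
pose u z := g z + v z.
have bu : bm u by exact: bmD.
have nv : ndecr v.
  move=> y z _ yz _; rewrite /v.
  case: (ltP y a) => ya.
    by have := v0W z; rewrite /v => /andP[].
  have -> : z < a = false by apply/negbTE; rewrite -leNgt; lra.
  case: (ltP y b) => yb.
    case: (ltP z b) => zb; first by apply: ler_wpM2l => //; lra.
    by have := lip0 y; rewrite ya yb /W => /(_ isT); lra.
  by have -> : z < b = false by apply/negbTE; rewrite -leNgt; lra.
have uE z : u z = if z < a then 0 else
    if z < b then f z + L * (z - a) else W.
  rewrite /u gdef /v indic_itv; case: (ltP z a) => za /=; first by ring.
  by case: (ltP z b) => zb /=; ring.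
have u0W z : 0 <= u z <= W.
  rewrite uE; case: ltP => za; first by lra.
  case: ltP => zb; last by lra.
  have zab : a <= z < b by rewrite za zb.
  by have := lip0 z zab; have := fV z zab; rewrite /W; lra.
have nu : ndecr u.
  move=> y z _ yz _; rewrite !uE.
  case: (ltP y a) => ya.
    by have := u0W z; rewrite uE => /andP[].
  have -> : z < a = false by apply/negbTE; rewrite -leNgt; lra.
  case: (ltP y b) => yb.
    have yab : a <= y < b by rewrite ya yb.
    case: (ltP z b) => zb; last first.
      by have := lip0 y yab; have := fV y yab; rewrite /W; lra.
    have zab : a <= z < b by rewrite zb; lra.
    have := fL y z yab zab; rewrite (ler0_norm (_ : y - z <= 0)); last by lra.
    by rewrite ler_norml; lra.
  by have -> : z < b = false by apply/negbTE; rewrite -leNgt; lra.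
have gE : g = (fun z => u z - v z).
  by apply/funext => z; rewrite /u addrK.
have hu := hM n u A W Mn bu nu mA W0 (fun z _ => u0W z).
have hv := hM n v A W Mn bv nv mA W0 (fun z _ => v0W z).
have buA : bm (fun z => iter n transfer u z * \1_A z).
  by apply: bmM => //; exact: bm_iter_transfer.
have bvA : bm (fun z => iter n transfer v z * \1_A z).
  by apply: bmM => //; exact: bm_iter_transfer.
rewrite gE iter_transferB meanB//.
have -> : mean (fun z => (iter n transfer u z - iter n transfer v z) * \1_A z) =
    mean (fun z => iter n transfer u z * \1_A z) -
    mean (fun z => iter n transfer v z * \1_A z).
  by rewrite -meanB//; apply: eq_mean => z _; ring.
set x := mean _ in hu *; set y := mean _ in hv *.
have -> : x - y - (mean u - mean v) * pr A =
  (x - mean u * pr A) - (y - mean v * pr A) by ring.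
apply: le_trans (ler_normB _ _) _; apply: le_trans (lerD hu hv) _.
have := ler_wpM2r (ltW e0) WL; lra.
Qed.

End mixing.

(** * Cylinders *)

Section cylinders.
Context {R : realType} (gamma : R) (gamma_gt1 : 1 < gamma).
Context (S : R -> R) (mS : measurable_fun setT S).
Hypothesis S_branch : forall d z, -1 <= z < 1 -> S (branch gamma d z) = z.
Local Notation branch := (branch gamma).
Local Notation weight := (weight gamma).
Local Notation wbranch := (wbranch gamma).
Local Notation wweight := (wweight gamma).
Local Notation transfer := (transfer gamma).
Implicit Types (f g h : R -> R) (A B : set R) (d e : bool) (w v : seq bool).

Ltac glra := move: (gamma_gt1) => ?; lra.

Lemma branch_S y : -1 <= y < 1 ->
  -1 <= S y < 1 /\ branch (0 <= y) (S y) = y.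
Proof.
move=> yI; have [z zI zy] := branch_onto gamma_gt1 yI.
by rewrite -[in S y]zy S_branch.
Qed.

Lemma S_itv y : -1 <= y < 1 -> -1 <= S y < 1.
Proof. by move=> /branch_S[]. Qed.

Lemma iter_S_itv n y : -1 <= y < 1 -> -1 <= iter n S y < 1.
Proof. by move=> yI; elim: n => //= n; exact: S_itv. Qed.

Lemma measurable_iterS n : measurable_fun setT (iter n S).
Proof. by elim: n => [|n ih] /=; [exact: measurable_id|exact: measurableT_comp]. Qed.

Lemma measurable_preS n A : measurable A -> measurable (iter n S @^-1` A).
Proof.
by move=> mA; rewrite -[X in measurable X]setTI; exact: measurable_iterS.
Qed.

Lemma transfer_comp f h z : -1 <= z < 1 ->
  transfer (fun y => f y * h (S y)) z = transfer f z * h z.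
Proof. by move=> zI; rewrite /transfer !S_branch//; ring. Qed.

Lemma eq_transfer f g : (forall z, -1 <= z < 1 -> f z = g z) ->
  forall z, -1 <= z < 1 -> transfer f z = transfer g z.
Proof. by move=> fg z zI; rewrite /transfer !fg//; exact: branch_itv. Qed.

Lemma iter_transfer_comp n f h z : -1 <= z < 1 ->
  iter n transfer (fun y => f y * h (iter n S y)) z = iter n transfer f z * h z.
Proof.
elim: n f h z => // n ih f h z zI; rewrite !iterS.
rewrite (@eq_transfer _ (fun y => iter n transfer f y * h (S y)))//.
  exact: transfer_comp.
by move=> y yI; rewrite -(ih _ (h \o S)).
Qed.

(** Duality between the transfer operator and composition with [S], through the invariance of the
    mean. *)
Lemma mean_comp_iterS n f h : bm f -> bm h ->
  mean (fun y => f y * h (iter n S y)) = mean (fun z => iter n transfer f z * h z).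
Proof.
move=> bf bh; rewrite -(mean_iter_transfer gamma_gt1 n).
  by apply: eq_mean => z zI; exact: iter_transfer_comp.
by apply: bmM => //; apply: bm_comp => //; exact: measurable_iterS.
Qed.

Lemma pr_preS n A : measurable A -> pr (iter n S @^-1` A) = pr A.
Proof.
move=> mA; rewrite /pr.
have -> : mean \1_(iter n S @^-1` A) = mean (fun y => 1 * \1_A (iter n S y)).
  by apply: eq_mean => y _; rewrite mul1r !indicE.
rewrite (mean_comp_iterS n (f := fun=> 1)) ?mean_comp_iterS//; last 2 first.
- exact: bm_cst.
- exact: bm_indic.
apply: eq_mean => z _.
have -> : iter n transfer (fun=> 1) z = 1.
  have -> : iter n transfer (fun=> 1) = fun=> 1; last by [].
  by elim: n => //= n ->; apply/funext => y; exact: transfer_cst.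
by rewrite mul1r.
Qed.

(** The points of [-1, 1[ whose first digits, the halves visited by the orbit, are [w]; see
    [cyl_rcons]. *)
Definition cyl w : set R := [set` `[wbranch w (-1), wbranch w 1[].

Lemma measurable_cyl w : measurable (cyl w).
Proof. exact: measurable_itv. Qed.

Lemma cyl_nil y : cyl [::] y <-> -1 <= y < 1.
Proof. by rewrite /cyl /= in_itv. Qed.

Lemma wbranch_cyl w z : -1 <= z < 1 -> cyl w (wbranch w z).
Proof.
move=> zI; rewrite /cyl /= in_itv/=; apply/andP; split.
  by apply: wbranch_le; glra.
by apply: wbranch_lt; glra.
Qed.

Lemma cyl_wbranch w y : cyl w y -> exists2 z, -1 <= z < 1 & y = wbranch w z.
Proof.
rewrite /cyl /= in_itv/=; elim: w y => [|d w ih] y /= yw; first by exists y.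
have aI : -1 <= wbranch w (-1) <= 1 by apply: wbranch_itvcc; glra.
have bI : -1 <= wbranch w 1 <= 1 by apply: wbranch_itvcc; glra.
have ha := @branch_le _ _ gamma_gt1 d (-1) (wbranch w (-1)).
have hb := @branch_le _ _ gamma_gt1 d (wbranch w 1) 1.
have {}ha := ha ltac:(lra) ltac:(lra) ltac:(lra).
have {}hb := hb ltac:(lra) ltac:(lra) ltac:(lra).
have bN1 : branch d (-1) = if d then 0 else -1 by case: (d); rewrite /= phiN1//; lra.
have b1 : branch d 1 = if d then 1 else 0 by case: (d); rewrite /= phi1//; lra.
have yI : -1 <= y < 1 by move: ha hb yw; rewrite bN1 b1; case: (d); lra.
have yd : (0 <= y) = d.
  by move: ha hb yw; rewrite bN1 b1; case: (d) => *; apply/idP; rewrite -?ltNge; lra.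
have [SyI Sy] := branch_S yI; rewrite yd in Sy.
have [|z zI Syz] := ih (S y).
  apply/andP; split.
    rewrite leNgt; apply/negP => h.
    have := branch_lt gamma_gt1 d (andP SyI).1 h (andP aI).2.
    by rewrite Sy; lra.
  rewrite ltNge; apply/negP => h.
  have := branch_le gamma_gt1 d (andP bI).1 h (ltW (andP SyI).2).
  by rewrite Sy; lra.
by exists z => //; rewrite -Syz.
Qed.

Lemma cyl_itv w y : cyl w y -> -1 <= y < 1.
Proof. by move=> /cyl_wbranch[z zI ->]; exact: wbranch_itv. Qed.

Lemma iterS_wbranch w z : -1 <= z < 1 -> iter (size w) S (wbranch w z) = z.
Proof.
move=> zI; elim: w => // d w ih; rewrite iterSr /= S_branch//.
exact: wbranch_itv.
Qed.

Lemma cylE w y : cyl w y <-> -1 <= y < 1 /\ wbranch w (iter (size w) S y) = y.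
Proof.
split=> [/[dup] /cyl_itv ? /cyl_wbranch[z zI ->]|[yI <-]].
  by rewrite iterS_wbranch//; split=> //; exact: wbranch_itv.
by apply: wbranch_cyl; exact: iter_S_itv.
Qed.

Lemma cyl_rcons w d y :
  cyl (rcons w d) y <-> cyl w y /\ (0 <= iter (size w) S y) = d.
Proof.
split=> [/cyl_wbranch[z zI ->]|].
  rewrite -cats1 wbranch_cat /=; have bI := branch_itv gamma_gt1 d zI.
  by rewrite iterS_wbranch// branch_sign//; split=> //; exact: wbranch_cyl.
move=> [/cyl_wbranch[z zI ->]]; rewrite iterS_wbranch// => <-.
have [SI Sz] := branch_S zI.
have -> : wbranch w z = wbranch (rcons w (0 <= z)) (S z).
  by rewrite -cats1 wbranch_cat /= Sz.
exact: wbranch_cyl.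
Qed.

Lemma pr_cyl_split w e H : measurable H ->
  pr (cyl w `&` H) = pr (cyl (rcons w e) `&` H) + pr (cyl (rcons w (~~ e)) `&` H).
Proof.
move=> mH; rewrite (@pr_split _ _ (cyl (rcons w e))); last 2 first.
- by apply: measurableI => //; exact: measurable_cyl.
- exact: measurable_cyl.
congr (_ + _); apply: eq_pr => y yI /=; split.
- by move=> [[_ Hy] wy].
- by move=> [/[dup] wy /cyl_rcons[]].
- move=> [[wy Hy] /cyl_rcons nwe]; split=> //; apply/cyl_rcons; split=> //.
  by case: e nwe; case: (0 <= _) => //= nwe; exfalso; apply: nwe.
- move=> [/cyl_rcons[wy we] Hy]; split=> //; move=> /cyl_rcons[_].
  by rewrite we; case: (e).
Qed.

(** Change of variables along an inverse branch, obtained letter by letter from the invariance of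
    the mean: [transfer] turns the indicator of [cyl (d :: w)] into [weight d] on [cyl w]. *)
Lemma mean_cyl w f : bm f ->
  mean (fun y => \1_(cyl w) y * f y) = mean (fun z => wweight w z * f (wbranch w z)).
Proof.
elim: w f => [|d w ih] f bf.
  by apply: eq_mean => y yI; rewrite indicE mem_set//; exact/cyl_nil.
rewrite -(mean_transfer gamma_gt1); last first.
  by apply: bmM => //; apply: bm_indic; exact: measurable_cyl.
rewrite (@eq_mean _ _ (fun z => \1_(cyl w) z * (weight d z * f (branch d z)))).
  rewrite ih; first by apply: eq_mean => z _ /=; ring.
  apply: bmM; first exact: bm_weight.
  by apply: bm_comp => //; exact: measurable_branch.
move=> z zI; have h d' : \1_(cyl (d :: w)) (branch d' z) = (d == d')%:R * \1_(cyl w) z :> R.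
  rewrite !indicE -natrM mulnb; congr (nat_of_bool _)%:R.
  apply/idP/andP; rewrite !inE => -[].
    move=> /cyl_wbranch[x xI /= e].
    have sg : d' = d.
      rewrite -(branch_sign gamma_gt1 d' zI) e branch_sign//.
      exact: wbranch_itv.
    split; first by rewrite sg.
    move: e; rewrite sg => e; have := S_branch d zI; rewrite e S_branch.
      by move=> <-; exact: wbranch_cyl.
    exact: wbranch_itv.
  move=> /eqP <- /cyl_wbranch[x xI ->].
  exact: (wbranch_cyl (d :: w)).
rewrite /transfer !h; case: (d) => /=; ring.
Qed.

Lemma pr_cyl_pre w H A : measurable H -> measurable A ->
  (forall z, -1 <= z < 1 -> H (wbranch w z) <-> A z) ->
  pr (cyl w `&` H) = mean (fun z => wweight w z * \1_A z).
Proof.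
move=> mH mA HA; rewrite -mean_indicM mean_cyl; last exact: bm_indic.
apply: eq_mean => z zI; congr (_ * _); rewrite !indicE; congr (nat_of_bool _)%:R.
by apply/idP/idP; rewrite !inE => /(HA z zI).
Qed.

Lemma bm_wweight w : bm (wweight w).
Proof.
elim: w => [|d w ih] /=; first exact: bm_cst.
apply: bmM => //; apply: bm_comp; first exact: bm_weight.
by elim: (w) => [|d' w' ih'] /=; [exact: measurable_id|
  exact: (measurableT_comp (measurable_branch _ d'))].
Qed.

End cylinders.

(** * Cylinders ending at a crossing: distortion, mixing, diameter *)

Section visits.
Context {R : realType} (gamma : R) (gamma_gt1 : 1 < gamma).
Context (S : R -> R) (mS : measurable_fun setT S).
Hypothesis S_branch : forall d z, -1 <= z < 1 -> S (branch gamma d z) = z.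
Local Notation branch := (branch gamma).
Local Notation wbranch := (wbranch gamma).
Local Notation wweight := (wweight gamma).
Local Notation core := (core gamma).
Local Notation cgamma := (cgamma gamma).
Local Notation cyl := (cyl gamma).
Implicit Types (f g h : R -> R) (A B : set R) (d e : bool) (w v : seq bool).

Ltac glra := move: (gamma_gt1) => ?; lra.

Definition coreset e : set R :=
  [set` `[(if e then 0 else - cgamma), (if e then cgamma else 0)[].

Lemma coresetE e z : coreset e z <-> core e z.
Proof. by rewrite /coreset /= in_itv/=; case: e. Qed.

Lemma core_cyl e z : -1 <= z < 1 ->
  core e z <-> (0 <= z) = e /\ (0 <= S z) = ~~ e.
Proof.
move=> zI; have p0 := phi0 gamma; have pN1 := phiN1 gamma_gt1; have p1 := phi1 gamma_gt1.
have ha : wbranch [:: e; ~~ e] (-1) = if e then 0 else - cgamma.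
  by case: (e) => /=; rewrite !pN1 ?subr0 ?pN1// p0 sub0r.
have hb : wbranch [:: e; ~~ e] 1 = if e then cgamma else 0.
  by case: (e) => /=; rewrite !p1 ?subrr ?p0.
have -> : core e z <-> cyl [:: e; ~~ e] z by rewrite -coresetE /coreset /cyl ha hb.
have h := @cyl_rcons _ _ gamma_gt1 _ S_branch.
rewrite (h [:: e] (~~ e) z) (h [::] e z) cyl_nil /=.
by split=> [[[_ ->] ->]//|[-> ->]].
Qed.

(** The points which, after following [w], are in the core of half [e], about to cross: on these
    cylinders the distortion is bounded uniformly in [w]. *)
Definition ccyl w e : set R := cyl (rcons (rcons w e) (~~ e)).

Lemma measurable_ccyl w e : measurable (ccyl w e).
Proof. exact: measurable_cyl. Qed.

Lemma ccylE w e y :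
  ccyl w e y <-> cyl w y /\ core e (iter (size w) S y).
Proof.
have h := @cyl_rcons _ _ gamma_gt1 _ S_branch.
rewrite /ccyl (h _ (~~ e)) (h _ e) size_rcons iterS.
split=> [[[wy] *]|[wy]].
  split=> //; apply/core_cyl => //.
  by apply: (iter_S_itv gamma_gt1 S_branch); exact: (cyl_itv gamma_gt1 S_branch wy).
move=> /core_cyl[]; last by split.
by apply: (iter_S_itv gamma_gt1 S_branch); exact: (cyl_itv gamma_gt1 S_branch wy).
Qed.

Lemma ccyl_wbranch w e z : -1 <= z < 1 -> ccyl w e (wbranch w z) <-> core e z.
Proof.
move=> zI; rewrite ccylE (iterS_wbranch gamma_gt1 S_branch)//.
by split=> [[]//|ez]; split=> //; exact: wbranch_cyl.
Qed.

Lemma pr_coreset e : pr (coreset e) = cgamma / 2.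
Proof.
have c0 := cgamma_gt0 gamma_gt1; have c2 := cgamma_lt gamma_gt1.
by rewrite /coreset; case: e; rewrite pr_itv; lra.
Qed.

Lemma measurable_coreset e : measurable (coreset e).
Proof. exact: measurable_itv. Qed.

Lemma core_itv e z : core e z -> -1 <= z < 1.
Proof. by move=> /(core_in_half gamma_gt1)/in_half_itv; lra. Qed.

Lemma pr_ccylI w e A B : measurable A -> measurable B ->
  (forall z, core e z -> B (wbranch w z) <-> A z) ->
  pr (ccyl w e `&` B) = mean (fun z => wweight w z * \1_(coreset e `&` A) z).
Proof.
move=> mA mB BA.
rewrite -(pr_cyl_pre gamma_gt1 S_branch (w := w) (H := ccyl w e `&` B)).
- apply: eq_pr => y yI /=; split=> [[+ By]|[]//].
  by move=> /[dup] ce /ccylE[wy _]; split.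
- by apply: measurableI => //; exact: measurable_ccyl.
- by apply: measurableI => //; exact: measurable_coreset.
move=> z zI /=; rewrite ccyl_wbranch// coresetE.
by split=> -[ez] /(BA z ez).
Qed.

Lemma pr_ccyl w e : pr (ccyl w e) = mean (fun z => wweight w z * \1_(coreset e) z).
Proof.
have := @pr_ccylI w e setT setT measurableT measurableT (fun _ _ => iff_refl _).
by rewrite !setIT.
Qed.

(* [expR 2] is the distortion, [cgamma / 2] the measure of a core. *)
Definition Kc : R := expR 2 * (2 / cgamma).

Lemma Kc_gt0 : 0 < Kc.
Proof. by rewrite mulr_gt0 ?expR_gt0 ?divr_gt0 ?cgamma_gt0. Qed.

(** By bounded distortion a value of the weight is at most [expR 2] times its average over the core,
    and this average is [pr (ccyl w e)] divided by the measure of the core. *)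
Lemma wweight_core_le w e z : core e z -> wweight w z <= Kc * pr (ccyl w e).
Proof.
move=> ez; have c0 := cgamma_gt0 gamma_gt1; have x0 := expR_gt0 (2 : R).
have bI : bm (\1_(coreset e) : R -> R) by apply: bm_indic; exact: measurable_coreset.
have h : (expR 2)^-1 * wweight w z * (cgamma / 2) <= pr (ccyl w e).
  rewrite -(pr_coreset e) pr_ccyl /pr -meanZ//; apply: le_mean.
  - by apply: bmM => //; exact: bm_cst.
  - by apply: bmM => //; exact: bm_wweight.
  move=> y yI; rewrite indicE; have [|_] := boolP (y \in _); last by rewrite !mulr0.
  rewrite inE => /coresetE ey; rewrite !mulr1 ler_pdivrMl//.
  exact: (core_wweight_le gamma_gt1 w ez ey).
apply: le_trans (ler_wpM2l (ltW Kc_gt0) h); rewrite le_eqVlt; apply/orP; left.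
by apply/eqP; rewrite /Kc; field; rewrite !gt_eqF.
Qed.

Lemma core_exists e : exists z, core e z.
Proof.
by have c0 := cgamma_gt0 gamma_gt1; exists (if e then 0 else - cgamma); case: e;
  rewrite /core; lra.
Qed.

Lemma pr_ccyl_gt0 w e : 0 < pr (ccyl w e).
Proof.
have [z ez] := core_exists e; have := wweight_core_le w ez.
move=> /(lt_le_trans (wweight_gt0 gamma_gt1 w (core_in_half gamma_gt1 ez))).
by rewrite pmulr_rgt0 ?Kc_gt0.
Qed.

(** Conditioned on the cylinder, the point reached after [w] has a density bounded by [Kc], whatever
    the word. *)
Lemma ccyl_quasi_indep w e A : measurable A ->
  pr (ccyl w e `&` iter (size w) S @^-1` A) <= Kc * pr A * pr (ccyl w e).
Proof.
move=> mA; have mA' := measurable_preS mS (size w) mA.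
rewrite (pr_ccylI (A := A))//; last first.
  by move=> z /core_itv zI; rewrite /= (iterS_wbranch gamma_gt1 S_branch).
rewrite mulrAC -[X in _ * X]/(mean \1_A) -meanZ; last exact: bm_indic.
apply: le_mean.
- apply: bmM; first exact: bm_wweight.
  by apply: bm_indic; apply: measurableI => //; exact: measurable_coreset.
- by apply: bmM; [exact: bm_cst|exact: bm_indic].
move=> z _; rewrite !indicE in_setI.
have [|_] := boolP (z \in coreset e); last first.
  by rewrite mulr0 mulr_ge0// mulr_ge0// ltW ?Kc_gt0 ?pr_ccyl_gt0.
rewrite inE => /coresetE ez /=; case: (z \in A); rewrite ?mulr0// !mulr1.
exact: wweight_core_le.
Qed.

(** The weight cut off to the core is bounded by [Kc * q] and Lipschitz there with constant
    [4 * gamma * expR 2 * (Kc * q)], where [q] is the measure of the cylinder. Mixing of Lipschitz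
    functions then gives a relative error, with a time [M] independent of the word; [D] collects the
    constants. *)
Lemma ccyl_mixing (k : R) : 0 < k -> exists M, forall n w e A, (M <= n)%N ->
  measurable A ->
  `|pr (ccyl w e `&` iter (size w + n) S @^-1` A) - pr (ccyl w e) * pr A|
    <= k * pr (ccyl w e).
Proof.
move=> k0; pose D := (1 + 8 * gamma * expR 2) * Kc.
have D0 : 0 < D.
  rewrite mulr_gt0 ?Kc_gt0// addr_gt0// !mulr_gt0 ?expR_gt0//; glra.
have kD : 0 < k / D by rewrite divr_gt0.
have [M hM] := mixing_lip gamma_gt1 kD.
exists M => n w e A Mn mA; set q := pr (ccyl w e).
have q0 : 0 < q := pr_ccyl_gt0 w e.
have c0 := cgamma_gt0 gamma_gt1; have c2 := cgamma_lt gamma_gt1.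
have L0 : 0 <= 4 * gamma * expR 2 by rewrite mulr_ge0 ?expR_ge0//; glra.
have itv z : (if e then 0 else - cgamma) <= z < (if e then cgamma else 0) ->
    core e z by case: (e).
have := hM n (wweight w) _ A (if e then 0 else - cgamma)
  (if e then cgamma else 0) (Kc * q) (4 * gamma * expR 2 * (Kc * q)) Mn
  (bm_wweight gamma_gt1 w) mA _ _ _ _ _ _ _ erefl.
have -> : (Kc * q + 2 * (4 * gamma * expR 2 * (Kc * q))) * (k / D) = k * q.
  rewrite /D; field; rewrite ?gt_eqF ?Kc_gt0//.
  by rewrite addr_gt0// !mulr_gt0 ?expR_gt0//; glra.
have -> : mean (fun z => wweight w z * \1_[set` `[(if e then 0 else - cgamma),
    (if e then cgamma else 0)[] z) = q by rewrite /q pr_ccyl.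
rewrite -(mean_comp_iterS gamma_gt1 mS S_branch); last 2 first.
- by apply: bmM; [exact: bm_wweight|apply: bm_indic; exact: measurable_itv].
- exact: bm_indic.
have -> : pr (ccyl w e `&` iter (size w + n) S @^-1` A) =
  mean (fun y => wweight w y * \1_[set` `[(if e then 0 else - cgamma),
    (if e then cgamma else 0)[] y * \1_A (iter n S y)).
  rewrite (pr_ccylI (A := iter n S @^-1` A)).
  - apply: eq_mean => z _; rewrite -mulrA; congr (_ * _).
    by rewrite !indicE in_setI -natrM mulnb.
  - exact: measurable_preS.
  - exact: measurable_preS.
  move=> z /core_itv zI.
  by rewrite /= addnC iterD (iterS_wbranch gamma_gt1 S_branch).
apply.
- by case: (e); lra.
- by case: (e); lra.
- by case: (e); lra.
- by rewrite mulr_gt0 ?Kc_gt0.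
- by rewrite mulr_ge0// mulr_ge0// ltW// Kc_gt0.
- move=> z /itv ez; rewrite wweight_ge0//=; exact: wweight_core_le.
- move=> y z /itv ey /itv ez.
  apply: le_trans (core_wweight_lip gamma_gt1 w ey ey ez) _.
  apply: ler_wpM2r => //; apply: ler_wpM2l => //; exact: wweight_core_le.
Qed.

Lemma ccyl_diam w e y z : ccyl w e y -> ccyl w e z ->
  `|y - z| <= 2 ^- changes (rcons w e).
Proof.
wlog : y z / z <= y => [hw ey ez|zy].
  have [zy|/ltW yz] := leP z y; first exact: hw.
  by rewrite distrC hw.
move=> /ccylE[/(cyl_wbranch gamma_gt1 S_branch)[s sI ys]].
rewrite ys (iterS_wbranch gamma_gt1 S_branch)// => es.
move=> /ccylE[/(cyl_wbranch gamma_gt1 S_branch)[t tI zt]].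
rewrite zt (iterS_wbranch gamma_gt1 S_branch)// => et.
have ts : t <= s.
  rewrite leNgt; apply/negP => st.
  have := @wbranch_lt _ _ gamma_gt1 w s t ltac:(lra) st ltac:(lra).
  by rewrite -ys -zt; lra.
have := wbranch_contr gamma_gt1 w (core_in_half gamma_gt1 et)
  (core_in_half gamma_gt1 es) ts.
rewrite ger0_norm; last by rewrite subr_ge0 -ys -zt.
move=> /le_trans; apply; rewrite -[leRHS]mulr1; apply: ler_wpM2l.
  by rewrite invr_ge0 exprn_ge0.
have := core_dist es et; rewrite ger0_norm; last lra.
by have := cgamma_lt gamma_gt1; lra.
Qed.

End visits.

(** * Crossings *)

Section trees.
Context {R : realType} (gamma : R) (gamma_gt1 : 1 < gamma).
Context (S : R -> R) (mS : measurable_fun setT S).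
Hypothesis S_branch : forall d z, -1 <= z < 1 -> S (branch gamma d z) = z.
Local Notation cyl := (cyl gamma).
Local Notation ccyl := (ccyl gamma).
Local Notation Kc := (Kc gamma).
Implicit Types (A B : set R) (d e : bool) (w v : seq bool).

Definition crossing : set R := [set z | (0 <= z) != (0 <= S z)].

Lemma measurable_crossing : measurable crossing.
Proof.
have mP : measurable [set` `[(0 : R), +oo[] by exact: measurable_itv.
have mSP := measurable_preS mS 1 mP.
have -> : crossing = [set` `[(0 : R), +oo[] `\` (iter 1 S @^-1` [set` `[(0 : R), +oo[])
    `|` (iter 1 S @^-1` [set` `[(0 : R), +oo[]) `\` [set` `[(0 : R), +oo[].
  apply/seteqP; split=> z; rewrite /crossing /= !in_itv/= !andbT;
    case: (0 <= z); case: (0 <= S z) => //=.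
  - by move=> _; left.
  - by move=> _; right.
  - by case=> -[].
  - by case=> -[].
by apply: measurableU; exact: measurableD.
Qed.

(* [visit N p A]: the points whose visit number [p] (counted from 0) to
   [crossing] occurs before time [N] and takes place in [A]; [late N p]: that
   visit does not occur before time [N]. *)
Fixpoint visit (N p : nat) A : set R :=
  if N is N'.+1 then
    (crossing `&` (if p is p'.+1 then S @^-1` visit N' p' A else A))
    `|` (~` crossing `&` S @^-1` visit N' p A)
  else set0.

Fixpoint late (N p : nat) : set R :=
  if N is N'.+1 then
    (crossing `&` (if p is p'.+1 then S @^-1` late N' p' else set0))
    `|` (~` crossing `&` S @^-1` late N' p)
  else setT.

Let mS1 A : measurable A -> measurable (S @^-1` A).
Proof. exact: (measurable_preS mS 1). Qed.

Lemma measurable_visit N p A : measurable A -> measurable (visit N p A).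
Proof.
move=> mA; elim: N p => //= N ih p; have mC := measurable_crossing.
apply: measurableU; apply: measurableI => //.
- by case: p => // p; exact: mS1.
- exact: measurableC.
- exact: mS1.
Qed.

Lemma measurable_late N p : measurable (late N p).
Proof.
elim: N p => //= N ih p; have mC := measurable_crossing.
apply: measurableU; apply: measurableI => //.
- by case: p => // p; exact: mS1.
- exact: measurableC.
- exact: mS1.
Qed.

Lemma visitY N p A z : crossing z ->
  visit N.+1 p A z <-> (if p is p'.+1 then visit N p' A (S z) else A z).
Proof. by case: p => [|p] Yz /=; (split; [case=> -[]//|left]). Qed.

Lemma visitN N p A z : ~ crossing z -> visit N.+1 p A z <-> visit N p A (S z).
Proof. by case: p => [|p] Yz /=; (split; [case=> -[]//|right]). Qed.

Lemma lateY N p z : crossing z ->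
  late N.+1 p z <-> (if p is p'.+1 then late N p' (S z) else False).
Proof. by case: p => [|p] Yz /=; (split; [case=> -[]//|left]). Qed.

Lemma lateN N p z : ~ crossing z -> late N.+1 p z <-> late N p (S z).
Proof. by case: p => [|p] Yz /=; (split; [case=> -[]//|right]). Qed.

Lemma changes_rcons w d e :
  changes (rcons (rcons w d) e) = (changes (rcons w d) + (d != e))%N.
Proof.
elim: w => [|a w ih]; first by rewrite /= !addn0 add0n.
have -> : changes (rcons (rcons (a :: w) d) e) =
    ((a != head d w) + changes (rcons (rcons w d) e))%N by case: (w).
have -> : changes (rcons (a :: w) d) = ((a != head d w) + changes (rcons w d))%N.
  by case: (w).
by rewrite ih addnA.
Qed.

Lemma cyl2_crossing w d e y : cyl (rcons (rcons w d) e) y ->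
  crossing (iter (size w) S y) <-> d != e.
Proof.
have h := @cyl_rcons _ _ gamma_gt1 _ S_branch.
by move=> /h[/h[_]]; rewrite size_rcons iterS /crossing /= => -> ->.
Qed.

(* Recursion on the tree of cylinders, along which the crossings still to be
   seen decrease: at the last one the cylinder [ccyl w e] has diameter at most
   [2 ^- q], hence lies in [Bp] as soon as it meets [B]. *)
Lemma pr_visit_tree N w e p q A B Bp : measurable A -> measurable B ->
  measurable Bp ->
  (forall y z, B y -> `|y - z| <= 2 ^- q -> Bp z) ->
  (changes (rcons w e) + p = q)%N ->
  pr (cyl (rcons w e) `&` (B `&` iter (size w) S @^-1` visit N p A))
    <= Kc * pr A * pr (cyl (rcons w e) `&` Bp).
Proof.
move=> mA mB mBp BBp; elim: N w e p => [|N ih] w e p pq.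
  rewrite /= preimage_set0 !setI0 pr0 mulr_ge0 ?pr_ge0//.
    by rewrite mulr_ge0 ?pr_ge0// ltW// Kc_gt0.
  by apply: measurableI => //; exact: measurable_cyl.
have mV m j : measurable (B `&` iter m S @^-1` visit N.+1 j A).
  by apply: measurableI => //; apply: measurable_preS => //; exact: measurable_visit.
have mV' m j : measurable (B `&` iter m S @^-1` visit N j A).
  by apply: measurableI => //; apply: measurable_preS => //; exact: measurable_visit.
have mc v (H : set R) : measurable H -> measurable (cyl v `&` H).
  by move=> mH; apply: measurableI => //; exact: measurable_cyl.
have split := pr_cyl_split gamma_gt1 S_branch (rcons w e) (~~ e).
rewrite !split// negbK mulrDr; apply: lerD.
  case: p pq => [|p] pq.
    have K0 : 0 <= Kc * pr A by rewrite mulr_ge0 ?pr_ge0// ltW// Kc_gt0.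
    have [[y0 [cy0 By0]]|none] := pselect (exists y, ccyl w e y /\ B y); last first.
      apply: (@le_trans _ _ 0); last by rewrite mulr_ge0 ?pr_ge0//; exact: mc.
      rewrite -pr0; apply: le_pr => //; first exact: mc.
      by move=> y yI [cy [By _]]; apply: none; exists y.
    have <- : pr (ccyl w e) = pr (ccyl w e `&` Bp).
      apply: eq_pr => y yI; split=> [cy|[]//]; split=> //.
      apply: (BBp y0) => //; rewrite -pq addn0.
      exact: (ccyl_diam gamma_gt1 S_branch cy0 cy).
    apply: le_trans (ccyl_quasi_indep gamma_gt1 mS S_branch w e mA).
    apply: le_pr; [exact: mc| |].
      by apply: mc; exact: measurable_preS.
    move=> y yI [cy [By Vy]]; split=> //.
    have Y := (cyl2_crossing cy).2 ltac:(by case: (e)).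
    by move: Vy => /= /(visitY N 0 A Y).
  rewrite (@eq_pr _ _ (cyl (rcons (rcons w e) (~~ e)) `&`
     (B `&` iter (size (rcons w e)) S @^-1` visit N p A))); last first.
    move=> y yI; split=> -[cy [By Vy]];
      have Y := (cyl2_crossing cy).2 ltac:(by case: (e)).
    - split=> //; split=> //; move: Vy => /= /(visitY N p.+1 A Y).
      by rewrite size_rcons.
    - split=> //; split=> //; apply/(visitY N p.+1 A Y).
      by move: Vy; rewrite /= size_rcons.
  apply: ih; rewrite changes_rcons -pq addnAC -addnA; congr (_ + _)%N.
  by case: (e); rewrite addn1.
rewrite (@eq_pr _ _ (cyl (rcons (rcons w e) e) `&`
   (B `&` iter (size (rcons w e)) S @^-1` visit N p A))); last first.
  move=> y yI; split=> -[cy [By Vy]].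
  - have Y : ~ crossing (iter (size w) S y).
      by move=> /(cyl2_crossing cy).1; rewrite eqxx.
    split=> //; split=> //; move: Vy => /= /(visitN N p A Y).
    by rewrite size_rcons.
  - have Y : ~ crossing (iter (size w) S y).
      by move=> /(cyl2_crossing cy).1; rewrite eqxx.
    split=> //; split=> //; apply/(visitN N p A Y).
    by move: Vy; rewrite /= size_rcons.
by apply: ih; rewrite changes_rcons eqxx addn0.
Qed.

Lemma pr_visit N p A B Bp : measurable A -> measurable B -> measurable Bp ->
  (forall y z, B y -> `|y - z| <= 2 ^- p -> Bp z) ->
  pr (B `&` visit N p A) <= Kc * pr A * pr Bp.
Proof.
move=> mA mB mBp BBp.
have split H := @pr_cyl_split _ _ gamma_gt1 _ S_branch [::] true H.
have nil H : pr (cyl [::] `&` H) = pr H.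
  by apply: eq_pr => y yI; split=> [[]//|Hy]; split=> //; exact/cyl_nil.
rewrite -nil -[X in _ <= _ * X]nil !split//; last first.
  by apply: measurableI => //; exact: measurable_visit.
rewrite mulrDr; apply: lerD.
  exact: (@pr_visit_tree N [::] true p p A B Bp).
exact: (@pr_visit_tree N [::] false p p A B Bp).
Qed.

(* The cylinders reached at the last crossing lie in [B], miss [B] or lie in
   [Bd]; mixing is applied to the first ones. *)
Lemma pr_mixing_tree (k : R) M N w e p q n A B Bd : 0 <= k ->
  (forall n w e A, (M <= n)%N -> measurable A ->
    `|pr (ccyl w e `&` iter (size w + n) S @^-1` A) - pr (ccyl w e) * pr A|
      <= k * pr (ccyl w e)) ->
  measurable A -> measurable B -> measurable Bd ->
  (forall y y' z, B y -> ~ B y' -> `|y - y'| <= 2 ^- q -> `|y - z| <= 2 ^- q ->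
    Bd z) ->
  (changes (rcons w e) + p = q)%N -> (size w + N + M <= n)%N ->
  `|pr (cyl (rcons w e) `&` (B `&` iter n S @^-1` A)) -
    pr (cyl (rcons w e) `&` B) * pr A| <=
  k * pr (cyl (rcons w e) `&` B) +
  pr (cyl (rcons w e) `&` (B `&` iter (size w) S @^-1` late N p)) +
  pr (cyl (rcons w e) `&` Bd).
Proof.
move=> k0 hM mA mB mBd BBd.
have mc v (H : set R) : measurable H -> measurable (cyl v `&` H).
  by move=> mH; apply: measurableI => //; exact: measurable_cyl.
have mnA m : measurable (iter m S @^-1` A) by exact: measurable_preS.
have mL i m j : measurable (B `&` iter m S @^-1` late i j).
  by apply: measurableI => //; apply: measurable_preS => //; exact: measurable_late.
have mBA m : measurable (B `&` iter m S @^-1` A) by exact: measurableI.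
have crude v m : `|pr (cyl v `&` (B `&` iter m S @^-1` A)) -
    pr (cyl v `&` B) * pr A| <= pr (cyl v `&` B).
  have h1 : pr (cyl v `&` (B `&` iter m S @^-1` A)) <= pr (cyl v `&` B).
    by apply: le_pr; [exact: mc|exact: mc|move=> y yI [cy []]].
  have h2 := pr_ge0 (mc v _ (mBA m)); have h3 := pr_ge0 (mc v _ mB).
  have h4 : pr (cyl v `&` B) * pr A <= pr (cyl v `&` B).
    by rewrite ler_piMr// pr_le1.
  have h5 : 0 <= pr (cyl v `&` B) * pr A by rewrite mulr_ge0// pr_ge0.
  by rewrite ler_norml; lra.
elim: N w e p => [|N ih] w e p pq nN.
  (* Out of time: every point counts as late, and the trivial bound suffices. *)
  apply: le_trans (crude _ _) _; rewrite /= preimage_setT setIT.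
  have := mulr_ge0 k0 (pr_ge0 (mc (rcons w e) _ mB)).
  by have := pr_ge0 (mc (rcons w e) _ mBd); lra.
have split := pr_cyl_split gamma_gt1 S_branch (rcons w e) (~~ e).
rewrite !split// negbK.
set x1 := pr (cyl (rcons (rcons w e) (~~ e)) `&` (B `&` iter n S @^-1` A)).
set x2 := pr (cyl (rcons (rcons w e) e) `&` (B `&` iter n S @^-1` A)).
set b1 := pr (cyl (rcons (rcons w e) (~~ e)) `&` B).
set b2 := pr (cyl (rcons (rcons w e) e) `&` B).
set l1 := pr (_ `&` (_ `&` _ @^-1` late _ _)).
set l2 := pr (_ `&` (_ `&` _ @^-1` late _ _)).
set d1 := pr (_ `&` Bd); set d2 := pr (_ `&` Bd).
have h1 : `|x1 - b1 * pr A| <= k * b1 + l1 + d1.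
  case: p pq @l1 l2 => [|p] pq l1 l2.
    have l10 : 0 <= l1 by apply: pr_ge0; exact: mc.
    have d10 : 0 <= d1 by apply: pr_ge0; exact: mc.
    have kb0 : 0 <= k * b1 by rewrite mulr_ge0// pr_ge0//; exact: mc.
    have [[y0 [cy0 By0]]|none] := pselect (exists y, ccyl w e y /\ B y); last first.
      have b10 : b1 = 0.
        by rewrite -pr0; apply: eq_pr => y yI; split=> // -[cy By];
          apply: none; exists y.
      have := crude (rcons (rcons w e) (~~ e)) n.
      by rewrite -/x1 -/b1 b10 normr_le0 => /eqP ->; rewrite normr0; lra.
    have [[y1 [cy1 By1]]|all] := pselect (exists y, ccyl w e y /\ ~ B y).
      have dE : d1 = pr (ccyl w e).
        apply: eq_pr => y yI; split=> [[]//|cy]; split=> //.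
        apply: (BBd y0 y1) => //; rewrite -pq addn0;
          exact: (ccyl_diam gamma_gt1 S_branch).
      have b1d : b1 <= d1.
        rewrite dE; apply: le_pr; [exact: mc|exact: measurable_ccyl|].
        by move=> y yI [].
      by have := crude (rcons (rcons w e) (~~ e)) n; rewrite -/x1 -/b1; lra.
    have cB y : ccyl w e y -> B y.
      by move=> cy; apply: contrapT => nBy; apply: all; exists y.
    have b1E : b1 = pr (ccyl w e).
      by apply: eq_pr => y yI; split=> [[]//|cy]; split=> //; exact: cB.
    have x1E : x1 = pr (ccyl w e `&` iter (size w + (n - size w)) S @^-1` A).
      rewrite subnKC; last by lia.
      apply: eq_pr => y yI; split=> [[cy []]//|[cy Ay]]; split=> //.
      by split=> //; exact: cB.
    have := hM (n - size w)%N w e A ltac:(lia) mA.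
    by rewrite -x1E -b1E; lra.
  have -> : l1 = pr (cyl (rcons (rcons w e) (~~ e)) `&`
     (B `&` iter (size (rcons w e)) S @^-1` late N p)).
    apply: eq_pr => y yI; split=> -[cy [By Vy]];
      have Y := (cyl2_crossing cy).2 ltac:(by case: (e)).
    - split=> //; split=> //; move: Vy => /= /(lateY N p.+1 Y).
      by rewrite size_rcons.
    - split=> //; split=> //; apply/(lateY N p.+1 Y).
      by move: Vy; rewrite /= size_rcons.
  apply: ih; last by rewrite size_rcons; lia.
  rewrite changes_rcons -pq addnAC -addnA; congr (_ + _)%N.
  by case: (e); rewrite addn1.
have h2 : `|x2 - b2 * pr A| <= k * b2 + l2 + d2.
  have -> : l2 = pr (cyl (rcons (rcons w e) e) `&`
     (B `&` iter (size (rcons w e)) S @^-1` late N p)).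
    apply: eq_pr => y yI; split=> -[cy [By Vy]].
    - have Y : ~ crossing (iter (size w) S y).
        by move=> /(cyl2_crossing cy).1; rewrite eqxx.
      split=> //; split=> //; move: Vy => /= /(lateN N p Y).
      by rewrite size_rcons.
    - have Y : ~ crossing (iter (size w) S y).
        by move=> /(cyl2_crossing cy).1; rewrite eqxx.
      split=> //; split=> //; apply/(lateN N p Y).
      by move: Vy; rewrite /= size_rcons.
  apply: ih; last by rewrite size_rcons; lia.
  by rewrite changes_rcons eqxx addn0.
have -> : x1 + x2 - (b1 + b2) * pr A = (x1 - b1 * pr A) + (x2 - b2 * pr A) by ring.
by apply: le_trans (ler_normD _ _) _; lra.
Qed.

Lemma pr_mixing (k : R) M N q n A B Bd : 0 <= k ->
  (forall n w e A, (M <= n)%N -> measurable A ->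
    `|pr (ccyl w e `&` iter (size w + n) S @^-1` A) - pr (ccyl w e) * pr A|
      <= k * pr (ccyl w e)) ->
  measurable A -> measurable B -> measurable Bd ->
  (forall y y' z, B y -> ~ B y' -> `|y - y'| <= 2 ^- q -> `|y - z| <= 2 ^- q ->
    Bd z) ->
  (N + M <= n)%N ->
  `|pr (B `&` iter n S @^-1` A) - pr B * pr A| <=
    k * pr B + pr (B `&` late N q) + pr Bd.
Proof.
move=> k0 hM mA mB mBd BBd nN.
have split H := @pr_cyl_split _ _ gamma_gt1 _ S_branch [::] true H.
have nil H : pr (cyl [::] `&` H) = pr H.
  by apply: eq_pr => y yI; split=> [[]//|Hy]; split=> //; exact/cyl_nil.
have mBA : measurable (B `&` iter n S @^-1` A).
  by apply: measurableI => //; exact: measurable_preS.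
have mBl : measurable (B `&` late N q).
  by apply: measurableI => //; exact: measurable_late.
rewrite -(nil (B `&` iter n S @^-1` A)) -(nil B) -(nil (B `&` late N q)) -(nil Bd).
rewrite !split//.
have h1 := @pr_mixing_tree k M N [::] true q q n A B Bd k0 hM mA mB mBd BBd erefl nN.
have h2 := @pr_mixing_tree k M N [::] false q q n A B Bd k0 hM mA mB mBd BBd erefl nN.
move: h1 h2 => /=.
set x1 := pr (_ `&` (B `&` iter n S @^-1` A)).
set x2 := pr (_ `&` (B `&` iter n S @^-1` A)).
set b1 := pr (_ `&` B); set b2 := pr (_ `&` B) => h1 h2.
have -> : x1 + x2 - (b1 + b2) * pr A = (x1 - b1 * pr A) + (x2 - b2 * pr A) by ring.
by apply: le_trans (ler_normD _ _) _; lra.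
Qed.

Definition long_excursion L : set R := crossing `&` S @^-1` late L 0.

Lemma measurable_long_excursion L : measurable (long_excursion L).
Proof.
apply: measurableI; first exact: measurable_crossing.
by apply: mS1; exact: measurable_late.
Qed.

(** A time budget: [l] steps for the first crossing and [L.+1] for each of the [p] crossings that
    follow. A point that overruns it has overrun one of the shares. *)
Lemma late_sub N p l L z : (l + p * L.+1 <= N)%N -> late N p z ->
  late l 0 z \/ exists2 j, (j < p)%N & visit N j (long_excursion L) z.
Proof.
elim: N p l z => [|N ih] p l z; first by case: l => // _ _; left.
have [Yz|Yz] := pselect (crossing z).
  case: p => [|p] lN; first by move=> /(lateY N 0 Yz).
  move=> /(lateY N p.+1 Yz) Lz; right.
  have [LSz|[j jp Vj]] := ih p L (S z) ltac:(rewrite mulSn in lN; lia) Lz.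
    by exists 0%N => //; apply/(visitY N 0 _ Yz).
  by exists j.+1 => //; apply/(visitY N j.+1 _ Yz).
move=> lN /(lateN N p Yz) Lz; case: l lN => [|l] lN; first by left.
have [LSz|[j jp Vj]] := ih p l (S z) ltac:(lia) Lz.
  by left; apply/(lateN l 0 Yz).
by right; exists j => //; apply/(visitN N j _ Yz).
Qed.

Fixpoint crossings n (z : R) : nat :=
  if n is n'.+1 then ((((0 <= z) != (0 <= S z))%R : bool) + crossings n' (S z))%N else 0%N.

Lemma visit_at N n A z : (n < N)%N -> crossing (iter n S z) -> A (iter n S z) ->
  visit N (crossings n z) A z.
Proof.
elim: n N z => [|n ih] [|N] z //=; first by move=> _ Yz Az; left.
rewrite ltnS -iterS !iterSr => nN Yn An.
have [Yz|Yz] := boolP ((0 <= z) != (0 <= S z)).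
  by rewrite add1n; apply/(visitY N _.+1 A Yz); exact: ih.
by rewrite add0n; apply/visitN; [exact/negP|exact: ih].
Qed.

Lemma crossings_le n z : (crossings n z <= n)%N.
Proof. by elim: n z => //= n ih z; rewrite -add1n leq_add// leq_b1. Qed.

End trees.

(** * The tail of the excursion times *)

Section excursions.
Context {R : realType} (gamma : R) (gamma_gt1 : 1 < gamma).
Context (S : R -> R) (mS : measurable_fun setT S).
Hypothesis S_branch : forall d z, -1 <= z < 1 -> S (branch gamma d z) = z.
Local Notation branch := (branch gamma).
Local Notation wbranch := (wbranch gamma).
Local Notation bend := (bend gamma).
Local Notation phi := (phi gamma).
Local Notation cyl := (cyl gamma).
Local Notation late := (late S).
Local Notation crossing := (crossing S).
Implicit Types (A B : set R) (d e : bool) (w v : seq bool) (n L : nat).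

Ltac glra := move: (gamma_gt1) => ?; lra.

Lemma cyl_cons d v y : -1 <= y < 1 ->
  cyl (d :: v) y <-> (0 <= y) = d /\ cyl v (S y).
Proof.
move=> yI; have [SI Sy] := branch_S gamma_gt1 S_branch yI.
split.
  move=> /(cyl_wbranch gamma_gt1 S_branch)[z zI /= yz].
  have zI' := wbranch_itv gamma_gt1 v zI.
  rewrite yz S_branch// branch_sign//; split=> //; exact: wbranch_cyl.
move=> [<- /(cyl_wbranch gamma_gt1 S_branch)[z zI Syz]].
by rewrite -[y in cyl _ y]Sy Syz; exact: (wbranch_cyl gamma_gt1 (_ :: v)).
Qed.

Lemma late_cyl L z : -1 <= z < 1 -> late L 0 z -> cyl (nseq L (0 <= z)) z.
Proof.
elim: L z => [|L ih] z zI; first by move=> _; exact/cyl_nil.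
have [Yz|Yz] := pselect (crossing z); first by move=> /(lateY L 0 Yz).
move=> /(lateN L 0 Yz) Lz; apply/cyl_cons => //; split=> //.
have -> : (0 <= z) = (0 <= S z) by apply/eqP/negPn/negP.
by apply: ih => //; exact: (S_itv gamma_gt1 S_branch).
Qed.

(* The distance to the fixed point 1 of the [n]-th preimage of -1 in [0, 1] *)
Definition gap n : R := 1 - wbranch (nseq n true) (-1).

Lemma wbranch1 n : wbranch (nseq n true) 1 = 1.
Proof. by elim: n => //= n ->; exact: phi1. Qed.

Lemma wbranchN w z : wbranch (map negb w) z = - wbranch w (- z).
Proof.
elim: w => [|d w ih] /=; first by rewrite opprK.
by rewrite ih branchN// negbK.
Qed.

Lemma gap_itv n : 0 < gap n.+1 <= 1.
Proof.
have zI : -1 <= wbranch (nseq n true) (-1) < 1 by apply: wbranch_itv; glra.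
have := branch_true_itv gamma_gt1 zI; rewrite /gap /=; lra.
Qed.

Lemma phiB1 (u : R) : 0 <= u <= 1 -> phi (1 - u) = 1 - u + bend u.
Proof.
move=> uI; have -> : 1 - u = - (u - 1) by ring.
rewrite phiN// /phi ifT; last by lra.
by rewrite (_ : 1 + (u - 1) = u); ring.
Qed.

(** The recursion of a neutral fixed point: the relative decrease tends to 0 with the gap, whence a
    merely polynomial decay. *)
Lemma gapS n : gap n.+2 = gap n.+1 - bend (gap n.+1).
Proof.
have gI := gap_itv n; have h := @phiB1 (gap n.+1) ltac:(lra).
have e : 1 - gap n.+1 = wbranch (nseq n.+1 true) (-1) by rewrite /gap; ring.
have -> : gap n.+2 = 1 - phi (wbranch (nseq n.+1 true) (-1)) by [].
by rewrite -e h; ring.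
Qed.

Lemma gap1 : gap 1 = 1.
Proof. by rewrite /gap /= phiN1// subr0. Qed.

Lemma le_bend (u v : R) : 0 <= u -> u <= v -> bend u <= bend v.
Proof.
move=> u0 uv; rewrite /bend ler_pM2l ?invr_gt0; last by glra.
by apply: ge0_ler_powR => //; rewrite ?nnegrE; glra.
Qed.

Lemma gap_le m n : gap (m + n).+1 <= gap m.+1.
Proof.
elim: n => [|n ih]; first by rewrite addn0.
rewrite addnS gapS; apply: le_trans ih; rewrite gerBl; exact: bend_ge0.
Qed.

(** Telescoping of [gapS]: each of the [n] decrements is at least the [bend] on the left, because
    the gaps decrease. *)
Lemma bend_gap m n : n%:R * bend (gap (m + n).+1) <= gap m.+1 - gap (m + n).+1.
Proof.
elim: n => [|n ih]; first by rewrite mul0r addn0 subrr.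
have h : bend (gap (m + n).+2) <= bend (gap (m + n).+1).
  apply: le_bend; first by have := gap_itv (m + n).+1; lra.
  by have := gap_le (m + n) 1; rewrite addn1.
have h' := ler_wpM2l (ler0n R n.+1) h.
have e := gapS (m + n); rewrite addnS; move: ih h' e.
move: (gap (m + n).+2) (gap (m + n).+1) (gap m.+1) => a b c ih h' e {h}.
apply: le_trans h' _; have -> : c - a = c - b + bend b by rewrite {1}e opprB addrA addrAC.
by rewrite -(natr1 n) mulrDl mul1r lerD2r.
Qed.

Lemma pr_cyl w : pr (cyl w) = (wbranch w 1 - wbranch w (-1)) / 2.
Proof.
have aI : -1 <= wbranch w (-1) <= 1 by apply: wbranch_itvcc; glra.
have bI : -1 <= wbranch w 1 <= 1 by apply: wbranch_itvcc; glra.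
rewrite pr_itv//; [lra| |lra].
by apply: wbranch_le; glra.
Qed.

(** With [g] the gap, the cylinder for [d = false] is the image of [1 - g, 1[ under the branch into
    [-1, 0], namely [- bend g, 0[; the other one is its mirror image. *)
Lemma pr_cyl_flip d n : pr (cyl (d :: nseq n.+1 (~~ d))) = bend (gap n.+1) / 2.
Proof.
have gI := gap_itv n; have h := @phiB1 (gap n.+1) ltac:(lra).
have e : wbranch (nseq n.+1 true) (-1) = 1 - gap n.+1 by rewrite /gap; ring.
have hF : pr (cyl (false :: nseq n.+1 true)) = bend (gap n.+1) / 2.
  have hc v z : wbranch (false :: v) z = wbranch v z - phi (wbranch v z) by [].
  by rewrite pr_cyl !hc wbranch1 e phi1// h; field.
case: d => //; rewrite -hF !pr_cyl.
have -> : true :: nseq n.+1 (~~ true) = map negb (false :: nseq n.+1 true).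
  by rewrite /= map_nseq.
move: (false :: nseq n.+1 true) => w.
by rewrite (wbranchN w 1) (wbranchN w (-1)) !opprK addrC.
Qed.

Lemma pr_long_excursion L : pr (long_excursion S L.+1) <= bend (gap L.+1).
Proof.
have mc w : measurable (cyl w) by exact: measurable_cyl.
have -> : bend (gap L.+1) = pr (cyl (true :: nseq L.+1 false)) +
    pr (cyl (false :: nseq L.+1 true)).
  by rewrite (pr_cyl_flip true) (pr_cyl_flip false); field.
apply: le_trans (pr_setU_le _ _) => //; apply: le_pr.
- exact: measurable_long_excursion.
- exact: measurableU.
move=> z zI [Yz Lz].
have SI := S_itv gamma_gt1 S_branch zI.
have cz := late_cyl SI (Lz : late L.+1 0 (S z)).
have : cyl ((0 <= z) :: nseq L.+1 (0 <= S z)) z by apply/cyl_cons.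
move: Yz; rewrite /crossing /=.
by case: (0 <= z); case: (0 <= S z) => // _ ?; [left|right].
Qed.

(** [bend_gap] is used twice. From 0 to [n] it gives [n * bend (gap n.+1) <= 1], hence a gap of at
    most [2 * gamma * 2 ^- (2 * j)] because [gamma <= K]. From [n] to [2 * n] it bounds the tail by
    this gap divided by [n]: the gap is what the tail gains over 1 / n. *)
Lemma long_excursion_tail (K j n : nat) : gamma <= K%:R ->
  n = (2 ^ (2 * K * j))%N ->
  pr (long_excursion S (2 * n).+1) <= 2 * gamma * 2 ^- ((2 * K).+1 * j + j).
Proof.
move=> gK nE; have n0 : 0 < n%:R :> R by rewrite ltr0n nE expn_gt0.
apply: le_trans (pr_long_excursion _) _.
have u := gap_itv n.
have h1 := bend_gap 0 n; rewrite add0n gap1 in h1.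
have h2 := bend_gap n n; rewrite addnn -mul2n in h2.
have u2 := gap_itv (2 * n).
move: (gap n.+1) (gap (2 * n).+1) u h1 h2 u2 => a b u h1 h2 u2.
pose C : R := 2 * gamma; have C1 : 1 <= C by rewrite /C; glra.
have gapn : a <= C * 2 ^- (2 * j).
  rewrite leNgt; apply/negP => h.
  have x0 : 0 < 2 ^- (2 * j) :> R by rewrite invr_gt0 exprn_gt0.
  have x1 : 2 ^- (2 * j) <= 1 :> R by rewrite invf_le1 ?exprn_gt0// exprn_ege1// ler1n.
  have Cx0 : 0 < C * 2 ^- (2 * j) by rewrite mulr_gt0//; lra.
  have : (C * 2 ^- (2 * j)) `^ gamma < a `^ gamma.
    by apply: gt0_ltr_powR => //; rewrite ?nnegrE ?in_itv/= ?andbT; glra.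
  rewrite powRM; [|lra|exact: ltW].
  have y1 : C <= C `^ gamma by apply: le1r_powR => //; glra.
  have y2 : 2 ^- (2 * K * j) <= (2 ^- (2 * j)) `^ gamma.
    apply: (@le_trans _ _ ((2 ^- (2 * j)) `^ K%:R)).
      rewrite powR_mulrn; last exact: ltW.
      by rewrite exprVn -exprM mulnAC.
    by apply: ger_powR => //; rewrite x0 x1.
  have z0 : 0 < 2 ^- (2 * K * j) :> R by rewrite invr_gt0 exprn_gt0.
  have y3 : C * 2 ^- (2 * K * j) <= C `^ gamma * (2 ^- (2 * j)) `^ gamma.
    by apply: ler_pM => //; lra.
  have : n%:R * bend (a) <= 1 by lra.
  rewrite /bend -/C => h4 h5.
  have : n%:R * (C^-1 * (C * 2 ^- (2 * K * j))) < n%:R * (C^-1 * a `^ gamma).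
    rewrite ltr_pM2l// ltr_pM2l ?invr_gt0; [exact: le_lt_trans h5|lra].
  rewrite mulKf; last by rewrite gt_eqF//; lra.
  have -> : n%:R * 2 ^- (2 * K * j) = 1 :> R.
    by rewrite nE natrX divff// expf_neq0.
  by lra.
have h3 : bend (b) <= C * 2 ^- (2 * j) / n%:R.
  by rewrite ler_pdivlMr// mulrC; lra.
apply: le_trans h3 _.
rewrite le_eqVlt; apply/orP; left; apply/eqP; rewrite -/C -mulrA; congr (_ * _).
rewrite nE natrX -invfM -exprD; congr (2 ^- _).
by clear; rewrite mulSn; lia.
Qed.

Lemma gap_small (k : R) : 0 < k -> exists n, gap n.+1 < k.
Proof.
move=> k0; have [n hn] : exists n : nat, (bend k)^-1 < n%:R.
  by exists (Num.truncn (bend k)^-1).+1; exact: truncnS_gt.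
exists n; rewrite ltNge; apply/negP => kg.
have bk0 : 0 < bend k.
  by rewrite mulr_gt0 ?powR_gt0// invr_gt0; glra.
have := bend_gap 0 n; rewrite add0n gap1 => h.
have := le_bend (ltW k0) kg => hb.
have := ler_wpM2l (ler0n R n) hb => h'.
move: hn; rewrite -div1r ltr_pdivrMr// => hn.
have := gap_itv n; move: (gap n.+1) h h' => a h h'; lra.
Qed.

End excursions.

(** * Returns to small balls *)

Section returns.
Context {R : realType} (gamma : R) (gamma_gt1 : 1 < gamma).
Context (S : R -> R) (mS : measurable_fun setT S).
Hypothesis S_branch : forall d z, -1 <= z < 1 -> S (branch gamma d z) = z.
Local Notation branch := (branch gamma).
Local Notation phi := (phi gamma).
Local Notation wbranch := (wbranch gamma).
Local Notation cyl := (cyl gamma).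
Local Notation late := (late S).
Local Notation crossing := (crossing S).
Local Notation crossings := (crossings S).
Local Notation visit := (visit S).
Local Notation Kc := (Kc gamma).
Implicit Types (A B : set R) (d e : bool) (w v : seq bool) (n L : nat).

Ltac glra := move: (gamma_gt1) => ?; lra.

Let SI := S_itv gamma_gt1 S_branch.
Let SIn := @iter_S_itv _ _ gamma_gt1 _ S_branch.

(** The orbit of [x] never reaches the fixed point -1: [x] is interior to each of its cylinders and
    crosses infinitely often. *)
Definition interior_pt (x : R) := forall w, x <> wbranch w (-1).

(** The last clause excludes periodic points, which are the fixed points of the maps [wbranch w]. *)
Definition generic (x : R) := [/\ -1 <= x < 1, interior_pt x &
  forall w, w != [::] -> wbranch w x <> x].

Lemma interior_ptS x : -1 <= x < 1 -> interior_pt x -> interior_pt (S x).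
Proof.
move=> xI ix w Sx; apply: (ix ((0 <= x) :: w)).
by have [_ {1}<-] := branch_S gamma_gt1 S_branch xI; rewrite Sx.
Qed.

Lemma interior_pt_iter n x : -1 <= x < 1 -> interior_pt x ->
  interior_pt (iter n S x).
Proof.
by move=> xI ix; elim: n => //= n; apply: interior_ptS; exact: SIn.
Qed.

Lemma no_crossing_late n x : (forall i, ~ crossing (iter i S x)) -> late n 0 x.
Proof.
elim: n x => // n ih x nc; apply/(lateN n 0 (nc 0%N)); apply: ih => i.
by rewrite -iterSr; exact: nc.
Qed.

(** Without a crossing [x] would lie in the cylinders of all constant words on one letter, which
    shrink to the fixed point. *)
Lemma interior_crossing x : -1 <= x < 1 -> interior_pt x ->
  exists n, crossing (iter n S x).
Proof.
move=> xI ix; apply: contrapT => nc.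
have Lx n : cyl (nseq n (0 <= x)) x.
  apply: (late_cyl gamma_gt1 S_branch) => //.
  by apply: no_crossing_late => i ci; apply: nc; exists i.
have x1 : 0 < 1 + x.
  have : x != -1 by apply/eqP; exact: (ix [::]).
  by rewrite neq_lt; lra.
have x2 : 0 < 1 - x by lra.
have [n1 g1] := gap_small gamma_gt1 x1.
have [n2 g2] := gap_small gamma_gt1 x2.
have := Lx n1.+1; have := Lx n2.+1.
have bN n : wbranch (nseq n false) 1 = - wbranch (nseq n true) (-1).
  have -> : nseq n false = map negb (nseq n true) by rewrite map_nseq.
  exact: wbranchN.
case: (0 <= x); rewrite /cyl /= !in_itv/=.
  move=> /andP[+ _] _; move: g2; rewrite /gap /=.
  by move: (phi _) => a; lra.
move=> _ /andP[_]; have := bN n1.+1 => /= ->; move: g1; rewrite /gap /=.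
by move: (phi _) => a; lra.
Qed.

Lemma crossings_add a b z :
  crossings (a + b) z = (crossings a z + crossings b (iter a S z))%N.
Proof. by elim: a z => // a ih z; rewrite addSn iterSr /= ih addnA. Qed.

Lemma interior_crossings J x : -1 <= x < 1 -> interior_pt x ->
  exists n, (J < crossings n x)%N.
Proof.
move=> xI ix.
have one y : -1 <= y < 1 -> interior_pt y -> exists n, (0 < crossings n y)%N.
  move=> yI iy; have [n cn] := interior_crossing yI iy; exists (n + 1)%N.
  rewrite crossings_add ltn_addl//=.
  by move: cn; rewrite /crossing /= => ->.
elim: J => [|J [n hn]]; first exact: one.
have [m hm] := one _ (SIn n xI) (interior_pt_iter xI ix).
by exists (n + m)%N; rewrite crossings_add; lia.
Qed.

Fixpoint digits n (x : R) : seq bool :=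
  if n is n'.+1 then (0 <= x) :: digits n' (S x) else [::].

Lemma size_digits n x : size (digits n x) = n.
Proof. by elim: n x => //= n ih x; rewrite ih. Qed.

Lemma cyl_digits n x : -1 <= x < 1 -> cyl (digits n x) x.
Proof.
elim: n x => [|n ih] x xI; first exact/cyl_nil.
by apply/(cyl_cons gamma_gt1 S_branch) => //; split=> //; apply: ih; exact: SI.
Qed.

Lemma cyl_digits_le k n x y : (k <= n)%N -> -1 <= y < 1 ->
  cyl (digits n x) y -> cyl (digits k x) y.
Proof.
elim: k n x y => [|k ih] [|n] x y // kn yI.
move=> /(cyl_cons gamma_gt1 S_branch _ _ yI)[dy cy].
apply/(cyl_cons gamma_gt1 S_branch) => //; split=> //.
by apply: (ih n) => //; exact: SI.
Qed.

(** One digit more than steps, since a crossing compares two successive digits. *)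
Lemma digits_crossings n x y : -1 <= x < 1 -> -1 <= y < 1 ->
  cyl (digits n.+1 x) y -> crossings n y = crossings n x.
Proof.
elim: n x y => // n ih x y xI yI.
move=> /(cyl_cons gamma_gt1 S_branch _ _ yI)[dy cy].
have := cy => /(cyl_cons gamma_gt1 S_branch _ _ (SI yI))[dSy _].
by rewrite /= dy dSy (ih (S x))//; exact: SI.
Qed.

Lemma cyl_nbhd w x : interior_pt x -> cyl w x ->
  exists2 r0 : R, 0 < r0 & forall y, `|y - x| < r0 -> cyl w y.
Proof.
move=> ix; rewrite /cyl /= in_itv/= => /andP[x1 x2].
have {}x1 : wbranch w (-1) < x.
  by rewrite lt_neqAle x1 andbT; apply/eqP => e; exact: (ix w).
exists (Num.min (x - wbranch w (-1)) (wbranch w 1 - x)).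
  by rewrite lt_min !subr_gt0 x1.
move=> y; rewrite lt_min !ltr_norml in_itv/= => /andP[/andP[h1 h2] /andP[h3 h4]].
by apply/andP; split; lra.
Qed.

(** If [y] shares [n] digits [w] with [x] and returns near [x] at time [n], then [y] is the image
    under [wbranch w] of a point near [x], so it is near [wbranch w x], which differs from [x]. Half
    the difference, [g], is the forbidden distance. *)
Lemma no_return x n : generic x -> exists2 r0 : R, 0 < r0 &
  forall y k, (0 < k <= n)%N -> cyl (digits n x) y -> `|y - x| < r0 ->
    r0 <= `|iter k S y - x|.
Proof.
move=> [xI ix px]; elim: n => [|n [r1 r10 h1]]; first by exists 1 => // y [].
pose w := digits n.+1 x; pose g := `|wbranch w x - x| / 2.
have g0 : 0 < g.
  by rewrite divr_gt0// normr_gt0 subr_eq0; apply/eqP; exact: px.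
exists (Num.min r1 g); first by rewrite lt_min r10.
move=> y k /andP[k0 kn] cy; rewrite lt_min => /andP[yr1 yg].
have yI := cyl_itv gamma_gt1 S_branch cy.
rewrite ge_min; move: kn; rewrite leq_eqVlt => /predU1P[kE|kn].
  apply/orP; right; rewrite leNgt; apply/negP => zg.
  have := cy => /(cylE gamma_gt1 S_branch)[_]; rewrite size_digits -kE.
  have zI := SIn k yI; set z := iter k S y in zI zg *; rewrite -/w kE -/w => yE.
  have lip : `|wbranch w x - wbranch w z| <= `|x - z|.
    have [xz|/ltW zx] := leP x z.
      rewrite distrC [`|x - z|]distrC !ger0_norm ?subr_ge0//.
        by apply: wbranch_contr_le; glra.
      by apply: wbranch_le; glra.
    rewrite !ger0_norm ?subr_ge0//.
      by apply: wbranch_contr_le; glra.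
    by apply: wbranch_le; glra.
  have : `|wbranch w x - x| <= `|wbranch w x - wbranch w z| + `|y - x|.
    by rewrite -yE; exact: ler_distD.
  by move: zg yg lip; rewrite /g [`|x - z|]distrC; lra.
apply/orP; left; apply: h1 => //; first by rewrite k0.
by apply: (cyl_digits_le (n := n.+1)).
Qed.

Definition bal (x r : R) : set R := [set` `]x - r, x + r[].

Lemma balE x r y : bal x r y <-> `|y - x| < r.
Proof. by rewrite /bal /= in_itv/= ltr_norml; split; lra. Qed.

Lemma measurable_bal x r : measurable (bal x r).
Proof. exact: measurable_itv. Qed.

Lemma pr_itvcc_le (a b : R) : a <= b -> pr [set` `[a, b]] <= (b - a) / 2.
Proof.
move=> ab; rewrite prE// mulrC ler_pM2r ?invr_gt0//.
have e : lebesgue_measure [set` `[a, b]] = (b - a)%:E.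
  rewrite lebesgue_measure_itv/= lte_fin; move: ab; rewrite le_eqVlt.
  by move=> /predU1P[->|-> //]; rewrite ltxx subrr.
pose I : set R := [set` `[-1, 1[].
have h : (lebesgue_measure ([set` `[a, b]] `&` I) <=
    lebesgue_measure ([set` `[a, b]] : set R))%E.
  have mA : measurable ([set` `[a, b]] : set R) by exact: measurable_itv.
  have mAI : measurable (([set` `[a, b]] : set R) `&` I).
    by apply: measurableI => //; exact: measurable_itv.
  by apply: le_measure; rewrite ?inE//; exact: subIsetl.
rewrite -lee_fin -e fineK// ge0_fin_numE//.
by apply: (le_lt_trans h); rewrite [X in (X < _)%E]e ltry.
Qed.

Lemma pr_bal_le x r : 0 <= r -> pr (bal x r) <= r.
Proof.
move=> r0; apply: (@le_trans _ _ (pr [set` `[x - r, x + r]])).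
  apply: le_pr; [exact: measurable_bal|exact: measurable_itv|].
  by move=> y _; rewrite /bal /= !in_itv/=; lra.
by apply: le_trans (pr_itvcc_le _) _; lra.
Qed.

(** The [2 ^- p]-neighbourhood of the ball has measure at most [r + 2 ^- p], half its length. *)
Lemma pr_visit_bal x r N p A : 0 <= r -> measurable A ->
  pr (bal x r `&` visit N p A) <= Kc * pr A * (r + 2 ^- p).
Proof.
move=> r0 mA; have s0 : 0 <= 2 ^- p :> R by rewrite invr_ge0 exprn_ge0.
have mB := measurable_bal x r.
have := @pr_visit _ _ gamma_gt1 _ mS S_branch N p A (bal x r)
  [set` `[x - (r + 2 ^- p), x + (r + 2 ^- p)]] mA mB (measurable_itv _).
move=> /(_ _)/le_trans; apply.
  move=> y z /balE; rewrite ltr_norml => h1; rewrite ler_norml => h2.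
  by rewrite /= in_itv/=; lra.
apply: ler_wpM2l.
  by rewrite mulr_ge0 ?pr_ge0// ltW// Kc_gt0.
by apply: le_trans (pr_itvcc_le _) _; lra.
Qed.

End returns.

(** * Short returns are negligible *)

Section short_returns.
Context {R : realType} (gamma : R) (gamma_gt1 : 1 < gamma).
Context (S : R -> R) (mS : measurable_fun setT S).
Hypothesis S_branch : forall d z, -1 <= z < 1 -> S (branch gamma d z) = z.
Local Notation branch := (branch gamma).
Local Notation wbranch := (wbranch gamma).
Local Notation wweight := (wweight gamma).
Local Notation cyl := (cyl gamma).
Local Notation ccyl := (ccyl gamma).
Local Notation core := (core gamma).
Local Notation coreset := (coreset gamma).
Local Notation late := (late S).
Local Notation crossing := (crossing S).
Local Notation crossings := (crossings S).
Local Notation visit := (visit S).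
Local Notation digits := (digits S).
Local Notation Kc := (Kc gamma).
Implicit Types (A B : set R) (d e : bool) (w v : seq bool) (n L : nat).

Let SIn := @iter_S_itv _ _ gamma_gt1 _ S_branch.

Definition avoid B n : set R :=
  [set y | forall k, (0 < k <= n)%N -> ~ B (iter k S y)].

Lemma avoidS B n : avoid B n.+1 = avoid B n `&` ~` (iter n.+1 S @^-1` B).
Proof.
apply/seteqP; split=> y.
  move=> h; split; last by apply: h; rewrite leqnn.
  by move=> k /andP[k0 kn]; apply: h; rewrite k0 ltnW.
move=> [h hn] k /andP[k0]; rewrite leq_eqVlt ltnS => /predU1P[->|kn]; first exact: hn.
by apply: h; rewrite k0.
Qed.

Lemma measurable_avoid B n : measurable B -> measurable (avoid B n).
Proof.
move=> mB; elim: n => [|n ih].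
  have -> : avoid B 0 = setT by apply/seteqP; split=> // y _ k; rewrite leqn0; case: k.
  exact: measurableT.
rewrite avoidS; apply: measurableI => //.
by apply: measurableC; exact: measurable_preS.
Qed.

Lemma avoidD B m n y : avoid B (m + n) y <-> avoid B m y /\ avoid B n (iter m S y).
Proof.
split.
  move=> h; split=> k /andP[k0 kn]; first by apply: h; rewrite k0 (leq_trans kn)// leq_addr.
  by rewrite -iterD; apply: h; lia.
move=> [h1 h2] k /andP[k0 kn]; have [km|mk] := leqP k m; first by apply: h1; rewrite k0.
by have := h2 (k - m)%N; rewrite -iterD subnK; [apply; lia|exact: ltnW].
Qed.

Lemma pr_avoid_drop B n : measurable B ->
  pr (avoid B n) - pr (avoid B n.+1) = pr (B `&` avoid B n).
Proof.
move=> mB; have mA := measurable_avoid n mB.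
have -> : pr (avoid B n.+1) = pr (avoid B n `&` ~` B).
  have mAB : measurable (avoid B n `&` ~` B).
    by apply: measurableI => //; exact: measurableC.
  rewrite -(pr_preS gamma_gt1 mS S_branch 1 mAB).
  apply: eq_pr => y _; rewrite -add1n.
  apply: (iff_trans (avoidD B 1 n y)); split.
    by move=> [h1 h2]; split=> //; exact: (h1 1%N).
  move=> [h1 h2]; split=> // k; case: k => // -[|k] // _; exact: h2.
by rewrite (pr_split mA mB) addrK setIC.
Qed.

Lemma pr_avoid_ge B n : measurable B -> 1 - n%:R * pr B <= pr (avoid B n).
Proof.
move=> mB; elim: n => [|n ih].
  rewrite mul0r subr0 -pr_full; apply: le_pr => //; first exact: measurable_avoid.
  by move=> y _ _ k; rewrite leqn0; case: k.
have := pr_avoid_drop n mB.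
have : pr (B `&` avoid B n) <= pr B.
  apply: le_pr => //; last by move=> y _ [].
  by apply: measurableI => //; exact: measurable_avoid.
by rewrite -(natr1 n) mulrDl mul1r; lra.
Qed.

Lemma pow2_small (k : R) : 0 < k -> exists J : nat, 2 ^- J < k.
Proof.
move=> k0; have [n hn] : exists n : nat, k^-1 < n%:R.
  by exists (Num.truncn k^-1).+1; exact: truncnS_gt.
exists n.
rewrite -[ltRHS]invrK ltf_pV2 ?posrE ?invr_gt0 ?exprn_gt0//.
by apply: lt_le_trans hn _; rewrite -natrX ler_nat ltnW// ltn_expl.
Qed.

Lemma geo_sum J n : \sum_(i < n) 2 ^- (J.+1 + i) = 2 ^- J - 2 ^- (J + n) :> R.
Proof.
elim: n => [|n ih]; first by rewrite big_ord0 addn0 subrr.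
rewrite big_ord_recr/= ih addnS addSn exprS; field.
by rewrite !expf_neq0.
Qed.

Lemma measurable_wbranch v : measurable_fun setT (wbranch v).
Proof.
elim: v => [|d v ih] /=; first exact: measurable_id.
exact: (measurableT_comp (measurable_branch _ d)).
Qed.

Lemma late_not m l y : (m < l)%N -> crossing (iter m S y) -> ~ late l 0 y.
Proof.
elim: m l y => [|m ih] [|l] y // ml Yy.
  by move=> /(lateY l 0 Yy).
have [Y0|Y0] := pselect (crossing y); first by move=> /(lateY l 0 Y0).
by move=> /(lateN l 0 Y0); apply: ih => //; rewrite -iterSr.
Qed.

(** A return to the ball need not occur at a crossing, so the ball is followed up to a time [m] at
    which the centre crosses. For small [r] it lies in one [ccyl v e], and a return at time [i]
    becomes a visit, at the crossing of time [m + i], to the copy [B'] of the ball in the core. Its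
    visit number exceeds [J], and visit number [j] costs at most [Kc * (r / W) * (r + 2 ^- j)]; the
    two terms sum to the last bound. *)
Lemma short_returns x : generic gamma x -> exists m, exists2 C : R, 0 < C &
  forall k : R, 0 < k -> exists2 r0 : R, 0 < r0 & forall r, 0 < r < r0 ->
  [/\ -1 <= x - r, x + r <= 1, forall y, bal x r y -> ~ late m.+1 0 y &
   forall N, pr (bal x r `&` ~` avoid (bal x r) N) <=
     (k + C * ((N + m)%:R * r)) * r].
Proof.
move=> gx; have [xI ix _] := gx.
have [m Ym] := interior_crossing gamma_gt1 S_branch xI ix.
pose v := digits m x; pose e := 0 <= iter m S x.
have sv : size v = m by exact: size_digits.
have ex : core e (iter m S x).
  apply/(core_cyl gamma_gt1 S_branch); first exact: SIn.
  split=> //; move: Ym; rewrite /crossing /= -/e.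
  by case: e; case: (0 <= S _).
have cx : ccyl v e x.
  apply/(ccylE gamma_gt1 S_branch); rewrite sv; split=> //.
  exact: cyl_digits.
have [r1 r10 hr1] := cyl_nbhd ix cx.
(* By bounded distortion, a lower bound for the weight of [v] on the core; it makes the measure of
   [B'] at most [r / W]. *)
pose W := (expR 2)^-1 * wweight v (iter m S x).
have W0 : 0 < W.
  rewrite mulr_gt0 ?invr_gt0 ?expR_gt0//.
  exact: (wweight_gt0 gamma_gt1 v (core_in_half gamma_gt1 ex)).
have K0 := Kc_gt0 gamma_gt1.
exists m; exists (Kc / W); first by rewrite divr_gt0.
move=> k k0.
(* The sum of [2 ^- j] over [j > J] is at most [2 ^- J], made negligible here; [n] is then a time by
   which the centre has crossed more than [J] times. *)
have [J hJ] := @pow2_small (k * W / Kc) ltac:(by rewrite divr_gt0// mulr_gt0).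
have [n hn] := interior_crossings gamma_gt1 S_branch J xI ix.
have [r2 r20 hr2] := cyl_nbhd ix (cyl_digits gamma_gt1 S_branch n.+1 xI).
have [r3 r30 hr3] := no_return gamma_gt1 S_branch n gx.
have [r4 r40 hr4] := cyl_nbhd (w := [::]) ix ((cyl_nil gamma x).2 xI).
exists (Num.min (Num.min r1 r2) (Num.min r3 (r4 / 2))).
  by rewrite !lt_min r10 r20 r30 divr_gt0.
move=> r /andP[r0]; rewrite !lt_min => /andP[/andP[rr1 rr2] /andP[rr3 rr4]].
set B := bal x r; have mB : measurable B by exact: measurable_bal.
have Bx y : B y -> `|y - x| < r by move=> /balE.
have Bc y : B y -> ccyl v e y.
  by move=> /Bx yx; apply: hr1; exact: lt_trans yx rr1.
have BY y : B y -> crossing (iter m S y) /\ core e (iter m S y).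
  move=> /Bc /(ccylE gamma_gt1 S_branch)[cv]; rewrite sv => cm; split=> //.
  have := cm => /(core_cyl gamma_gt1 S_branch _ (core_itv gamma_gt1 cm)).
  by move=> [h1 h2]; rewrite /crossing /= h1 h2; case: (e).
split.
- have := hr4 (x - r) ltac:(by rewrite addrAC subrr sub0r normrN gtr0_norm//; lra).
  by move=> /cyl_nil; lra.
- have := hr4 (x + r) ltac:(by rewrite addrAC subrr add0r gtr0_norm//; lra).
  by move=> /cyl_nil; lra.
- by move=> y /BY[Yy _]; apply: (late_not (m := m)).
move=> N.
pose A := wbranch v @^-1` B.
have mA : measurable A.
  by rewrite -[A]setTI; apply: measurable_wbranch => //.
pose B' := coreset e `&` A.
have mB' : measurable B' by apply: measurableI => //; exact: measurable_coreset.
have prB' : pr B' <= r / W.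
  rewrite ler_pdivlMr// mulrC.
  apply: (@le_trans _ _ (pr (ccyl v e `&` B))).
    rewrite (pr_ccylI gamma_gt1 S_branch (A := A))// /pr -meanZ; last exact: bm_indic.
    apply: le_mean.
    - by apply: bmM; [exact: bm_cst|exact: bm_indic].
    - by apply: bmM; [exact: bm_wweight|exact: bm_indic].
    move=> z _; rewrite indicE; have [|_] := boolP (z \in _); last by rewrite !mulr0.
    rewrite inE => -[/coresetE ez _]; rewrite !mulr1 /W ler_pdivrMl ?expR_gt0//.
    exact: (core_wweight_le gamma_gt1 v ex ez).
  apply: (@le_trans _ _ (pr B)); last by apply: pr_bal_le; exact: ltW.
  apply: le_pr => //; last by move=> y _ [].
  by apply: measurableI => //; exact: measurable_ccyl.
have mhit : measurable (B `&` ~` avoid B N).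
  by apply: measurableI => //; apply: measurableC; exact: measurable_avoid.
have mV j : measurable (B `&` visit (N + m).+1 (J.+1 + j) B').
  by apply: measurableI => //; exact: measurable_visit.
apply: (@le_trans _ _ (\sum_(j < N + m) pr (B `&` visit (N + m).+1 (J.+1 + j) B'))).
  apply: (@pr_sum_le _ (N + m) _
    (fun j => B `&` visit (N + m).+1 (J.+1 + j) B')) => // y yI [By nav].
  have [i iN Bi] : exists2 i, (0 < i <= N)%N & B (iter i S y).
    apply: contrapT => h; apply: nav => i iN Bi; apply: h; by exists i.
  have ni : (n < i)%N.
    rewrite ltnNge; apply/negP => le_in.
    have := hr3 y i; rewrite le_in (andP iN).1 => /(_ isT).
    have cy : cyl (digits n.+1 x) y by apply: hr2; exact: lt_trans (Bx y By) rr2.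
    have := cyl_digits_le gamma_gt1 S_branch (leqnSn n) yI cy.
    move=> cn /(_ cn (lt_trans (Bx y By) rr3)).
    by rewrite leNgt; move=> /negP; apply; exact: lt_trans (Bx _ Bi) rr3.
  have cnt : crossings n y = crossings n x.
    apply: (digits_crossings gamma_gt1 S_branch) => //.
    by apply: hr2; exact: lt_trans (Bx y By) rr2.
  have [t tmi] : exists t, t = (m + i)%N by exists (m + i)%N.
  have tE : iter t S y = iter m S (iter i S y) by rewrite tmi iterD.
  have [Yt ct] := BY _ Bi; rewrite -tE in Yt ct.
  have At : B' (iter t S y).
    split; first exact/coresetE.
    rewrite /A /= tE; have := Bc _ Bi => /(ccylE gamma_gt1 S_branch)[].
    by move=> /(cylE gamma_gt1 S_branch)[_]; rewrite sv => ->.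
  have jJ : (J < crossings t y)%N.
    have nt : (n <= t)%N by rewrite tmi (leq_trans (ltnW ni))// leq_addl.
    by rewrite -(subnKC nt) crossings_add cnt (leq_trans hn)// leq_addr.
  have jt := crossings_le S t y.
  have tN : (t <= N + m)%N by rewrite tmi addnC leq_add2r; have /andP[] := iN.
  exists (crossings t y - J.+1)%N.
    by rewrite ltn_subLR// addSn ltnS (leq_trans jt)// (leq_trans tN)// leq_addl.
  by split=> //; rewrite subnKC//; apply: visit_at.
have KW0 : 0 <= Kc * (r / W) by rewrite mulr_ge0// ?divr_ge0// ltW.
apply: (@le_trans _ _ (\sum_(j < N + m) (Kc * (r / W)) * (r + 2 ^- (J.+1 + j)))).
  apply: ler_sum => j _.
  apply: le_trans (pr_visit_bal gamma_gt1 mS S_branch x _ _ (ltW r0) mB') _.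
  apply: ler_wpM2r; first by rewrite addr_ge0 ?ltW ?invr_gt0 ?exprn_gt0.
  by apply: ler_wpM2l => //; exact: ltW.
rewrite -mulr_sumr big_split/= sumr_const card_ord geo_sum -[r *+ _]mulr_natl.
have JW : Kc / W * 2 ^- J <= k.
  by rewrite mulrC mulrA ler_pdivrMr// -ler_pdivlMr// ltW.
have x0 : 0 <= 2 ^- (J + (N + m)) :> R by rewrite invr_ge0 exprn_ge0.
have KW1 : 0 <= Kc / W by rewrite divr_ge0// ltW.
set a := (N + m)%:R * r; set b : R := 2 ^- J; set c : R := 2 ^- _ in x0 *.
have -> : Kc * (r / W) * (a + (b - c)) = (Kc / W * a + Kc / W * b - Kc / W * c) * r.
  by field; rewrite gt_eqF.
apply: ler_wpM2r; first exact: ltW.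
have := mulr_ge0 KW1 x0; rewrite /b; lra.
Qed.

End short_returns.

(** * Almost independence of the ball and of the avoiding sets *)

Section almost_independence.
Context {R : realType} (gamma : R) (gamma_gt1 : 1 < gamma).
Context (S : R -> R) (mS : measurable_fun setT S).
Hypothesis S_branch : forall d z, -1 <= z < 1 -> S (branch gamma d z) = z.
Local Notation late := (late S).
Local Notation visit := (visit S).
Local Notation avoid := (avoid S).
Local Notation Kc := (Kc gamma).
Implicit Types (A B : set R) (n L : nat).

Ltac glra := move: (gamma_gt1) => ?; lra.

(** Used as [j * 2 ^- j <= 2 / j]: the number of crossings, linear in [j], does not spoil the
    exponential gain in the waiting time. *)
Lemma sqr_le_expn j : (j * j <= 2 * 2 ^ j)%N.
Proof.
have [j3|j3] := ltnP j 3; first by case: j j3 => [|[|[|]]].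
elim: j j3 => // j ih; rewrite leq_eqVlt => /predU1P[<-//|].
by rewrite ltnS => j3; have := ih j3; rewrite expnS; nia.
Qed.

Lemma double_succ_le (a n : nat) : (0 < n)%N -> (a * (2 * n).+2 <= 4 * a * n)%N.
Proof. by move=> n0; nia. Qed.

Lemma geo_sum0 n : \sum_(i < n) 2 ^- i <= 2 :> R.
Proof.
suff : \sum_(i < n) 2 ^- i = 2 - 2 * 2 ^- n :> R.
  by move=> ->; rewrite gerBl mulr_ge0// invr_ge0 exprn_ge0.
elim: n => [|n ih]; first by rewrite big_ord0 expr0 invr1 mulr1 subrr.
by rewrite big_ord_recr/= ih exprS; field; rewrite expf_neq0.
Qed.

(** Take the least [j] with [2 ^- (q * j)] below [k * r]: minimality gives the upper bound on
    [k * r], and a small [r] forces [j] past [j0]. *)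
Lemma dyadic_scale (q j0 : nat) (k : R) : (0 < q)%N -> 0 < k ->
  exists2 r0 : R, 0 < r0 & forall r, 0 < r < r0 -> exists j,
    [/\ (j0 < j)%N, 2 ^- (q * j) <= k * r & k * r < 2 ^+ q * 2 ^- (q * j)].
Proof.
move=> q0 k0; exists (2 ^- (q * j0) / k); first by rewrite divr_gt0// invr_gt0 exprn_gt0.
move=> r /andP[r0]; rewrite ltr_pdivlMr// mulrC => rj0.
have kr0 : 0 < k * r by rewrite mulr_gt0.
have mono i i' : (i <= i')%N -> 2 ^- i' <= 2 ^- i :> R.
  by move=> ii; rewrite lef_pV2 ?posrE ?exprn_gt0// ler_weXn2l// ler1n.
have ex : exists j, 2 ^- (q * j) <= k * r.
  have [J hJ] := pow2_small kr0; exists J; apply: le_trans (ltW hJ).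
  by apply: mono; rewrite leq_pmull.
have [j hj jmin] := ex_minnP ex.
have j0j : (j0 < j)%N.
  rewrite ltnNge; apply/negP => jj0.
  have := mono (q * j)%N (q * j0)%N ltac:(by rewrite leq_mul2l jj0 orbT).
  by lra.
exists j; split=> //.
case: j hj jmin j0j => // j hj jmin _.
rewrite ltNge; apply/negP => h.
have : 2 ^- (q * j) <= k * r.
  by apply: le_trans h; rewrite mulnS exprD invfM mulVKf// expf_neq0.
by move=> /jmin; rewrite ltnn.
Qed.

Lemma pr_bal (x r : R) : 0 < r -> -1 <= x - r -> x + r <= 1 -> pr (bal x r) = r.
Proof.
move=> r0 x1 x2; rewrite prE; last exact: measurable_bal.
rewrite (_ : _ `&` _ = bal x r).
  rewrite /bal lebesgue_measure_itv/= lte_fin ifT; last by lra.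
  by rewrite -EFinB /=; field.
by apply/setIidPl => y; rewrite /bal /= !in_itv/=; lra.
Qed.

(** The first crossing comes early on the ball, so by [late_sub] a late point makes a long excursion
    after one of its first [p] crossings. Visit number [j] costs [r + 2 ^- j], in total at most
    [p * r + 2]. *)
Lemma pr_late_bal (x r : R) (m p L n : nat) : 0 <= r -> (m.+1 + p * L.+1 <= n)%N ->
  (forall y, bal x r y -> ~ late m.+1 0 y) ->
  pr (bal x r `&` late n p) <= Kc * pr (long_excursion S L) * (p%:R * r + 2).
Proof.
move=> r0 nL nl; have mB := measurable_bal x r.
have mE := measurable_long_excursion mS L.
have mV j : measurable (bal x r `&` visit n j (long_excursion S L)).
  by apply: measurableI => //; exact: measurable_visit.
have mL : measurable (bal x r `&` late n p).
  by apply: measurableI => //; exact: measurable_late.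
apply: (@le_trans _ _ (\sum_(j < p) pr (bal x r `&` visit n j (long_excursion S L)))).
  apply: (@pr_sum_le _ p _
    (fun j => bal x r `&` visit n j (long_excursion S L))) => // y yI [By Ly].
  have [/(nl y By)//|[j jp Vj]] := late_sub gamma_gt1 nL Ly.
  by exists j.
have KE : 0 <= Kc * pr (long_excursion S L).
  by rewrite mulr_ge0 ?pr_ge0// ltW// Kc_gt0.
apply: (@le_trans _ _ (\sum_(j < p) Kc * pr (long_excursion S L) * (r + 2 ^- j))).
  by apply: ler_sum => j _; exact: (pr_visit_bal gamma_gt1 mS S_branch).
rewrite -mulr_sumr; apply: ler_wpM2l => //.
rewrite big_split/= sumr_const card_ord -[r *+ _]mulr_natl.
by apply: lerD => //; exact: geo_sum0.
Qed.

(** The times up to [Nt + M] are removed from the window at a small cost: on the ball by the rarity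
    of short returns, on the whole circle by the union bound. Mixing applies to the times that
    remain. The constant adds up [5 + 6 * gamma * Kc] for mixing, [1 + C0] for short returns and 1
    for the union bound. *)
Lemma almost_indep x : generic gamma x -> exists2 C : R, 0 < C &
  forall k : R, 0 < k <= 1 -> exists2 r0 : R, 0 < r0 & forall r, 0 < r < r0 ->
  [/\ -1 <= x - r, x + r <= 1 & forall n,
    `|pr (bal x r `&` avoid (bal x r) n) - r * pr (avoid (bal x r) n)|
      <= C * k * r].
Proof.
move=> gx; have [m [C0 C00 hC0]] := short_returns gamma_gt1 mS S_branch gx.
have K0 := Kc_gt0 gamma_gt1; have g0 : 0 < gamma by glra.
exists (7 + 6 * gamma * Kc + C0); first by have := mulr_gt0 g0 K0; lra.
move=> k /andP[k0 k1].
have [r1 r10 hr1] := hC0 k k0.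
have [M hM] := ccyl_mixing gamma_gt1 mS S_branch k0.
have [K gK] : exists K : nat, gamma <= K%:R.
  by exists (Num.truncn gamma).+1; apply/ltW; exact: truncnS_gt.
(* The scales: [k * r] is about [2 ^- (q * j)] and excursions are cut at about [2 * n] with
   [n = 2 ^ (2 * K * j)]. Then [n * r] is about [2 ^- j / k], while the tail beyond the cut is at
   most [2 * gamma * 2 ^- (q * j)]. *)
pose q := (2 * K).+1.
(* The time of the [p] excursions, multiplied by [r], is at most [8 * q * 2 ^ q / (j * k)], which
   has to be below [k / 2]. *)
have [j0 hj0] : exists j0 : nat, 16 * q%:R * 2 ^+ q / k ^+ 2 < j0%:R.
  by exists (Num.truncn (16 * q%:R * 2 ^+ q / k ^+ 2)).+1; exact: truncnS_gt.
have [r2 r20 hr2] := @dyadic_scale q j0 k isT k0.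
(* For [r < k / D] the part of the waiting time that does not depend on [r], multiplied by [r],
   takes up the other half of [k]. *)
pose D : R := 2 * (2 * m.+1 + M)%:R.
have D0 : 0 < D by rewrite mulr_gt0// ltr0n addn_gt0.
exists (Num.min (Num.min r1 r2) (k / D)); first by rewrite !lt_min r10 r20 divr_gt0.
move=> r /andP[r0]; rewrite !lt_min => /andP[/andP[rr1 rr2] rD].
have [x1 x2 nlate hit] := hr1 r ltac:(by rewrite r0).
have [j [jj0 kr1 kr2]] := hr2 r ltac:(by rewrite r0).
split=> // n0.
have [n nE] : exists n, n = (2 ^ (2 * K * j))%N by exists (2 ^ (2 * K * j))%N.
set B := bal x r; have mB : measurable B by exact: measurable_bal.
have prB : pr B = r by exact: pr_bal.
have [p pE] : exists p, p = (q * j)%N by exists (q * j)%N.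
have [Nt NtE] : exists Nt, Nt = (m.+1 + p * (2 * n).+2)%N by exists (m.+1 + p * (2 * n).+2)%N.
have mA i : measurable (avoid B i) by exact: measurable_avoid.
have jpos : 0 < j%:R :> R by rewrite ltr0n (leq_ltn_trans _ jj0).
have time : (Nt + M + m)%:R * r <= k.
  have h1 : (2 * m.+1 + M)%:R * r <= k / 2.
    move: rD; rewrite ltr_pdivlMr// /D.
    by move: ((2 * m.+1 + M)%:R) => a; lra.
  have h2 : (p * (2 * n).+2)%:R * r <= k / 2.
    have nr : n%:R * r * k <= 2 ^+ q * 2 ^- j.
      have -> : n%:R * r * k = n%:R * (k * r) by ring.
      have n1 : 0 < n%:R :> R by rewrite ltr0n nE expn_gt0.
      apply: le_trans (ler_wpM2l (ltW n1) (ltW kr2)) _.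
      rewrite nE natrX mulrCA le_eqVlt; apply/orP; left; apply/eqP; congr (_ * _).
      have -> : (q * j = 2 * K * j + j)%N by rewrite /q mulSn addnC.
      by rewrite exprD invfM mulVKf// expf_neq0.
    have jj : j%:R * 2 ^- j <= 2 / j%:R :> R.
      rewrite ler_pdivlMr// mulrAC ler_pdivrMr ?exprn_gt0//.
      by rewrite -natrX -!natrM ler_nat sqr_le_expn.
    have h3 : (p * (2 * n).+2)%:R <= 4 * q%:R * j%:R * n%:R :> R.
      rewrite -!natrM ler_nat pE.
      have : (0 < n)%N by rewrite nE expn_gt0.
      by rewrite -(mulnA 4); exact: double_succ_le.
    apply: le_trans (ler_wpM2r (ltW r0) h3) _.
    rewrite ler_pdivlMr// -(ler_pM2r (_ : 0 < k))//.
    have -> : 4 * q%:R * j%:R * n%:R * r * 2 * k =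
      8 * q%:R * j%:R * (n%:R * r * k) by ring.
    have q0 : 0 <= 8 * q%:R * j%:R :> R by rewrite !mulr_ge0.
    apply: le_trans (ler_wpM2l q0 nr) _.
    have -> : 8 * q%:R * j%:R * (2 ^+ q * 2 ^- j) =
      8 * q%:R * 2 ^+ q * (j%:R * 2 ^- j) :> R by ring.
    have q1 : 0 <= 8 * q%:R * 2 ^+ q :> R by rewrite !mulr_ge0// exprn_ge0.
    apply: le_trans (ler_wpM2l q1 jj) _.
    rewrite mulrA ler_pdivrMr//.
    move: hj0; rewrite ltr_pdivrMr ?exprn_gt0// => hj0.
    have : j0%:R * k ^+ 2 <= j%:R * k ^+ 2.
      by apply: ler_wpM2r; [exact: sqr_ge0|rewrite ler_nat ltnW].
    by rewrite -expr2 [k ^+ 2 * _]mulrC; lra.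
  have -> : (Nt + M + m)%:R * r =
     (m.+1 + M + m)%:R * r + (p * (2 * n).+2)%:R * r.
    by rewrite -mulrDl -natrD NtE -!addnA [(_ + (M + m))%N]addnC -!addnA.
  have h4 : (m.+1 + M + m)%:R * r <= (2 * m.+1 + M)%:R * r.
    apply: ler_wpM2r; [exact: ltW|rewrite ler_nat].
    by rewrite -addnA (addnC M) addnA leq_add2r mul2n -addnn leq_add2l.
  by lra.
have pr1 : p%:R * r <= 1.
  apply: le_trans k1; apply: le_trans time; apply: ler_wpM2r; first exact: ltW.
  by rewrite ler_nat NtE mulnS; exact: leq_trans (leq_addr _ _) (leq_trans (leq_addl _ _) (leq_trans (leq_addr _ _) (leq_addr _ _))).
have time' : (Nt + M)%:R * r <= k.
  by apply: le_trans time; apply: ler_wpM2r; [exact: ltW|rewrite ler_nat leq_addr].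
have late_bound : pr (B `&` late Nt p) <= 6 * gamma * Kc * (k * r).
  have nL : (m.+1 + p * ((2 * n).+1).+1 <= Nt)%N by rewrite NtE.
  apply: le_trans (pr_late_bal (ltW r0) nL nlate) _.
  have ht := long_excursion_tail gamma_gt1 mS S_branch gK nE.
  have ht' : pr (long_excursion S (2 * n).+1) <= 2 * gamma * (k * r).
    apply: le_trans ht _; apply: ler_wpM2l; first by rewrite mulr_ge0// ltW.
    apply: le_trans kr1; rewrite lef_pV2 ?posrE ?exprn_gt0// ler_weXn2l ?ler1n//.
    by rewrite leq_addr.
  have -> : 6 * gamma * Kc * (k * r) = Kc * (2 * gamma * (k * r)) * 3 by ring.
  apply: ler_pM; last by lra.
  - by rewrite mulr_ge0 ?pr_ge0 ?ltW//; exact: measurable_long_excursion.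
  - by rewrite addr_ge0// mulr_ge0// ltW.
  - by apply: ler_wpM2l => //; exact: ltW.
pose s : R := 2 ^- p; have s0 : 0 <= s by rewrite invr_ge0 exprn_ge0.
have sk : s <= k * r by rewrite /s pE.
pose Bd := [set` `[x - r - 2 * s, x - r + 2 * s]] `|`
           [set` `[x + r - 2 * s, x + r + 2 * s]].
have mI (a b : R) : measurable ([set` `[a, b]] : set R) by exact: measurable_itv.
have mBd : measurable Bd by exact: measurableU.
have prBd : pr Bd <= 4 * (k * r).
  apply: le_trans (pr_setU_le _ _) _ => //.
  have := @pr_itvcc_le R (x - r - 2 * s) (x - r + 2 * s) ltac:(lra).
  have := @pr_itvcc_le R (x + r - 2 * s) (x + r + 2 * s) ltac:(lra).
  by lra.
have mixing i : `|pr (B `&` iter (Nt + M) S @^-1` avoid B i) - r * pr (avoid B i)|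
    <= (5 + 6 * gamma * Kc) * (k * r).
  have hB : forall y y' z, B y -> ~ B y' -> `|y - y'| <= 2 ^- p ->
      `|y - z| <= 2 ^- p -> Bd z.
    move=> y y' z /balE By nB; rewrite -/s => yy' yz.
    have {}nB : r <= `|y' - x| by rewrite leNgt; apply/negP => h; apply/nB/balE.
    rewrite /Bd /= !in_itv/=; move: By yy' yz nB; rewrite ltr_norml !ler_norml.
    by case: (ler0P (y' - x)) => ? *; [left|right]; lra.
  have := pr_mixing gamma_gt1 mS S_branch (ltW k0) hM (mA i) mB mBd hB (leqnn (Nt + M)).
  by rewrite prB => /le_trans; apply; lra.
have rho : pr (B `&` ~` avoid B (Nt + M)) <= (1 + C0) * (k * r).
  apply: le_trans (hit (Nt + M)%N) _.
  have -> : (1 + C0) * (k * r) = (k + C0 * k) * r by ring.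
  apply: ler_wpM2r; first exact: ltW.
  by rewrite lerD2l; apply: ler_wpM2l => //; exact: ltW.
have av : 1 - k <= pr (avoid B (Nt + M)).
  by have := pr_avoid_ge gamma_gt1 mS S_branch (Nt + M) mB; rewrite prB; lra.
have mBA i : measurable (B `&` avoid B i) by exact: measurableI.
have kr0 : 0 < k * r by rewrite mulr_gt0.
have Ck0 : 0 <= 6 * gamma * Kc * (k * r) by rewrite mulr_ge0 ?(ltW kr0)// mulr_ge0 ?(ltW K0)// mulr_ge0// ltW.
have Cr0 : 0 <= C0 * (k * r) by rewrite mulr_ge0 ?ltW.
have mBn i : measurable (B `&` ~` avoid B i).
  by apply: measurableI => //; exact: measurableC.
have C7 : (7 + 6 * gamma * Kc + C0) * k * r =
    7 * (k * r) + 6 * gamma * Kc * (k * r) + C0 * (k * r) by ring.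
rewrite C7.
(* For a short window both terms are within a multiple of [k * r] of [r] itself. *)
have [n0N|Nn0] := leqP n0 (Nt + M).
  have anti : avoid B (Nt + M) `<=` avoid B n0.
    by move=> y h i /andP[i0 i1]; apply: h; rewrite i0 (leq_trans i1).
  have h1 : pr (B `&` avoid B n0) <= r.
    by rewrite -prB; apply: le_pr => // y _ [].
  have h2 : r - (1 + C0) * (k * r) <= pr (B `&` avoid B n0).
    have := pr_split mB (mA (Nt + M)%N); rewrite prB => e.
    have : pr (B `&` avoid B (Nt + M)) <= pr (B `&` avoid B n0).
      by apply: le_pr => // y _ [By /anti].
    by lra.
  have h3 : 1 - k <= pr (avoid B n0).
    by apply: le_trans av _; apply: le_pr => // y _ /anti.
  have h4 : r * (1 - k) <= r * pr (avoid B n0) by apply: ler_wpM2l => //; exact: ltW.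
  have h5 : r * pr (avoid B n0) <= r by rewrite ler_piMr ?pr_le1 // ltW.
  by rewrite ler_norml; lra.
have [i iE] : exists i, n0 = (Nt + M + i)%N by exists (n0 - (Nt + M))%N; rewrite subnKC// ltnW.
have AE y : avoid B n0 y <-> avoid B (Nt + M) y /\ avoid B i (iter (Nt + M) S y).
  by rewrite iE; exact: avoidD.
have mX : measurable (iter (Nt + M) S @^-1` avoid B i) by exact: measurable_preS.
have mBX : measurable (B `&` iter (Nt + M) S @^-1` avoid B i) by exact: measurableI.
have := mixing i; set Xi := pr (B `&` _) => hXi.
have h1 : pr (B `&` avoid B n0) <= Xi.
  by apply: le_pr => // y _ [By /AE[]].
have h2 : Xi <= pr (B `&` avoid B n0) + pr (B `&` ~` avoid B (Nt + M)).
  apply: le_trans (pr_setU_le _ _) => //; apply: le_pr => //; first exact: measurableU.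
  move=> y _ [By Ay]; have [h|h] := pselect (avoid B (Nt + M) y).
    by left; split=> //; apply/AE.
  by right.
have preA : pr (iter (Nt + M) S @^-1` avoid B i) = pr (avoid B i).
  exact: (pr_preS gamma_gt1 mS S_branch).
have h3 : pr (avoid B n0) <= pr (avoid B i).
  by rewrite -preA; apply: le_pr => // y _ /AE[].
have h4 : pr (avoid B i) <= pr (avoid B n0) + k.
  rewrite -preA; have := pr_split mX (mA (Nt + M)%N).
  have mc : measurable (~` avoid B (Nt + M)) by exact: measurableC.
  have e1 : pr (iter (Nt + M) S @^-1` avoid B i `&` avoid B (Nt + M)) <= pr (avoid B n0).
    apply: le_pr => //; first exact: measurableI.
    by move=> y _ [? ?]; apply/AE.
  have e2 : pr (iter (Nt + M) S @^-1` avoid B i `&` ~` avoid B (Nt + M)) <=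
      pr (~` avoid B (Nt + M)).
    apply: le_pr => //; first exact: measurableI.
    by move=> y _ [].
  have e3 : pr (~` avoid B (Nt + M)) = 1 - pr (avoid B (Nt + M)).
    have := pr_split measurableT (mA (Nt + M)%N).
    by rewrite pr_full !setTI => ->; rewrite addrAC subrr add0r.
  by move: av e1 e2 e3; clear; lra.
have h5 := ler_wpM2l (ltW r0) h3; have h6 := ler_wpM2l (ltW r0) h4.
by move: hXi; rewrite !ler_norml; lra.
Qed.

End almost_independence.

(** * The circle map *)

Section circle_map.
Context {R : realType} (gamma : R) (gamma_gt1 : 1 < gamma).
Context (T : circle R -> circle R) (T_map : is_circle_map gamma T).
Local Notation branch := (branch gamma).
Local Notation phi := (phi gamma).
Local Notation bend := (bend gamma).
Local Notation slope := (slope gamma).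
Local Notation cgamma := (cgamma gamma).
Local Notation rep := (@circle_rep R).
Local Notation proj := (@circle_proj R).

Ltac glra := move: (gamma_gt1) => ?; lra.

Lemma circle_repK (p : circle R) : proj (rep p) = p.
Proof. exact: valKd. Qed.

Lemma circle_projK (a : R) : -1 <= a < 1 -> rep (proj a) = a.
Proof. by move=> aI; rewrite /circle_proj -[rep _]/(val _) insubdK. Qed.

Lemma proj_out (a : R) : ~~ (-1 <= a < 1) -> proj a = circle_base.
Proof. by move=> aI; apply: val_inj; rewrite /circle_proj val_insubd (negbTE aI). Qed.

Lemma proj1 : proj 1 = circle_base.
Proof. by apply: proj_out; lra. Qed.

Lemma projN1 : proj (-1) = circle_base.
Proof. by rewrite -[RHS]circle_repK. Qed.

(** [slope] reaches 1 only at [2 ^ (1 / (gamma - 1))], which is larger than 1. *)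
Lemma slope_half_lt : exists2 b : R, 0 < b & forall u, 1 <= u -> u < 1 + b -> slope u < 1.
Proof.
have g1 : 0 < (gamma - 1)^-1 by rewrite invr_gt0; glra.
have h1 : 1 < 2 `^ (gamma - 1)^-1.
  have one : 1 `^ (gamma - 1)^-1 = 1 :> R by rewrite powR1.
  rewrite -[ltLHS]one.
  by apply: gt0_ltr_powR => //; rewrite ?nnegrE ?in_itv/= ?andbT// ltrDl.
exists (2 `^ (gamma - 1)^-1 - 1); first by rewrite subr_gt0.
move=> u u1 ub; rewrite /slope ltr_pdivrMr// mul1r.
have -> : 2 = (2 `^ (gamma - 1)^-1) `^ (gamma - 1) :> R.
  by rewrite -powRrM mulVf ?powRr1//; glra.
by apply: gt0_ltr_powR => //; rewrite ?nnegrE ?in_itv/= ?andbT; glra.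
Qed.

(* On [-1, 0[ the map [b |-> b + bend (1 - b)] stays below its value at 0
   until it is some distance away from 0. *)
Lemma negative_root_gap : exists2 b0 : R, 0 < b0 & forall b, -1 <= b -> b < 0 ->
  cgamma <= b + bend (1 - b) -> b <= - b0.
Proof.
have [b0 b00 hb0] := slope_half_lt; exists b0 => // b b1 bneg h.
rewrite leNgt; apply/negP => bb0.
have s1 : slope (1 - b) < 1 by apply: hb0; lra.
have := @bend_tangent _ _ gamma_gt1 (1 - b) 1 ltac:(lra) ltac:(lra).
rewrite bend1 -/cgamma => ht.
have : b * (1 - slope (1 - b)) < 0 by rewrite nmulr_rlt0// subr_gt0.
by lra.
Qed.

Lemma circle_dist_proj (a b : R) : -1 <= a < 1 -> -1 <= b < 1 ->
  circle_dist (proj a) (proj b) = Num.min `|a - b| (2 - `|a - b|).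
Proof. by move=> aI bI; rewrite /circle_dist !circle_projK. Qed.

Lemma ball_circleE (p q : circle R) (e : R) : ball p e q <-> circle_dist p q < e.
Proof. by rewrite ballEmdist. Qed.

Lemma phi_lip (y z : R) : -1 <= y <= 1 -> -1 <= z <= 1 -> `|phi y - phi z| <= `|y - z|.
Proof.
wlog : y z / z <= y => [hw yI zI|zy yI zI].
  have [zy|/ltW yz] := leP z y; first exact: hw.
  by rewrite distrC [`|y - z|]distrC hw.
rewrite !ger0_norm ?subr_ge0//.
  by apply: (@wbranch_contr_le _ _ gamma_gt1 [:: true]); glra.
by apply: (@branch_le _ _ gamma_gt1 true); glra.
Qed.

Lemma T_phi_neg (z : R) : -1 <= z <= 0 -> T (proj (phi z)) = proj z.
Proof.
move=> zI; have [_ Tlow _ _] := T_map.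
have pz : phi z = bend (1 + z) by rewrite /phi ifT//; lra.
have aI : 0 <= phi z <= (2 * gamma)^-1.
  have p1 := @branch_le _ _ gamma_gt1 true (-1) z ltac:(lra) ltac:(lra) ltac:(lra).
  have p2 := @branch_le _ _ gamma_gt1 true z 0 ltac:(lra) ltac:(lra) ltac:(lra).
  by move: p1 p2; rewrite /= phiN1// (phi0 gamma); lra.
have [b [bI -> e]] := Tlow _ aI; congr (proj _).
have c0 : (2 * gamma)^-1 != 0 by rewrite invr_eq0; glra.
have /(mulfI c0)/esym e' : (2 * gamma)^-1 * (1 + z) `^ gamma =
  (2 * gamma)^-1 * (1 + b) `^ gamma by rewrite -e pz.
have : 1 + b = 1 + z.
  by apply: (@powR_injective _ gamma) => //; rewrite ?nnegrE; glra.
by lra.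
Qed.

Lemma phi_ge0E (z : R) : 0 <= z -> phi z = z + bend (1 - z).
Proof.
rewrite le_eqVlt => /predU1P[<-|z0]; first by rewrite /phi lexx addr0 subr0 add0r.
by rewrite /phi leNgt z0.
Qed.

(** A nonnegative root has to be [z], as [phi] is injective; the other alternative keeps what
    [negative_root_gap] asks for. *)
Lemma T_phi_dichotomy (z : R) : 0 <= z < 1 -> T (proj (phi z)) = proj z \/
  exists b, [/\ -1 <= b, b < 0, cgamma <= b + bend (1 - b) & T (proj (phi z)) = proj b].
Proof.
move=> zI; have [_ _ Thigh _] := T_map.
have pz := phi_ge0E (andP zI).1.
have aI : (2 * gamma)^-1 <= phi z <= 1.
  have p1 := @branch_le _ _ gamma_gt1 true 0 z ltac:(lra) ltac:(lra) ltac:(lra).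
  have p2 := @branch_le _ _ gamma_gt1 true z 1 ltac:(lra) ltac:(lra) ltac:(lra).
  by move: p1 p2; rewrite /= phi1// (phi0 gamma); lra.
have [b [bI Tb e]] := Thigh _ aI.
have [b0|b0] := leP 0 b.
  left; rewrite Tb; congr (proj _).
  have pb : phi b = phi z by rewrite (phi_ge0E b0) e.
  apply/eqP; rewrite eq_le; apply/andP; split; rewrite leNgt; apply/negP => h.
    have := @phi_lt _ _ gamma_gt1 z b ltac:(lra) h ltac:(lra); lra.
  have := @phi_lt _ _ gamma_gt1 b z ltac:(lra) h ltac:(lra); lra.
right; exists b; split=> //; first by lra.
by move: aI; rewrite /cgamma {1}e /bend; lra.
Qed.

(* The wrong root can be excluded by continuity: measured from the midpoint of
   [0, z], the distance of [T (proj (phi y))] starts at [z / 2] for [y = 0] and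
   would have to jump to become larger than that. *)
Lemma T_phi_pos (z : R) : 0 <= z < 1 -> T (proj (phi z)) = proj z.
Proof.
move=> zI; have [//|[b [b1 bneg hb Tb]]] := T_phi_dichotomy zI; exfalso.
have [b0 b00 gap] := negative_root_gap.
have Tphi0 : T (proj (phi 0)) = proj 0 by apply: T_phi_neg; lra.
have z0 : 0 < z.
  rewrite lt_neqAle (andP zI).1 andbT; apply/eqP => z0; move: Tb.
  rewrite -z0 Tphi0 => /(congr1 rep); rewrite !circle_projK; lra.
pose q := z / 2; have qI : 0 < q < 2^-1 by rewrite /q; lra.
have qI' : -1 <= q < 1 by lra.
pose g := Num.min b0 (1 - 2 * q).
have [g0 gb gq] : [/\ 0 < g, g <= b0 & g <= 1 - 2 * q].
  by rewrite /g lt_min b00 !ge_min !lexx orbT; split=> //; lra.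
have far b' : -1 <= b' -> b' <= - b0 -> q + g <= circle_dist (proj b') (proj q).
  move=> b'1 b'0; rewrite circle_dist_proj//; last by lra.
  by rewrite le_min ler0_norm; lra.
have near y : 0 <= y -> y <= z -> circle_dist (proj y) (proj q) <= q.
  move=> y0 yz; rewrite circle_dist_proj//; last by lra.
  by rewrite ge_min ler_norml; apply/orP; left; rewrite /q; lra.
pose clip (y : R) : R := if y <= 0 then 0 else if z <= y then z else y.
have clipI y : 0 <= clip y <= z.
  by rewrite /clip; case: (leP y 0) => ?; [lra|case: (leP z y) => ?; lra].
have clip_lip y y' : `|clip y - clip y'| <= `|y - y'|.
  wlog yy' : y y' / y' <= y => [hw|].
    have [yy'|/ltW yy'] := leP y' y; first exact: hw.
    by rewrite distrC [`|y - y'|]distrC hw.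
  rewrite (ger0_norm (_ : 0 <= y - y')) ?subr_ge0// ler_norml /clip.
  clear -z0 yy'; case: (leP y 0) => ?; case: (leP y' 0) => ?; try lra;
    case: (leP z y) => ?; case: (leP z y') => ?; lra.
pose D y := circle_dist (T (proj (phi (clip y)))) (proj q).
have cD : continuous D.
  move=> y; apply/cvgrPdist_le => e e0.
  have [cT _ _ _] := T_map.
  have := cT (proj (phi (clip y))) => /cvg_ballP /(_ e e0).
  move=> /nbhs_ballP[d /= d0 hd]; near=> y'.
  have yy' : `|y - y'| < d.
    by near: y'; apply: cvgr_dist_lt => //; exact: cvg_id.
  have cI := clipI y; have cI' := clipI y'.
  have pI u : 0 <= u <= z -> -1 <= phi u < 1.
    by move=> uI; have := @branch_itv _ _ gamma_gt1 true u ltac:(lra).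
  have : ball (T (proj (phi (clip y)))) e (T (proj (phi (clip y')))).
    apply: hd; apply/ball_circleE; rewrite circle_dist_proj ?pI//.
    rewrite gt_min; apply/orP; left; apply: le_lt_trans yy'.
    by apply: le_trans (clip_lip y y'); apply: phi_lip; lra.
  move=> /ball_circleE h.
  rewrite /D; move: (T _) (T _) h => p1 p2 h.
  have h1 := circle_dist_triangle p1 p2 (proj q).
  have h2 := circle_dist_triangle p2 p1 (proj q).
  rewrite (circle_dist_sym p2 p1) in h1 h; move: h h1 h2 {hd}.
  rewrite ler_norml; clear.
  move: (circle_dist p1 p2) (circle_dist p1 (proj q)) (circle_dist p2 (proj q)).
  by move=> u v w; lra.
have D0 : D 0 <= q.
  by rewrite /D /clip lexx Tphi0; apply: near => //; lra.
have Dz : q + g <= D z.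
  have cz : clip z = z by rewrite /clip lexx (leNgt z 0) z0.
  by rewrite /D cz Tb; apply: far => //; exact: gap.
have [] := @IVT _ D 0 z (q + g / 2).
- exact: ltW.
- exact: continuous_subspaceT.
- rewrite ge_min le_max; apply/andP; split; apply/orP; [left|right].
    by apply: le_trans D0 _; rewrite lerDl; lra.
  by apply: le_trans Dz; rewrite lerD2l; lra.
move=> y; rewrite in_itv/= => yI Dy.
have cy : clip y = y.
  clear -yI; rewrite /clip; case: (leP y 0) => ?; first by lra.
  by case: (leP z y) => ?; lra.
have yI' : 0 <= y < 1 by clear -yI zI; lra.
have := T_phi_dichotomy yI'.
move: Dy; rewrite /D cy => Dy [Ty|[b' [b'1 b'0 hb' Tb']]].
  by have := near y (andP yI).1 (andP yI).2; rewrite -Ty; lra.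
by have := far b' b'1 (gap _ b'1 b'0 hb'); rewrite -Tb'; lra.
Unshelve. all: by end_near. Qed.

Lemma T_branch_true (z : R) : -1 <= z < 1 -> T (proj (branch true z)) = proj z.
Proof.
move=> zI; have [z0|z0] := leP z 0; first by apply: T_phi_neg; lra.
by apply: T_phi_pos; lra.
Qed.

Lemma circle_opp_proj (a : R) : -1 < a < 1 -> circle_opp (proj a) = proj (- a).
Proof. by move=> aI; rewrite /circle_opp circle_projK//; lra. Qed.

(** By oddness the image of the point -1 = 1 is its own opposite, hence 0 or -1; the value 0
    contradicts the second defining relation at 1, where it would read [1 = cgamma]. *)
Lemma T_base : T (proj (-1)) = proj (-1).
Proof.
have [_ _ Thigh Topp] := T_map.
have c2 := cgamma_lt gamma_gt1.
have [|b [bI Tb e]] := Thigh 1.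
  by rewrite -/cgamma; lra.
have oN1 : circle_opp (proj (-1)) = proj (-1).
  by rewrite /circle_opp circle_projK ?opprK ?proj1 ?projN1//; lra.
have [p pE] : exists p, p = T (proj (-1)) by exists (T (proj (-1))).
have := Topp (proj (-1)); rewrite oN1 -pE => op.
have [pI|pI] := boolP (-1 < rep p).
  have rI : -1 < rep p < 1 by rewrite pI; have /andP[] := circle_repP p.
  have := op; rewrite -{2}[p]circle_repK circle_opp_proj// => /(congr1 rep).
  rewrite circle_projK; last by lra.
  move=> rp; have r0 : rep p = 0 by lra.
  have : p = proj b by rewrite pE -Tb proj1 -projN1.
  move=> /(congr1 rep); rewrite r0.
  have [bI'|bI'] := boolP (-1 <= b < 1).
    rewrite circle_projK// => b0; move: e c2; rewrite -b0 subr0 powR1 mulr1 add0r -/cgamma.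
    by move=> *; exfalso; lra.
  by rewrite proj_out//= => h; exfalso; lra.
apply: val_inj; rewrite /= -[circle_rep (proj (-1))]/(rep (proj (-1))) circle_projK; last by lra.
have /andP[h _] := circle_repP p; apply/le_anti.
by rewrite [_ <= circle_rep p]h andbT leNgt.
Qed.

Lemma T_branch d (z : R) : -1 <= z < 1 -> T (proj (branch d z)) = proj z.
Proof.
case: d => zI; first exact: T_branch_true.
have [_ _ _ Topp] := T_map.
have [->|z1] := eqVneq z (-1).
  by rewrite /= phiN1// subr0 T_base.
have {}zI : -1 < z < 1 by rewrite lt_neqAle eq_sym z1.
have bN : branch false z = - branch true (- z) by rewrite branchN// opprK.
have h : -1 < branch true (- z) < 1.
  by have := @branch_true_itv _ _ gamma_gt1 (- z) ltac:(lra); rewrite /=; lra.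
rewrite bN -circle_opp_proj// Topp T_branch_true; last by lra.
by rewrite circle_opp_proj ?opprK//; lra.
Qed.

Definition real_map (y : R) : R := rep (T (proj y)).

Lemma real_map_branch d (z : R) : -1 <= z < 1 -> real_map (branch d z) = z.
Proof. by move=> zI; rewrite /real_map T_branch// circle_projK. Qed.

Lemma iter_real_map k (p : circle R) : rep (iter k T p) = iter k real_map (rep p).
Proof. by elim: k => //= k <-; rewrite /real_map circle_repK. Qed.

Lemma measurable_real_map : measurable_fun setT real_map.
Proof.
(* [real_map] is nondecreasing on each half, so these extensions by constants are nondecreasing on
   the whole line, hence measurable. *)
pose f1 (y : R) : R := if y < 0 then -1 else if y < 1 then real_map y else 1.
pose f0 (y : R) : R := if y < -1 then -1 else if y < 0 then real_map y else 1.
have rI (y : R) : -1 <= real_map y < 1 by exact: circle_repP.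
have mono d (y y' : R) : -1 <= y < 1 -> -1 <= y' < 1 -> (0 <= y) = d -> (0 <= y') = d ->
    y <= y' -> real_map y <= real_map y'.
  move=> yI yI' yd yd' yy'; rewrite leNgt; apply/negP => h.
  have [_ e] := branch_S gamma_gt1 real_map_branch yI.
  have [_ e'] := branch_S gamma_gt1 real_map_branch yI'.
  rewrite yd in e; rewrite yd' in e'.
  have := @branch_lt _ _ gamma_gt1 d _ _ (andP (rI y')).1 h (ltW (andP (rI y)).2).
  by rewrite e e'; lra.
have m1 : measurable_fun setT f1.
  apply: nondecreasing_measurable => // y y' yy'; rewrite /f1.
  have ry := rI y; have ry' := rI y'.
  case: (ltP y 0) => y0; case: (ltP y' 0) => y0'; case: (ltP y 1) => y1;
    case: (ltP y' 1) => y1'; try lra.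
  by apply: (mono true) => //; lra.
have m0 : measurable_fun setT f0.
  apply: nondecreasing_measurable => // y y' yy'; rewrite /f0.
  have ry := rI y; have ry' := rI y'.
  case: (ltP y (-1)) => y0; case: (ltP y' (-1)) => y0'; case: (ltP y 0) => y1;
    case: (ltP y' 0) => y1'; try lra.
  by apply: (mono false) => //; rewrite ?(leNgt 0) ?y1 ?y1'//; lra.
have mlt (a : R) : measurable_fun setT (fun y : R => y < a).
  by apply: measurable_fun_ltr => //; exact: measurable_cst.
have -> : real_map = (fun y => if y < -1 then rep (T circle_base) else
    if y < 0 then f0 y else if y < 1 then f1 y else rep (T circle_base)).
  apply/funext => y; case: (ltP y (-1)) => y1.
    by rewrite /real_map proj_out//; lra.
  case: (ltP y 0) => y2; first by rewrite /f0 y2 ltNge y1.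
  case: (ltP y 1) => y3; first by rewrite /f1 y3 ltNge y2.
  by rewrite /real_map proj_out//; lra.
apply: measurable_fun_ifT => //; apply: measurable_fun_ifT => //.
by apply: measurable_fun_ifT.
Qed.

End circle_map.

(** * Exponential approximation and passage from the line to the circle *)

Section exponential_law.
Context {R : realType} (T : circle R -> circle R).
Local Notation rep := (@circle_rep R).
Local Notation proj := (@circle_proj R).

(** From [1 - r <= expR (- r)] and [expR (- (r / (1 - r))) <= 1 - r]: replacing [n * r] by [t] and
    [r / (1 - r)] by [r] costs a multiple of [r]. *)
Lemma pow_expR_bound (t r : R) n : 0 <= t -> 0 < r -> r <= 2^-1 ->
  n%:R * r <= t < n.+1%:R * r ->
  `|(1 - r) ^+ n - expR (- t)| <= 2 * (1 + t) * r.
Proof.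
move=> t0 r0 r2 /andP[nt tn].
have r1 : 0 < 1 - r by lra.
have up : (1 - r) ^+ n <= expR (- (n%:R * r)).
  rewrite -mulrN expRM_natl; apply: lerXn2r; rewrite ?nnegrE ?expR_ge0 ?(ltW r1)//.
  exact: expR_ge1Dx.
have up2 : expR (- (n%:R * r)) <= expR (- t) + 2 * r.
  have h1 : expR (- (n%:R * r)) <= expR (- t) * expR r.
    by rewrite -expRD ler_expR; move: tn; rewrite -natr1 mulrDl mul1r; lra.
  have h2 : expR r <= 1 + 2 * r.
    have := expR_ge1Dx (- r); rewrite expRN => h.
    have e0 := expR_gt0 r.
    have h3 : expR r * (1 - r) <= 1.
      by rewrite mulrC -ler_pdivlMr// div1r.
    have h4 : (1 + 2 * r) * (1 - r) = 1 + r * (1 - 2 * r) by ring.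
    have h5 : 0 <= r * (1 - 2 * r) by rewrite mulr_ge0//; lra.
    by rewrite -(ler_pM2r r1) h4; lra.
  have h3 : expR (- t) <= 1 by rewrite expR_le1; lra.
  have h4 : expR (- t) * expR r <= expR (- t) * (1 + 2 * r).
    by apply: ler_wpM2l => //; exact: expR_ge0.
  have h5 : expR (- t) * (2 * r) <= 2 * r by rewrite ler_piMl//; lra.
  by lra.
have q0 : 0 <= r / (1 - r) by rewrite divr_ge0// ltW.
have q2 : r / (1 - r) <= 2 * r.
  rewrite ler_pdivrMr//.
  have : 0 <= r * (1 - 2 * r) by rewrite mulr_ge0//; lra.
  by lra.
have low : expR (- (n%:R * (r / (1 - r)))) <= (1 - r) ^+ n.
  rewrite -mulrN expRM_natl; apply: lerXn2r; rewrite ?nnegrE ?expR_ge0 ?(ltW r1)//.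
  rewrite expRN -[leRHS]invrK lef_pV2 ?posrE ?expR_gt0 ?invr_gt0//.
  have := expR_ge1Dx (r / (1 - r)).
  have -> : 1 + r / (1 - r) = (1 - r)^-1 by field; rewrite gt_eqF.
  by [].
have low2 : expR (- t) - 2 * t * r <= expR (- (n%:R * (r / (1 - r)))).
  have h1 : n%:R * (r / (1 - r)) <= t + 2 * t * r.
    have -> : n%:R * (r / (1 - r)) = n%:R * r + n%:R * r * (r / (1 - r)).
      by field; rewrite gt_eqF.
    have nr0 : 0 <= n%:R * r by rewrite mulr_ge0// ltW.
    have : n%:R * r * (r / (1 - r)) <= t * (2 * r) by apply: ler_pM.
    by lra.
  apply: (@le_trans _ _ (expR (- (t + 2 * t * r)))); last by rewrite ler_expR; lra.
  rewrite opprD expRD.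
  have := expR_ge1Dx (- (2 * t * r)).
  have e1 : expR (- t) <= 1 by rewrite expR_le1; lra.
  have e0 := expR_ge0 (- t).
  move=> /(ler_wpM2l e0).
  have : expR (- t) * (2 * t * r) <= 2 * t * r.
    by rewrite ler_piMl// mulr_ge0// ?mulr_ge0// ltW.
  by lra.
have tr0 : 0 <= t * r by rewrite mulr_ge0// ltW.
by rewrite ler_norml; lra.
Qed.

Lemma prE_circle (A : set (circle R)) : measurable (rep @` A) ->
  lambda A = (pr (rep @` A))%:E.
Proof.
move=> mA; rewrite prE// /lambda.
have -> : rep @` A `&` [set` `[-1, 1[] = rep @` A.
  by apply/setIidPl => _ [p _ <-]; rewrite /= in_itv/=; exact: circle_repP.
rewrite EFinM fineK// ge0_fin_numE//.
apply: (@le_lt_trans _ _ (lebesgue_measure ([set` `[-1, 1[] : set R))).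
  apply: le_measure; rewrite ?inE//.
  by move=> _ [p _ <-]; rewrite /= in_itv/=; exact: circle_repP.
by rewrite lebesgue_measure_itv/= lte_fin; case: ifP => // _; rewrite -EFinB ltry.
Qed.

Lemma image_repE (A : set (circle R)) (B : set R) :
  (forall p, A p <-> B (rep p)) -> rep @` A = B `&` [set` `[-1, 1[].
Proof.
move=> AB; apply/seteqP; split=> [_ [p Ap <-]|y [By]].
  by split; [exact/AB|rewrite /= in_itv/=; exact: circle_repP].
rewrite /= in_itv/= => yI; exists (proj y); last by rewrite circle_projK.
by apply/AB; rewrite circle_projK.
Qed.

Lemma lambda_pr (A : set (circle R)) (B : set R) : measurable B ->
  (forall p, A p <-> B (rep p)) -> lambda A = (pr B)%:E.
Proof.
move=> mB AB; have e := image_repE AB.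
have mI : measurable (B `&` [set` `[-1, 1[]).
  by apply: measurableI => //; exact: measurable_itv.
rewrite prE_circle e//; congr EFin; apply: eq_pr => y yI.
by split=> [[]//|By]; split=> //; rewrite /= in_itv.
Qed.

Lemma ball_bal (p q : circle R) (r : R) : -1 <= rep p - r -> rep p + r <= 1 ->
  ball p r q <-> bal (rep p) r (rep q).
Proof.
move=> h1 h2; rewrite ball_circleE balE /circle_dist gt_min.
have := circle_repP p; have := circle_repP q; move: h1 h2.
move: (circle_rep p) (circle_rep q) => a b h1 h2 aI bI.
rewrite distrC; split; last by move=> ->.
move=> /orP[//|]; case: (ler0P (b - a)) => ? ?; lra.
Qed.

(** [n] is the integer part of [t / r], so the event is that the hitting time is at least [n.+1],
    infinite values included. *)
Lemma hitting_time_gt (B : set (circle R)) (y : circle R) (t r : R) n :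
  0 < r -> n%:R * r <= t < n.+1%:R * r ->
  (t%:E < hitting_time T B y * r%:E)%E <->
  forall k, (0 < k <= n)%N -> ~ B (iter k T y).
Proof.
move=> r0 /andP[nt tn]; split.
  move=> ht k /andP[k0 kn] Bk.
  have h : (hitting_time T B y <= k%:R%:E)%E.
    by apply: ereal_inf_lbound; exists k.
  have : (hitting_time T B y * r%:E <= k%:R%:E * r%:E)%E.
    by rewrite lee_pmul2r// lte_fin.
  move=> /(lt_le_trans ht); rewrite -EFinM lte_fin ltNge => /negP; apply.
  by apply: le_trans nt; apply: ler_wpM2r; [exact: ltW|rewrite ler_nat].
move=> nB.
have h : (n.+1%:R%:E <= hitting_time T B y)%E.
  apply: le_ereal_inf_tmp => _ [k [k1 Bk] <-].
  rewrite lee_fin ler_nat ltnNge; apply/negP => kn.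
  by apply: (nB k); rewrite ?k1.
apply: (@lt_le_trans _ _ (n.+1%:R%:E * r%:E)%E); first by rewrite -EFinM lte_fin.
by rewrite lee_pmul2r// lte_fin.
Qed.

End exponential_law.

(** * Generic centres and convergence of both laws *)

Section conclusion.
Context {R : realType} (gamma : R) (gamma_gt1 : 1 < gamma).
Context (T : circle R -> circle R) (T_map : is_circle_map gamma T).
Local Notation rep := (@circle_rep R).
Local Notation S := (real_map T).
Local Notation wbranch := (wbranch gamma).

Let mS := measurable_real_map gamma_gt1 T_map.
Let S_branch := real_map_branch gamma_gt1 T_map.

Lemma open_setC1_circle (p : circle R) : open (~` [set p]).
Proof.
rewrite openE => q /= qp; apply/nbhs_ballP; exists (circle_dist q p) => /=.
  have := circle_repP p; have := circle_repP q => qI pI.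
  have d0 : 0 <= circle_dist q p.
    rewrite /circle_dist le_min normr_ge0 subr_ge0.
    by move: qI pI; case: (ler0P (rep q - rep p)) => ? *; lra.
  rewrite lt_neqAle d0 andbT; apply/eqP => e; apply: qp.
  exact: circle_dist_positivity.
by move=> x /ball_circleE h xp; move: h; rewrite xp ltxx.
Qed.

Lemma negligible_subsingleton (A : set (circle R)) :
  (forall p q, A p -> A q -> p = q) -> (@lambda R).-negligible A.
Proof.
move=> A1; have [[p Ap]|nA] := pselect (exists p, A p); last first.
  by exists set0; split=> // p Ap; apply: nA; exists p.
exists [set p]; split.
- rewrite -[X in measurable X]setCK; apply: measurableC.
  suff: <<s @open (circle R) >> (~` [set p]) by [].
  by apply: sub_sigma_algebra; exact: open_setC1_circle.
- by rewrite /lambda image_set1 lebesgue_measure_set1 mule0.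
- by move=> q Aq; exact: A1.
Qed.

(** Words are countable, and each one excludes a single end point and, [wbranch w] being a strict
    contraction, at most one periodic point. *)
Lemma negligible_nongeneric :
  (@lambda R).-negligible [set p | ~ generic gamma (rep p)].
Proof.
pose F (w : seq bool) := [set p | rep p = wbranch w (-1)].
pose G (w : seq bool) := [set p | w != [::] /\ wbranch w (rep p) = rep p].
pose H n := if unpickle n is Some w then F w `|` G w else set0.
apply: (@negligibleS _ _ _ _ (\bigcup_n H n)); last first.
  apply: negligible_bigcup => n; rewrite /H; case: unpickle => [w|]; last first.
    exact: negligible_set0.
  apply: negligibleU; apply: negligible_subsingleton => p q.
    by move=> fp fq; apply: val_inj; rewrite /= fp fq.
  move=> [w0 fp] [_ fq]; apply: val_inj => /=.
  have := circle_repP p; have := circle_repP q => qI pI.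
  apply/eqP; rewrite eq_le; apply/andP; split; rewrite leNgt; apply/negP => h.
    have := @wbranch_contr_lt _ _ gamma_gt1 w (rep q) (rep p) w0 ltac:(lra) h ltac:(lra).
    by rewrite fp fq ltxx.
  have := @wbranch_contr_lt _ _ gamma_gt1 w (rep p) (rep q) w0 ltac:(lra) h ltac:(lra).
  by rewrite fp fq ltxx.
move=> p /= ngp; apply: contrapT => nH; apply: ngp; split.
- exact: circle_repP.
- by move=> w pw; apply: nH; exists (pickle w) => //; rewrite /H pickleK; left.
- by move=> w w0 pw; apply: nH; exists (pickle w) => //; rewrite /H pickleK; right.
Qed.

Lemma generic_law_bound (p : circle R) (t e : R) : generic gamma (rep p) ->
  0 <= t -> 0 < e -> exists2 r0 : R, 0 < r0 & forall r, 0 < r < r0 ->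
  `|return_time_dist T p t r - expR (- t)| <= e /\
  `|hitting_time_dist T p t r - expR (- t)| <= e.
Proof.
move=> gp t0 e0; have [C C0 hC] := almost_indep gamma_gt1 mS S_branch gp.
(* The errors are [C * k <= e / 4] for comparing with the power of [1 - r], [e / 2] for comparing
   that power with the exponential, and once more [C * k] for the return law. *)
pose k := Num.min 1 (e / (4 * C)).
have C40 : 0 < 4 * C by rewrite mulr_gt0.
have [k0 k1 kC] : [/\ 0 < k, k <= 1 & C * k <= e / 4].
  split; rewrite /k ?lt_min ?ltr01 ?divr_gt0 ?ge_min ?lexx//.
  apply: (@le_trans _ _ (C * (e / (4 * C)))).
    by apply: ler_wpM2l; [exact: ltW|rewrite ge_min lexx orbT].
  by rewrite le_eqVlt; apply/orP; left; apply/eqP; field; rewrite gt_eqF.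
have [r1 r10 hr1] := hC k ltac:(by rewrite k0).
have t40 : 0 < 4 * (1 + t) by lra.
exists (Num.min r1 (Num.min 2^-1 (e / (4 * (1 + t))))).
  by rewrite !lt_min r10 invr_gt0 divr_gt0//; lra.
move=> r /andP[r0]; rewrite !lt_min => /and3P[rr1 r2 re].
have [x1 x2 ind] := hr1 r ltac:(by rewrite r0).
have [n nt] : exists n : nat, n%:R * r <= t < n.+1%:R * r.
  exists (Num.truncn (t / r)).
  rewrite -ler_pdivlMr// -ltr_pdivrMr//; apply: truncn_itv.
  by rewrite divr_ge0// ltW.
set B := bal (rep p) r in ind.
have mB : measurable B by exact: measurable_bal.
have mA i : measurable (avoid S B i) by exact: measurable_avoid.
have lB : lambda (ball p r) = r%:E.
  rewrite (lambda_pr mB); first by rewrite pr_bal.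
  by move=> q; exact: ball_bal.
have hitE q : (t%:E < hitting_time T (ball p r) q * r%:E)%E <->
    avoid S B n (rep q).
  have hE := hitting_time_gt T (ball p r) q r0 nt.
  split=> [/hE h i iI|h]; last apply/hE => i iI.
    by rewrite -iter_real_map => /(ball_bal _ x1 x2); exact: h.
  by move=> /(ball_bal _ x1 x2); rewrite iter_real_map; exact: h.
have FhE : hitting_time_dist T p t r = pr (avoid S B n).
  by rewrite /hitting_time_dist lB (lambda_pr (mA n)).
have FeE : return_time_dist T p t r = pr (B `&` avoid S B n) / r.
  rewrite /return_time_dist /cond_lambda lB (lambda_pr (B := B `&` avoid S B n))//.
    exact: measurableI.
  move=> q; split=> [[[bq hq] _]|[Bq Aq]].
    by split; [exact/(ball_bal _ x1 x2)|exact: (hitE q).1].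
  have bq : ball p r q by apply/(ball_bal _ x1 x2).
  by split=> //; split=> //; exact: (hitE q).2.
have Ck0 : 0 <= C * k by rewrite mulr_ge0 ?ltW.
have r10' : 0 <= 1 - r by lra.
(* Errors do not accumulate: a step multiplies the previous error by [1 - r] and adds at most
   [C * k * r]. *)
have pow i : `|pr (avoid S B i) - (1 - r) ^+ i| <= C * k.
  elim: i => [|i ih].
    rewrite expr0 (_ : pr _ = 1) ?subrr ?normr0//.
    by rewrite -pr_full; apply: eq_pr => y _; split=> // _ j; case: j.
  have := pr_avoid_drop gamma_gt1 mS S_branch i mB; have := ind i.
  move: ih; set a := pr (avoid S B i); set b := pr (avoid S B i.+1) => ih.
  move=> hd drop.
  have -> : b - (1 - r) ^+ i.+1 = (1 - r) * (a - (1 - r) ^+ i) -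
      (pr (B `&` avoid S B i) - r * a) by rewrite exprS -drop; ring.
  apply: le_trans (ler_normB _ _) _; rewrite normrM (ger0_norm r10').
  by have := ler_wpM2l r10' ih; lra.
have hn := pow n.
have hx := pow_expR_bound t0 r0 (ltW r2) nt.
have he : 2 * (1 + t) * r <= e / 2.
  by move: re; rewrite ltr_pdivlMr//; lra.
have hh : `|pr (avoid S B n) - expR (- t)| <= C * k + e / 2.
  have -> : pr (avoid S B n) - expR (- t) = (pr (avoid S B n) - (1 - r) ^+ n) +
    ((1 - r) ^+ n - expR (- t)) by ring.
  by apply: le_trans (ler_normD _ _) _; lra.
rewrite FhE FeE; split; last by lra.
have hr : `|pr (B `&` avoid S B n) / r - pr (avoid S B n)| <= C * k.
  have -> : pr (B `&` avoid S B n) / r - pr (avoid S B n) =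
      (pr (B `&` avoid S B n) - r * pr (avoid S B n)) / r.
    by field; rewrite gt_eqF.
  rewrite normrM normfV (gtr0_norm r0) ler_pdivrMr//; exact: ind.
have -> : pr (B `&` avoid S B n) / r - expR (- t) =
  (pr (B `&` avoid S B n) / r - pr (avoid S B n)) +
  (pr (avoid S B n) - expR (- t)) by ring.
by apply: le_trans (ler_normD _ _) _; lra.
Qed.

End conclusion.

Theorem proposition10 (R : realType) (gamma : R) (gamma_gt1 : 1 < gamma)
    (T : circle R -> circle R) (T_map : is_circle_map gamma T) :
  {ae @lambda R, forall x, forall t : R, 0 <= t ->
    (return_time_dist T x t r @[r --> 0^'+] --> expR (- t)) /\
    (hitting_time_dist T x t r @[r --> 0^'+] --> expR (- t))}.
Proof.
apply: (negligibleS _ (negligible_nongeneric gamma_gt1)) => x.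
apply: contra_not => /= gx t t0.
have bound e : 0 < e -> \forall r \near 0^'+,
    `|return_time_dist T x t r - expR (- t)| <= e /\
    `|hitting_time_dist T x t r - expR (- t)| <= e.
  move=> e0; have [r0 r00 h] := generic_law_bound gamma_gt1 T_map gx t0 e0.
  near=> r; apply: h; apply/andP; split; first by near: r; exact: nbhs_right_gt.
  by near: r; exact: nbhs_right_lt.
split; apply/cvgrPdist_le => e e0; near=> r; rewrite distrC.
  by near: r; apply: filterS (bound e e0) => r [].
by near: r; apply: filterS (bound e e0) => r [].
Unshelve. all: by end_near. Qed.
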